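(* Let $d=2$. Let $\mathbf{P}$ be a probability measure on $(\Omega_{\mathbb{Z}^2},\mathcal{F}_{\mathbb{Z}^2})$ such that: (i) under $\mathbf{P}$, writing $\omega^x(y)=\omega(x,x+y)$, the family $(\omega^x)_{x\in\mathbb{Z}^2}$ is i.i.d.; (ii) with $\mathbf{P}$-probability 1, the Markov chain induced by $\omega$ has only one infinite communicating class, and that class is reachable from every site; (iii) there is an $R>0$ such that with $\mathbf{P}$-probability 1, $\omega(x,y)=0$ whenever $|x-y|>R$. Let $\ell\in S^1$. Then $P^0(A_\ell)\in\{0,1\}$.
   Context: For a finite or countable set $V$, an environment on $V$ is a function $\omega:V\times V\to[0,1]$ with $\sum_{y\in V}\omega(x,y)=1$ for all $x\in V$; $\Omega_V$ is the set of all environments on $V$ and $\mathcal{F}_V$ is the Borel sigma-field of the product topology on $\Omega_V$. For $\omega\in\Omega_V$ and $x\in V$, the quenched measure $P_\omega^x$ on $V^{\mathbb{N}}$ (with $0\in\mathbb{N}$) is the law of the Markov chain $\mathbf{X}=(X_n)_{n\ge0}$ on $V$ started at $x$ with transition probabilities $\omega$, i.e. $P_\omega^x(X_0=x)=1$ and $P_\omega^x(X_{n+1}=y\mid X_0,\dots,X_n)=\omega(X_n,y)$. Given a probability measure $\mathbf{P}$ on $(\Omega_V,\mathcal{F}_V)$, the annealed measure $P^x$ on $\Omega_V\times V^{\mathbb{N}}$ is defined by $P^x(A\times B)=\int_A P_\omega^x(B)\,\mathbf{P}(d\omega)$; for $B\subset V^{\mathbb{N}}$ measurable, $P^x(B)$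 means $P^x(\Omega_V\times B)$. A site $y$ is reachable from $x$ under $\omega$ if there is a finite path from $x$ to $y$ each of whose steps has positive probability under $\omega$; communicating classes are the equivalence classes for mutual reachability. $S^{d-1}$ is the Euclidean unit sphere of $\mathbb{R}^d$, and for $\ell\in S^{d-1}$, $A_\ell=\{\mathbf{X}\in(\mathbb{Z}^d)^{\mathbb{N}}:\lim_{n\to\infty}X_n\cdot\ell=\infty\}$. *)

(* Defs.v *)
From HB Require Import structures.
From mathcomp Require Import all_boot all_order all_algebra finmap.
From mathcomp Require Import all_classical all_reals all_analysis.

Set Implicit Arguments.
Unset Strict Implicit.
Unset Printing Implicit Defensive.

Import Order.TTheory GRing.Theory Num.Theory.
Import numFieldNormedType.Exports.

Local Open Scope classical_set_scope.
Local Open Scope ring_scope.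

(* [prod_topology] comes without the pointed structure that
   [g_sigma_algebraType] requires. *)
HB.instance Definition _ (I : Type) (T : I -> ptopologicalType) :=
  Pointed.on (prod_topology T).

Definition borel (T : ptopologicalType) := g_sigma_algebraType (@open T).


Definition site (d : nat) := 'rV[int]_d.

HB.instance Definition _ d := GRing.Zmodule.on (site d).
HB.instance Definition _ d := Countable.on (site d).
HB.instance Definition _ d := isPointed.Build (site d) 0.

Record environment (d : nat) (R : realType) := Environment {
  env_fun :> site d * site d -> R;
  env_itv : forall xy, 0 <= env_fun xy <= 1;
  env_sum : forall x, (\esum_(y in [set: site d]) (env_fun (x, y))%:E = 1)%E }.

(* Environments have to be a pointed type; the default one never moves. *)
Section dirac_environment.
Context (d : nat) (R : realType).

Definition dirac_env_fun (xy : site d * site d) : R := (xy.1 == xy.2)%:R.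

Lemma dirac_env_itv xy : 0 <= dirac_env_fun xy <= 1.
Proof. by rewrite /dirac_env_fun; case: eqP => _; rewrite ?lexx ?ler01. Qed.

Lemma dirac_env_sum x :
  (\esum_(y in [set: site d]) (dirac_env_fun (x, y))%:E = 1)%E.
Proof.
rewrite -[RHS](@esum_set1 R (site d) x (fun=> 1%E)) ?lee01//.
rewrite [RHS]esum_mkcond; apply: eq_esum => y _; rewrite /dirac_env_fun/=.
case: ifPn => [|/negP]; rewrite inE/= => yx; first by rewrite yx eqxx.
by case: eqP => // xy; case: yx.
Qed.

Definition dirac_env : environment d R :=
  Environment dirac_env_itv dirac_env_sum.

HB.instance Definition _ := gen_eqMixin (environment d R).
HB.instance Definition _ := gen_choiceMixin (environment d R).
HB.instance Definition _ := isPointed.Build (environment d R) dirac_env.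

End dirac_environment.

(* The topology induced on environments by the product topology of
   R^(Z^d x Z^d). *)
HB.instance Definition _ d R := Topological.copy (environment d R)
  (initial_topology (fun w : environment d R =>
     (env_fun w : prod_topology (fun _ : site d * site d => R)))).

(* Z^d being countable and discrete, these events generate the product
   sigma-algebra on (Z^d)^N. *)
Definition path_events d : set (set (nat -> site d)) :=
  [set A | exists n x, A = [set X | X n = x]].

Definition path_space d := g_sigma_algebraType (@path_events d).


(* Existence of the Markov chain with given transition probabilities, sampled
   from one uniform variable u in [0, 1[: the first step is the cell of u in the
   partition of [0, 1[ into intervals of lengths p y, and the position of u
   inside its cell, rescaled to [0, 1[, drives the next steps. *)
Section sampling.
Context (V : countType) (R : realType).

Section step.
Variables (p : V -> R) (p0 : forall y, 0 <= p y)
  (p1 : (\esum_(y in [set: V]) (p y)%:E = 1)%E).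

Let q n := oapp p 0 (pickle_inv n).

Let F n := \sum_(k < n) q k.

Let q0 n : 0 <= q n. Proof. by rewrite /q; case: pickle_inv => /=. Qed.

Let F_nd m n : (m <= n)%N -> F m <= F n.
Proof.
move=> mn; rewrite /F -!(big_mkord xpredT q) [leRHS](big_cat_nat _ mn)//=.
by rewrite lerDl sumr_ge0.
Qed.

Let q_sum : (\sum_(0 <= n <oo) (q n)%:E = 1)%E.
Proof.
rewrite nneseries_esumT => [|n]; last by rewrite lee_fin.
rewrite -p1; transitivity
    (\esum_(n in [set choice.pickle y | y in [set: V]]) (q n)%:E)%E; last first.
  rewrite (esum_image [set: V] choice.pickle (fun n => (q n)%:E)); last first.
    by move=> y z _ _ /(pcan_inj (@choice.pickleK V)).
  by apply: eq_esum => y _; rewrite /q pickleK_inv.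
rewrite [RHS]esum_mkcond; apply: eq_esum => n _.
case: ifPn => // /negP nV; rewrite /q.
case E : (pickle_inv n) => [y|]//=; exfalso; apply: nV; rewrite inE.
by exists y => //; have := pickle_invK (T := V) n; rewrite E.
Qed.

Let F_lt u : u < 1 -> exists n, u < F n.
Proof.
move=> u1; apply: contrapT => /forallNP Fu.
suff : ((1 : R)%:E <= u%:E)%E by rewrite lee_fin leNgt u1.
rewrite -q_sum; apply: lime_le.
  by apply: is_cvg_nneseries => n _ _; rewrite lee_fin.
apply: nearW => n; rewrite /= sumEFin lee_fin leNgt big_mkord; apply/negP; exact: Fu.
Qed.

Let F_le1 n : F n <= 1.
Proof.
rewrite -lee_fin -q_sum /F -(big_mkord xpredT q) -sumEFin.
by apply: nneseries_lim_ge => k _; rewrite lee_fin.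
Qed.

Lemma sampler : exists g : R -> V * R, forall y, exists c,
  [/\ 0 <= c, c + p y <= 1 & forall u, 0 <= u < 1 ->
    ((g u).1 = y -> c <= u < c + p y /\ (g u).2 = (u - c) / p y) /\
    (c <= u < c + p y -> (g u).1 = y)].
Proof.
have [[v0 _]|noV] := pselect (exists v : V, True); last first.
  exfalso; move: p1.
  rewrite (_ : setT = set0) ?esum_set0; last first.
    by apply/seteqP; split => // v _; case: noV; exists v.
  by move/eqP; rewrite eqe eq_sym oner_eq0.
pose N u := xget 0%N [set n | F n <= u < F n.+1].
have NP u : 0 <= u < 1 -> F (N u) <= u < F (N u).+1.
  move=> /andP[u0 /F_lt ex]; rewrite /N; case: xgetP => [n _//|] noN.
  have [m mP mmin] := ex_minnP ex.
  case: m mP mmin => [|m] mP mmin.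
    by move: mP; rewrite /F big_ord0 ltNge u0.
  case: (noN m); rewrite /= mP andbT leNgt; apply/negP => /mmin.
  by rewrite ltnn.
have NU u n : 0 <= u < 1 -> F n <= u < F n.+1 -> N u = n.
  move=> /NP /andP[a b] /andP[c d]; apply/eqP; rewrite eqn_leq.
  apply/andP; split; rewrite leqNgt; apply/negP => /F_nd e.
    by have := lt_le_trans d (le_trans e a); rewrite ltxx.
  by have := lt_le_trans b (le_trans e c); rewrite ltxx.
have FS n : F n.+1 = F n + q n by rewrite /F big_ord_recr.
exists (fun u => (odflt v0 (pickle_inv (N u)), (u - F (N u)) / q (N u))) => y.
have qy : q (choice.pickle y) = p y by rewrite /q pickleK_inv.
exists (F (choice.pickle y)); split => [||u u01].
- exact: sumr_ge0.
- by rewrite -qy -FS.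
split => /= [|uF]; last by rewrite (NU _ (choice.pickle y)) ?FS ?qy// pickleK_inv.
have := NP _ u01; have := pickle_invK (T := V) (N u).
case E : (pickle_inv (N u)) => [v|]/=.
  by move=> <- uF vy; rewrite vy qy; split => //; rewrite FS vy qy in uF.
have qN : q (N u) = 0 by rewrite /q E.
by rewrite FS qN addr0 => _ /andP[+ /lt_le_trans] => /[swap] /[apply]; rewrite ltxx.
Qed.

End step.

Variables (w : V -> V -> R) (w0 : forall x y, 0 <= w x y)
  (w1 : forall x, (\esum_(y in [set: V]) (w x y)%:E = 1)%E).

Lemma chain_sampler x : exists f : R -> nat -> V, forall (z : nat -> V) n,
  exists a b, [/\ 0 <= a, a <= b, b <= 1,
    b - a = (z 0%N == x)%:R * \prod_(k < n) w (z k) (z k.+1) &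
    forall u, 0 <= u < 1 ->
      (forall k, (k <= n)%N -> f u k = z k) <-> a <= u < b].
Proof.
have [g gP] := choice (fun x => sampler (w0 x) (w1 x)).
pose st n s := iter n (fun s : V * R => g s.1 s.2) s.
exists (fun u n => (st n (x, u)).1) => z n.
elim: n z x => [|n IH] z x.
  rewrite big_ord0 mulr1; case: eqP => zx.
    exists 0, 1; split; rewrite ?subr0 ?ler01// => u u01.
    by split => // _ [|//] _ /=.
  exists 0, 0; split; rewrite ?subr0 ?ler01// => u u01.
  split => [/(_ 0%N isT)/= /esym//|/andP[a /(le_lt_trans a)]].
  by rewrite ltxx.
have [zx|zx] := eqVneq (z 0%N) x; last first.
  exists 0, 0; split; rewrite ?subr0 ?ler01 ?mul0r// => u u01.
  split => [/(_ 0%N isT)/= /esym/eqP|/andP[a /(le_lt_trans a)]].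
    by rewrite (negbTE zx).
  by rewrite ltxx.
have [a [b [a0 ab b1 bap IHP]]] := IH (fun k => z k.+1) (z 1%N).
have [c [c0 cp cP]] := gP x (z 1%N).
set pp := w x (z 1%N) in cp cP.
have pp0 : 0 <= pp by exact: w0.
exists (c + pp * a), (c + pp * b); split.
- by rewrite addr_ge0// mulr_ge0.
- by rewrite lerD2l ler_wpM2l.
- by apply: le_trans cp; rewrite lerD2l -[leRHS]mulr1 ler_wpM2l.
- rewrite opprD addrACA subrr add0r -mulrBr bap eqxx !mul1r.
  by rewrite big_ord_recl/= zx.
move=> u u01.
have stS k : st k.+1 (x, u) = st k (g x u).
  by rewrite /st iterSr.
have [ppE|ppn0] := eqVneq pp 0.
  rewrite ppE !mul0r addr0; split => [/(_ 1%N isT)|/andP[e /(le_lt_trans e)]].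
    by rewrite stS /= => /(cP u u01).1[]; rewrite ppE addr0 => /andP[e /(le_lt_trans e)];
     rewrite ltxx.
  by rewrite ltxx.
have pp_gt0 : 0 < pp by rewrite lt_neqAle eq_sym ppn0.
have tr (v := (u - c) / pp) : (a <= v < b) = (c + pp * a <= u < c + pp * b).
  by rewrite /v ler_pdivlMr// ltr_pdivrMr// lerBrDl ltrBlDl !(mulrC pp).
have inner : (g x u).1 = z 1%N -> (forall k, (k <= n)%N ->
    (st k (g x u)).1 = z k.+1) <-> c + pp * a <= u < c + pp * b.
  move=> g1; have [/andP[cu ucp] g2] := (cP u u01).1 g1.
  rewrite -tr -IHP; last first.
    by rewrite divr_ge0 ?subr_ge0//= ltr_pdivrMr// mul1r ltrBlDl.
  by rewrite -g2 -g1 -surjective_pairing.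
split => [H|H].
  have g1 : (g x u).1 = z 1%N by have := H 1%N isT; rewrite stS.
  by apply/(inner g1) => k kn; rewrite -stS; apply: H.
have g1 : (g x u).1 = z 1%N.
  apply: (cP u u01).2; move: H => /andP[H1 H2]; apply/andP; split.
    by apply: le_trans H1; rewrite lerDl mulr_ge0.
  by apply: lt_le_trans H2 _; rewrite lerD2l -[leRHS]mulr1 ler_wpM2l.
by case=> [//|k] kn; rewrite stS; apply: (inner g1).2.
Qed.

End sampling.

Section quenched.
Context (d : nat) (R : realType).
Implicit Types (w : environment d R) (mu : probability (path_space d) R).

(* P(X_{n+1} = y | X_0, ..., X_n) = w(X_n, y) in multiplied-out form, the
   conditioning variables being discrete: z lists the values of X_0, ..., X_n and
   y = z_{n+1}. *)
Definition markov_law w (x : site d) mu :=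
  mu [set X | X 0%N = x] = 1%E /\
  forall (z : nat -> site d) n,
    mu [set X | forall k, (k <= n.+1)%N -> X k = z k] =
    (mu [set X | forall k, (k <= n)%N -> X k = z k] * (w (z n, z n.+1))%:E)%E.

Lemma markov_law_exists w x : exists mu, markov_law w x mu.
Proof.
have [||f fP] := @chain_sampler (site d) R (fun x y => w (x, y)) _ _ x.
- by move=> a b; have /andP[] := env_itv w (a, b).
- exact: env_sum.
pose U : set R := `[0, 1[%classic.
have mU : measurable U by exact: measurable_itv.
have U01 u : U u <-> 0 <= u < 1 by rewrite /U/= in_itv.
pose Z z n : set R := [set u | U u /\ forall k, (k <= n)%N -> f u k = z k].
have ZP z n : exists a b, [/\ Z z n = `[a, b[%classic, a <= b &
    b - a = (z 0%N == x)%:R * \prod_(k < n) w (z k, z k.+1)].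
  have [a [b [a0 ab b1 bap H]]] := fP z n; exists a, b; split => //.
  apply/seteqP; split => u /=; rewrite in_itv/=.
    by move=> [/U01 u01 /(H u u01)].
  move=> aub; have u01 : 0 <= u < 1.
    by move: aub => /andP[au ub]; rewrite (le_trans a0 au)/= (lt_le_trans ub b1).
  by split; [exact/U01|exact/(H u u01)].
have mZ z n : measurable (Z z n).
  by have [a [b [-> _ _]]] := ZP z n; exact: measurable_itv.
have ZE z n : lebesgue_measure (Z z n) =
    ((z 0%N == x)%:R * \prod_(k < n) w (z k, z k.+1))%:E.
  have [a [b [-> ab <-]]] := ZP z n; rewrite lebesgue_measure_itv/= lte_fin.
  case: ltP => [_|ba]; first by rewrite EFinB.
  by rewrite (@le_anti _ _ a b) ?subrr// ab ba.
pose h (u : measurableTypeR R) : path_space d :=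
    f (if 0 <= (u : R) < 1 then u else 0).
have mh : measurable_fun [set: measurableTypeR R] h.
  apply: (@measurability _ _ (measurableTypeR R) (path_space d) _ h (@path_events d)) => // _ [_ [n [y ->]] <-].
  rewrite setTI (_ : _ @^-1` _ =
      \bigcup_(s in [set s : seq (site d) | nth y s n = y]) Z (nth y s) n `|`
      (if `[< f 0 n = y >] then ~` U else set0)); last first.
    apply/seteqP; split => u; rewrite /h/=.
      case: ifPn => u01 fu.
        left; exists (mkseq (f u) n.+1); first by rewrite /= nth_mkseq.
        by split => [|k kn]; [exact/U01|rewrite nth_mkseq].
      by right; case: asboolP => // _ /U01; exact/negP.
    move=> [[s /= sn [/U01 u01 us]]|]; first by rewrite u01 us.
    by case: asboolP => //= f0 /U01/negP/negbTE ->.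
  apply: measurableU; last by case: ifP => // _; exact: measurableC.
  rewrite bigcup_mkcond; apply: countable_bigcupT_measurable => [|s].
    exact: countableP.
  by case: ifP => // _; exact: mZ.
pose mu0 := mrestr (@lebesgue_measure R) mU.
have mu0T : mu0 setT = 1%E.
  by rewrite /mu0 /mrestr setTI /U lebesgue_measure_itv/= lte01 oppr0 adde0.
pose P0 : probability (measurableTypeR R) R := HB.pack mu0
  (Measure_isProbability.Build _ _ _ mu0 mu0T).
pose H : {mfun measurableTypeR R >-> path_space d} := HB.pack h (isMeasurableFun.Build _ _ _ _ h mh).
exists (distribution P0 H).
have hE z n : distribution P0 H [set X | forall k, (k <= n)%N -> X k = z k] =
    ((z 0%N == x)%:R * \prod_(k < n) w (z k, z k.+1))%:E.
  rewrite -ZE /distribution /pushforward/= /mu0 /mrestr; congr (_ _).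
  apply/seteqP; split => u /=; rewrite /h.
    by move=> [] + Uu; move: (Uu) => /U01 ->.
  by move=> [Uu]; move: (Uu) => /U01 ->.
split=> [|z n]; last first.
  apply: etrans (hE z n.+1) _; apply: etrans _ (congr1 (mule^~ _) (esym (hE z n))).
  by rewrite big_ord_recr/= -EFinM mulrA.
have := hE (fun=> x) 0%N; rewrite eqxx big_ord0 mulr1 => <-.
congr (_ _); apply/seteqP; split => X /=; last by move=> ->.
by move=> X0 [|].
Qed.

(* [markov_law w x] prescribes the probabilities of all cylinder sets, hence
   determines the measure; the choice below is the only one. *)
Definition quenched w x : probability (path_space d) R :=
  projT1 (cid (markov_law_exists w x)).

Lemma quenchedP w x : markov_law w x (quenched w x).
Proof. exact: projT2 (cid _). Qed.

End quenched.

(* annealed P x A B is P^x(A x B). *)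
Definition annealed d (R : realType)
    (P : probability (borel (environment d R)) R) (x : site d)
    (A : set (environment d R)) (B : set (path_space d)) : \bar R :=
  (\int[P]_(w in A) quenched w x B)%E.

Section iid.
Context d1 d2 (T1 : measurableType d1) (T2 : measurableType d2) (R : realType)
  (P : probability T1 R) (I : choiceType) (X : I -> T1 -> T2).

Definition mutually_independent :=
  forall (J : {fset I}) (B : I -> set T2),
    (forall i, i \in J -> measurable (B i)) ->
    P (\bigcap_(i in [set` J]) (X i @^-1` B i)) =
    (\prod_(i <- J) P (X i @^-1` B i))%E.

Definition identically_distributed :=
  forall i j (B : set T2), measurable B -> P (X i @^-1` B) = P (X j @^-1` B).

Definition iid := mutually_independent /\ identically_distributed.

End iid.

Definition local_env d (R : realType) (x : site d) (w : environment d R) :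
    borel (prod_topology (fun _ : site d => R)) :=
  fun y => w (x, x + y).

Section classes.
Context (d : nat) (R : realType) (w : environment d R).

(* The empty path is allowed, so every site is reachable from itself. *)
Definition reachable (x y : site d) : Prop :=
  exists2 s : seq (site d), path (fun a b => 0 < w (a, b)) x s & last x s = y.

Definition communicating_class (x : site d) : set (site d) :=
  [set y | reachable x y /\ reachable y x].

Definition infinite_communicating_classes : set (set (site d)) :=
  [set C | (exists x, C = communicating_class x) /\ infinite_set C].

Definition unique_infinite_class_reachable : Prop :=
  exists2 C, infinite_communicating_classes = [set C] &
    forall x, exists2 y, C y & reachable x y.

End classes.

Definition site_vec d (R : realType) (x : site d) : 'rV[R]_d := map_mx intr x.

Definition dot d (R : realType) (u v : 'rV[R]_d) : R := \sum_i u 0 i * v 0 i.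

(* The library's norm on row vectors is the sup norm. *)
Definition enorm d (R : realType) (u : 'rV[R]_d) : R := Num.sqrt (dot u u).

Definition unit_sphere d (R : realType) : set 'rV[R]_d :=
  [set u | enorm u = 1].
Arguments unit_sphere : clear implicits.

Definition directionally_transient d (R : realType) (l : 'rV[R]_d) :
    set (path_space d) :=
  [set X | dot (site_vec R (X n)) l @[n --> \oo] --> +oo].

(* Main.v *)
Require Import Defs.
From HB Require Import structures.
From mathcomp Require Import all_boot all_order all_algebra finmap.
From mathcomp Require Import all_classical all_reals all_analysis measurable_realfun.
From mathcomp Require Import zify ring lra.
Import Order.TTheory GRing.Theory Num.Theory.
Import numFieldNormedType.Exports.
Local Open Scope classical_set_scope.
Local Open Scope ring_scope.

Set Implicit Arguments.
Unset Strict Implicit.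
Unset Printing Implicit Defensive.

(** Let f be the inner product with l and t the inner product with the unit
    vector orthogonal to l.  The walk is described by its steps, and its height
    is the value of f at the sum of the steps performed so far: A_l is the event
    that the height of the walk from 0 tends to infinity.  Let A' be the event
    that it tends to minus infinity.  The zero-one law follows from two facts.

    First, if A_l has positive probability and A' is null, then A_l is almost
    sure ([transient_one]).  A walk that sets a record of height sees a fresh
    environment above it, so that with a probability bounded below it never
    goes under the record again; hence a walk which is unbounded above tends to
    infinity ([unbounded_not_transient_null]).  A walk which is bounded above
    tends to minus infinity ([bounded_not_down_null]).  Otherwise it would come
    infinitely often close to some bound.  At infinitely many new sites, a fixed
    step upwards would break the bound sooner or later; at a site visited
    infinitely often, so would a path to a site above the bound, which exists
    because the infinite class is reachable from everywhere and contains sites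
    of arbitrarily large height.  Both arguments use [repeated_trials].

    Secondly, in the plane, A_l and A' do not both have positive probability
    ([no_opposite_transience]).  Suppose that they do, and run in the same
    environment a walk from 0 that performs two successive climbs of height L
    and a walk from a site y, at height about 3 L, that performs two successive
    descents of depth L.  Successive climbs use disjoint parts of the
    environment, so the probabilities multiply and stay bounded below as L
    grows.  Since all sites are sums of possible steps, a climb can be deviated
    laterally by any amount at a bounded cost ([spread]).  A pigeonhole argument
    then yields a lateral position of y for which, with a probability bounded
    below, the two walks exchange sides laterally while their heights cross
    ([between_quadruples]).  Two such planar paths with bounded steps come close
    to each other ([grid_paths_meet]), and a short detour makes the second walk
    hit a site e of the first one ([forced_path]).  Let r be the quenched
    probability that the walk from e tends to infinity in the direction of l.
    If r < 1/2, the first walk has climbed far and yet is likely not to be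
    transient; if r >= 1/2, the second walk has descended far and yet is likely
    not to tend to minus infinity.  Both have small annealed probability for
    large L ([two_walks_bound], [reach_not_transient_small]), against the lower
    bound. *)

(** * Sums over countable types *)

Section countable_sums.
Context {R : realType} {T : countType}.
Local Open Scope ereal_scope.
Implicit Types (D : set T) (f : T -> \bar R).

(** Transfers what is known of series indexed by nat to sums over a countable
    type: each element contributes at its rank, and the ranks of no element
    contribute 0. *)
Lemma esum_pickle D f : (forall i, 0 <= f i) ->
  \esum_(i in D) f i =
  \sum_(0 <= n <oo) oapp (fun i => if i \in D then f i else 0) 0 (pickle_inv n).
Proof.
move=> f0; pose g i := if i \in D then f i else 0.
have g0 i : 0 <= g i by rewrite /g; case: ifP.
have q0 n : 0 <= oapp g 0 (pickle_inv n) by case: pickle_inv => /=.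
rewrite nneseries_esumT // esum_mkcond; transitivity
    (\esum_(n in [set choice.pickle y | y in [set: T]]) oapp g 0 (pickle_inv n)).
  rewrite (esum_image [set: T] choice.pickle (fun n => oapp g 0 (pickle_inv n))).
    by apply: eq_esum => y _; rewrite pickleK_inv.
  by move=> y z _ _ /(pcan_inj (@choice.pickleK T)).
rewrite esum_mkcond; apply: eq_esum => n _.
case: ifPn => // /negP nV.
case E : (pickle_inv n) => [y|]//=; exfalso; apply: nV; rewrite inE.
by exists y => //; have := pickle_invK (T := T) n; rewrite E.
Qed.

Lemma esumZl D f (c : R) : (0 <= c)%R -> (forall i, 0 <= f i) ->
  \esum_(i in D) (c%:E * f i) = c%:E * \esum_(i in D) f i.
Proof.
move=> c0 f0; rewrite !esum_pickle // => [|i]; last by rewrite mule_ge0.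
rewrite -nneseriesZl//; last by move=> n _; case: pickle_inv => //= i; case: ifP.
by apply: eq_eseriesr => n _; case: pickle_inv => /= [i|]; try case: ifP; rewrite ?mule0.
Qed.

Lemma esum_le_sub D D' f : (forall i, 0 <= f i) -> D `<=` D' ->
  \esum_(i in D) f i <= \esum_(i in D') f i.
Proof.
move=> f0 DD'; rewrite esum_mkcond [leRHS]esum_mkcond; apply: le_esum => i _.
case: ifPn => [|_]; last by case: ifP.
by rewrite inE => /DD' D'i; rewrite ifT ?inE.
Qed.

Lemma esum_le_inj (T' : choiceType) D (D' : set T') f (g : T' -> \bar R)
    (e : T -> T') : (forall i, 0 <= f i) -> (forall j, 0 <= g j) ->
  (forall i, D i -> D' (e i)) -> {in D &, injective e} ->
  (forall i, D i -> f i <= g (e i)) ->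
  \esum_(i in D) f i <= \esum_(j in D') g j.
Proof.
move=> f0 g0 eD einj fg.
apply: (@le_trans _ _ (\esum_(i in D) g (e i))); first exact: le_esum.
rewrite -(esum_image D e g) //.
rewrite esum_mkcond [leRHS]esum_mkcond; apply: le_esum => i _.
case: ifPn => [|_]; last by case: ifP.
by rewrite inE => -[j Dj <-]; rewrite ifT ?inE//; exact: eD.
Qed.

Context d (X : measurableType d) (mu : {measure set X -> \bar R}).

Lemma measurable_countable_bigcup D (F : T -> set X) :
  (forall i, measurable (F i)) -> measurable (\bigcup_(i in D) F i).
Proof.
move=> mF; rewrite bigcup_mkcond; apply: countable_bigcupT_measurable => [|i].
  exact: countableP.
by case: ifP.
Qed.

Lemma null_countable_bigcup (F : T -> set X) (B : set X) : measurable B ->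
  (forall i, measurable (F i)) -> (forall i, mu (F i) = 0) ->
  B `<=` \bigcup_i F i -> mu B = 0.
Proof.
move=> mB mF F0 BF; apply/eqP; rewrite eq_le measure_ge0 andbT.
pose G n := oapp F set0 (pickle_inv n).
have mG n : measurable (G n) by rewrite /G; case: pickle_inv => /=.
apply: (@le_trans _ _ (\sum_(0 <= n <oo) mu (G n))).
  apply: measure_sigma_subadditive => // x /BF[i _ Fix].
  by exists (choice.pickle i) => //; rewrite /G pickleK_inv.
by rewrite eseries0// => n _ _; rewrite /G; case: pickle_inv => [i|] /=; rewrite ?measure0.
Qed.

Lemma measurable_esum D (f : T -> X -> \bar R) :
  (forall i x, 0 <= f i x) -> (forall i, measurable_fun setT (f i)) ->
  measurable_fun setT (fun x => \esum_(i in D) f i x).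
Proof.
move=> f0 mf; have -> : (fun x => \esum_(i in D) f i x) = fun x => \sum_(0 <= n <oo)
    oapp (fun i => if i \in D then f i x else 0) 0 (pickle_inv n).
  by apply/funext => x; rewrite esum_pickle.
apply: (ge0_emeasurable_sum (P := xpredT)) => [n x _ _|n _]; case: pickle_inv => //= i.
  by case: ifP.
by case: (i \in D).
Qed.

Lemma ge0_integral_esum D (f : T -> X -> \bar R) :
  (forall i x, 0 <= f i x) -> (forall i, measurable_fun setT (f i)) ->
  \int[mu]_x (\esum_(i in D) f i x) = \esum_(i in D) \int[mu]_x f i x.
Proof.
move=> f0 mf; rewrite esum_pickle => [|i]; last exact: integral_ge0.
under eq_integral do rewrite esum_pickle //.
rewrite integral_nneseries //; last 2 first.
- by move=> n; case: pickle_inv => //= i; case: (i \in D).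
- by move=> n x _; case: pickle_inv => //= i; case: ifP.
apply: eq_eseriesr => n _; case: pickle_inv => /= [i|]; last by rewrite integral0.
by case: (i \in D) => //; rewrite integral0.
Qed.

Lemma measure_bigcup_esum D (F : T -> set X) :
  trivIset D F -> (forall i, measurable (F i)) ->
  mu (\bigcup_(i in D) F i) = \esum_(i in D) mu (F i).
Proof.
move=> tF mF; rewrite esum_pickle//.
pose G n := oapp (fun i => if i \in D then F i else set0) set0 (pickle_inv n).
have mG n : measurable (G n).
  by rewrite /G; case: pickle_inv => //= i; case: ifP.
have -> : \bigcup_(i in D) F i = \bigcup_n G n.
  apply/seteqP; split => x.
    move=> [i Di Fix]; exists (choice.pickle i) => //.
    by rewrite /G pickleK_inv /= ifT ?inE.
  move=> [n _]; rewrite /G; case: pickle_inv => //= i.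
  by case: ifPn => // /[!inE] Di Fix; exists i.
rewrite measure_bigcup //; last first.
  move=> n m _ _ [x []]; rewrite /G.
  have := pickle_invK (T := T) n; case: pickle_inv => //= i <-.
  have := pickle_invK (T := T) m; case: pickle_inv => //= j <-.
  case: ifPn => [/[!inE] Di Fi|//]; case: ifPn => [/[!inE] Dj Fj|//].
  by congr choice.pickle; apply: tF => //; exists x.
rewrite [LHS](_ : _ = \sum_(0 <= n <oo) mu (G n)); last first.
  by apply: eq_eseriesl => n; rewrite in_setT.
apply: eq_eseriesr => n _; rewrite /G; case: pickle_inv => /= [i|].
  by case: (i \in D) => //; exact: measure0.
exact: measure0.
Qed.

End countable_sums.

(** * Words of steps and cylinders *)

Definition wsum d (s : seq (site d)) : site d := \sum_(v <- s) v.

Definition cyl d (s : seq (site d)) : set (path_space d) :=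
  [set Z | forall k, (k < size s)%N -> Z k = nth 0 s k].

Definition prefix_of d (Z : path_space d) n : seq (site d) := mkseq Z n.

Definition increments d (X : path_space d) : path_space d :=
  fun k => X k.+1 - X k.

Definition shiftp d n (Z : path_space d) : path_space d := fun k => Z (n + k)%N.

Section words.
Context {d : nat}.
Local Notation V := (site d).
Implicit Types (s t : seq V) (x : V) (Z : path_space d).

Lemma wsum_nil : wsum (d := d) [::] = 0. Proof. by rewrite /wsum big_nil. Qed.

Lemma wsum_cons v s : wsum (v :: s) = v + wsum s.
Proof. by rewrite /wsum big_cons. Qed.

Lemma wsum_cat s t : wsum (s ++ t) = wsum s + wsum t.
Proof. by rewrite /wsum big_cat. Qed.

Lemma wsum_rcons s v : wsum (rcons s v) = wsum s + v.
Proof. by rewrite -cats1 wsum_cat wsum_cons wsum_nil addr0. Qed.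

Lemma wsum_take_nth s k : (k < size s)%N ->
  wsum (take k.+1 s) = wsum (take k s) + nth 0 s k.
Proof. by move=> ks; rewrite (take_nth 0)// wsum_rcons. Qed.

Lemma size_prefix_of Z n : size (prefix_of Z n) = n.
Proof. exact: size_mkseq. Qed.

Lemma nth_prefix_of Z n k : (k < n)%N -> nth 0 (prefix_of Z n) k = Z k.
Proof. by move=> kn; rewrite /prefix_of nth_mkseq. Qed.

Lemma cylP s Z : cyl s Z <-> prefix_of Z (size s) = s.
Proof.
split=> [sZ|sZ k ks]; last by rewrite -sZ nth_mkseq.
apply: (@eq_from_nth _ 0); rewrite size_mkseq// => k ks.
by rewrite nth_mkseq// sZ.
Qed.

Lemma cyl_prefix Z n : cyl (prefix_of Z n) Z.
Proof. by apply/cylP; rewrite size_mkseq. Qed.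

Lemma take_prefix_of Z n m : (n <= m)%N -> take n (prefix_of Z m) = prefix_of Z n.
Proof.
move=> nm; apply: (@eq_from_nth _ 0); rewrite size_takel ?size_mkseq// => k kn.
by rewrite nth_take// !nth_mkseq// (leq_trans kn).
Qed.

Lemma cyl_nil : cyl (d := d) [::] = setT.
Proof. by apply/seteqP; split. Qed.

Lemma cyl_cat s t : cyl (s ++ t) = cyl s `&` (shiftp (size s) @^-1` cyl t).
Proof.
apply/seteqP; split => Z; rewrite /cyl/= size_cat.
  move=> st; split => k ks.
    by rewrite st ?ltn_addr// nth_cat ks.
  by rewrite /shiftp st ?ltn_add2l// nth_cat ltnNge leq_addr/= addKn.
move=> [sZ tZ] k kst; rewrite nth_cat; case: ltnP => [ks|sk]; first exact: sZ.
by rewrite -{1}(subnKC sk) -[LHS]/(shiftp _ _ _) tZ// ltn_subLR.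
Qed.

Lemma cyl_comparable s t Z : (size s <= size t)%N -> cyl s Z -> cyl t Z ->
  s = take (size s) t.
Proof.
by move=> st /cylP <- /cylP <-; rewrite !size_mkseq take_prefix_of.
Qed.

Lemma cyl_take s n : cyl s `<=` cyl (take n s).
Proof.
move=> Z sZ k; rewrite size_take_min leq_min => /andP[kn ks].
by rewrite sZ// nth_take.
Qed.

Lemma measurable_coord n x : measurable ([set Z | Z n = x] : set (path_space d)).
Proof. by apply: sub_sigma_algebra; exists n, x. Qed.

Lemma measurable_cyl s : measurable (cyl s).
Proof.
rewrite (_ : cyl s = \bigcap_(k in [set k | (k < size s)%N])
    [set Z | Z k = nth 0 s k]) //.
case: s => [|v s].
  by rewrite [X in measurable X](_ : _ = setT)//; apply/seteqP; split.
apply: bigcap_measurable; first by exists 0%N.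
by move=> k _; exact: measurable_coord.
Qed.

Definition cyls : set (set (path_space d)) := [set A | A = set0 \/ exists s, A = cyl s].

Lemma path_measurableE : @measurable _ (path_space d) = <<s cyls >>.
Proof.
apply/seteqP; split; last first.
  apply: smallest_sub; first exact: sigma_algebra_measurable.
  by move=> A [->|[s ->]] //; exact: measurable_cyl.
apply: smallest_sub; first exact: smallest_sigma_algebra.
move=> _ [n [x ->]].
pose T := g_sigma_algebraType cyls.
have -> : [set X : nat -> V | X n = x] =
    \bigcup_(s in [set s | size s = n.+1 /\ nth 0 s n = x]) cyl s.
  apply/seteqP; split=> X /=.
    move=> Xn; exists (prefix_of X n.+1); last exact: cyl_prefix.
    split; [exact: size_prefix_of|by rewrite nth_prefix_of].
  by move=> [s [/= ss <-]] sX; rewrite sX ?ss.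
rewrite bigcup_mkcond.
apply: (@countable_bigcupT_measurable _ T _) => [|s]; first exact: countableP.
case: ifP => [_|_]; last exact: (@measurable0 _ T).
by apply: (@sub_sigma_algebra _ _ cyls); right; exists s.
Qed.

Lemma cyls_setI : setI_closed cyls.
Proof.
move=> A B [->|[s ->]]; first by left; rewrite set0I.
move=> [->|[t ->]]; first by left; rewrite setI0.
wlog st : s t / (size s <= size t)%N.
  move=> H; have [/H//|/ltnW/H] := leqP (size s) (size t).
  by rewrite setIC.
have [ts|ts] := pselect (s = take (size s) t).
  right; exists t; apply/seteqP; split=> [Z []//|Z tZ]; split => //.
  by rewrite ts; exact: cyl_take.
left; apply/seteqP; split => // Z [sZ tZ]; apply: ts.
exact: (cyl_comparable st sZ tZ).
Qed.

(** The cylinders, together with the empty set, form a pi-system that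
    generates the sigma-algebra of paths; hence the law of a walk is
    determined by the probabilities of finite words. *)
Lemma path_measure_unique (R : realType) (m1 m2 : {measure set (path_space d) -> \bar R}) :
  (m1 setT < +oo)%E -> (forall s, m1 (cyl s) = m2 (cyl s)) ->
  forall A, measurable A -> m1 A = m2 A.
Proof.
move=> m1oo m12; apply: (measure_unique cyls (fun=> setT)).
- exact: path_measurableE.
- exact: cyls_setI.
- by move=> _; right; exists [::]; rewrite cyl_nil.
- by apply/seteqP; split => // x _; exists 0%N.
- by move=> B [->|[s ->]]; rewrite ?measure0.
- by [].
Qed.

Lemma measurable_path_map (f : path_space d -> path_space d) :
  (forall n x, measurable (f @^-1` [set Z | Z n = x])) ->
  measurable_fun setT f.
Proof.
move=> mf; apply: (@measurability _ _ _ _ _ f (@path_events d)) => //.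
by move=> _ [_ [n [x ->]] <-]; rewrite setTI.
Qed.

Lemma measurable_increments : measurable_fun setT (@increments d).
Proof.
apply: measurable_path_map => n x.
rewrite (_ : _ @^-1` _ = \bigcup_(y in setT)
   ([set Z : path_space d | Z n = y] `&` [set Z | Z n.+1 = x + y])).
  by apply: measurable_countable_bigcup => y; apply: measurableI; exact: measurable_coord.
apply/seteqP; split=> Z /=; rewrite /increments.
  by move=> <-; exists (Z n) => //; split => //=; rewrite subrK.
by move=> [y _ [/= -> ->]]; rewrite addrK.
Qed.

Lemma measurable_shiftp n : measurable_fun setT (@shiftp d n).
Proof. by apply: measurable_path_map => k x; exact: measurable_coord. Qed.

Lemma measurable_shift_preimage n (B : set (path_space d)) : measurable B ->
  measurable (shiftp n @^-1` B).
Proof. by rewrite -[X in _ -> measurable X]setTI; exact: measurable_shiftp. Qed.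

End words.

(** * The quenched law of the steps *)

HB.instance Definition _ d :=
  isMeasurableFun.Build _ _ _ _ (@increments d) measurable_increments.

(** The events of interest depend on the walk through its steps, and, unlike
    words of sites, words of steps can be moved from one starting site to
    another. *)
Definition quenched_inc d (R : realType) (w : environment d R) (x : site d) :
  probability (path_space d) R := distribution (quenched w x) (@increments d).

Fixpoint path_prob d (R : realType) (w : environment d R) (x : site d) (s : seq (site d)) : R :=
  if s is v :: s' then w (x, x + v) * path_prob w (x + v) s' else 1.

(** The sites at which the environment has an influence on path_prob w x s:
    the endpoint of the walk is not one of them. *)
Fixpoint departures d (x : site d) (s : seq (site d)) : seq (site d) :=
  if s is v :: s' then x :: departures (x + v) s' else [::].

Lemma measureI_probability1 dT (T : measurableType dT) (R : realType)
    (m : probability T R) (A B : set T) : measurable A -> measurable B ->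
  m B = 1%E -> m (A `&` B) = m A.
Proof.
move=> mA mB mB1.
have AE : m A = (m (A `\` B) + m (A `&` B))%E by exact: measureDI.
suff AB0 : m (A `\` B) = 0%E by rewrite AE AB0 add0e.
apply/eqP; rewrite -measure_le0.
apply: (@le_trans _ _ (m (~` B))).
  apply: le_measure; rewrite ?inE; [exact: measurableD|exact: measurableC|].
  by move=> x [].
by rewrite probability_setC// mB1 subee.
Qed.

Section quenched_increments.
Context {d : nat} {R : realType}.
Local Notation V := (site d).
Implicit Types (w : environment d R) (s t : seq V) (x y : V).

Lemma path_prob_cat w x s t : path_prob w x (s ++ t) = path_prob w x s * path_prob w (x + wsum s) t.
Proof.
elim: s x => [|v s IH] x /=; first by rewrite wsum_nil addr0 mul1r.
by rewrite IH wsum_cons mulrA addrA.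
Qed.

Lemma env_ge0 w xy : 0 <= w xy. Proof. by have /andP[] := env_itv w xy. Qed.
Lemma env_le1 w xy : w xy <= 1. Proof. by have /andP[] := env_itv w xy. Qed.

Lemma path_prob_ge0 w x s : 0 <= path_prob w x s.
Proof. by elim: s x => //= v s IH x; rewrite mulr_ge0// env_ge0. Qed.

Lemma path_prob_le1 w x s : path_prob w x s <= 1.
Proof.
elim: s x => //= v s IH x.
by rewrite -[leRHS]mulr1 ler_pM ?env_ge0 ?env_le1 ?path_prob_ge0.
Qed.

Lemma departures_cat x s t : departures x (s ++ t) = departures x s ++ departures (x + wsum s) t.
Proof.
elim: s x => [|v s IH] x /=; first by rewrite wsum_nil addr0.
by rewrite IH wsum_cons addrA.
Qed.

Lemma departuresP x s y :
  reflect (exists2 k, (k < size s)%N & y = x + wsum (take k s)) (y \in departures x s).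
Proof.
elim: s x y => [|v s IH] x y /=; first by apply: (iffP idP) => [//|[]].
rewrite in_cons; apply: (iffP orP) => [[/eqP ->|/IH[k ks ->]]|[[|k] ks ->]].
- by exists 0%N => //; rewrite take0 wsum_nil addr0.
- by exists k.+1 => //=; rewrite wsum_cons addrA.
- by left; rewrite take0 wsum_nil addr0.
- by right; apply/IH; exists k => //=; rewrite wsum_cons addrA.
Qed.

Lemma quenched_path w (z : nat -> V) n :
  quenched w (z 0%N) [set X | forall k, (k <= n)%N -> X k = z k] =
  (\prod_(k < n) w (z k, z k.+1))%:E.
Proof.
have [P0 PS] := quenchedP w (z 0%N).
elim: n => [|n IH]; last first.
  by rewrite PS IH big_ord_recr /= EFinM.
rewrite big_ord0 -P0; congr (quenched _ _ _); apply/seteqP; split => X /=.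
  exact.
by move=> X0 [|].
Qed.

Lemma path_prob_prod w x s :
  path_prob w x s = \prod_(k < size s) w (x + wsum (take k s), x + wsum (take k.+1 s)).
Proof.
elim: s x => [|v s IH] x /=; first by rewrite big_ord0.
rewrite IH big_ord_recl /= take0 wsum_nil addr0 wsum_cons wsum_nil addr0.
by congr (_ * _); apply: eq_bigr => i _; rewrite !wsum_cons !addrA.
Qed.

(** As the walk almost surely starts at x, its first steps and its first
    positions determine each other. *)
Lemma quenched_inc_cyl w x s : quenched_inc w x (cyl s) = (path_prob w x s)%:E.
Proof.
pose z k := x + wsum (take k s).
have z0 : z 0%N = x by rewrite /z take0 wsum_nil addr0.
have := quenched_path w z (size s); rewrite z0 -path_prob_prod => <-.
have [x0 _] := quenchedP w x.
have m0 : measurable [set X : path_space d | X 0%N = x] by exact: measurable_coord.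
have mI : measurable (@increments d @^-1` cyl s).
  by rewrite -[X in measurable X]setTI; apply: measurable_increments => //; exact: measurable_cyl.
transitivity (quenched w x (@increments d @^-1` cyl s)); first by [].
rewrite -(measureI_probability1 mI m0 x0).
congr (quenched _ _ _); apply/seteqP; split => X /=; last first.
  move=> Xz; split; last by rewrite Xz// z0.
  move=> k ks; rewrite /increments !Xz ?(ltnW ks)// /z wsum_take_nth//.
  by rewrite addrA [_ + nth 0 s k]addrC addrK.
move=> [Xs X0]; elim => [|k IH] ks; first by rewrite z0.
have := Xs _ ks; rewrite /increments IH ?(ltnW ks)// => /eqP.
by rewrite subr_eq => /eqP ->; rewrite addrC /z wsum_take_nth// addrA.
Qed.

End quenched_increments.

(** * Markov property and local environments *)

Section environment_law.
Context {d : nat} {R : realType}.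
Local Notation V := (site d).
Local Notation E := (borel (environment d R)).
Implicit Types (w : environment d R) (s t : seq V) (x y : V).

(** The Markov property after a finite word: both members are finite measures
    in B, and they agree on cylinders. *)
Lemma quenched_inc_markov w x s B : measurable B ->
  quenched_inc w x (cyl s `&` shiftp (size s) @^-1` B) =
  ((path_prob w x s)%:E * quenched_inc w (x + wsum s)%R B)%E.
Proof.
move=> mB.
pose m1 := pushforward (mrestr (quenched_inc w x) (measurable_cyl s)) (@shiftp d (size s)).
have r0 : 0 <= path_prob w x s by exact: path_prob_ge0.
pose m2 := mscale (NngNum r0) (quenched_inc w (x + wsum s)).
have -> : quenched_inc w x (cyl s `&` shiftp (size s) @^-1` B) = m1 B.
  by rewrite /m1 /pushforward /mrestr setIC.
rewrite -[RHS]/(m2 B).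
apply: path_measure_unique => //; first exact: measurable_shiftp.
- move=> m; rewrite /= /m1 /pushforward /mrestr /= preimage_setT setTI quenched_inc_cyl.
  exact: ltry.
- move=> m t; rewrite /= /m1 /m2 /pushforward /mrestr /mscale /= setIC -cyl_cat.
  by rewrite !quenched_inc_cyl path_prob_cat EFinM.
Qed.

Lemma continuous_env_fun : continuous (fun w : environment d R =>
  (env_fun w : prod_topology (fun _ : V * V => R))).
Proof. exact: (@initial_continuous (environment d R) _ (fun w : environment d R =>
  (env_fun w : prod_topology (fun _ : V * V => R)))). Qed.

Lemma continuous_env_coord xy : continuous (fun w : environment d R => w xy : R).
Proof.
move=> w; apply: (@continuous_comp _ _ _ (fun w : environment d R =>
  (env_fun w : prod_topology (fun _ : V * V => R))) (proj xy)).
  exact: continuous_env_fun.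
exact: proj_continuous.
Qed.

Lemma borel_continuous_measurable (T : ptopologicalType) (f : T -> R) :
  continuous f -> measurable_fun setT (f : borel T -> R).
Proof.
move=> cf; apply: (measurability _ (RGenOpens.measurableE R)).
move=> _ [_ [a [b ->] <-]]; rewrite setTI.
apply: sub_sigma_algebra; move/continuousP: cf; apply.
exact: interval_open.
Qed.

Lemma measurable_env_coord xy :
  measurable_fun setT (fun w : E => (w : environment d R) xy).
Proof.
apply: (@borel_continuous_measurable (environment d R) (fun w => w xy)).
exact: continuous_env_coord.
Qed.

(** For the product topologies, the local environment is a continuous
    function of the environment. *)
Lemma measurable_local_env x : measurable_fun setT (@local_env d R x : E -> _).
Proof.
apply: (measurability _ (erefl (measurable : set (set (borel
  (prod_topology (fun _ : V => R))))))).
move=> _ [B oB <-]; rewrite setTI; apply: sub_sigma_algebra.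
suff : continuous (fun w : environment d R =>
   (local_env x w : prod_topology (fun _ : V => R))) by move/continuousP; apply.
move=> w; apply/cvg_sup; first exact/fmap_filter/(nbhs_filter w).
move=> y; move: w; apply/(@continuousP _ (initial_topology (@^~ y))).
move=> _ [C oC <-].
have /continuousP cxy := continuous_env_coord (xy := (x, x + y)).
exact: (cxy C oC).
Qed.

(** * The annealed law of the steps *)

Lemma measurable_path_prob x s :
  measurable_fun setT (fun w : E => path_prob w x s).
Proof.
elim: s x => [|v s IH] x /=; first exact: measurable_cst.
by apply: measurable_funM; [exact: measurable_env_coord|exact: IH].
Qed.

Lemma measurable_path_probE x s :
  measurable_fun setT (fun w : E => (path_prob w x s)%:E).
Proof. by apply/measurable_EFinP; exact: measurable_path_prob. Qed.

(** By a Dynkin argument from the cylinders, whose quenched probability is a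
    finite product of coordinates of the environment. *)
Lemma measurable_quenched_inc x B : measurable B ->
  measurable_fun setT (fun w : E => quenched_inc w x B).
Proof.
move=> mB; move: (mB); rewrite (path_measurableE (d := d)); move: B {mB}.
apply: (dynkin_induction (T := path_space d) (G := cyls (d := d))).
- exact: path_measurableE.
- exact: cyls_setI.
- rewrite (_ : (fun w : E => _) = cst 1%E); first exact: measurable_cst.
  by apply/funext => w; rewrite probability_setT.
- move=> B [->|[s ->]].
    rewrite (_ : (fun w : E => _) = cst 0%E); first exact: measurable_cst.
    by apply/funext => w; rewrite measure0.
  rewrite (_ : (fun w : E => _) = fun w : E => (path_prob w x s)%:E).
    exact: measurable_path_probE.
  by apply/funext => w; rewrite quenched_inc_cyl.
- move=> B mB mf.
  rewrite (_ : (fun w : E => _) = fun w : E => (1 - quenched_inc w x B)%E).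
    by apply: emeasurable_funB => //; exact: measurable_cst.
  by apply/funext => w; rewrite probability_setC.
- move=> F mF tF mf.
  rewrite (_ : (fun w : E => _) = fun w : E =>
      (\sum_(0 <= n <oo) quenched_inc w x (F n))%E).
    exact: (ge0_emeasurable_sum (P := xpredT)).
  by apply/funext => w; rewrite measure_semi_bigcup//; exact: bigcupT_measurable.
Qed.

Context (P : probability E R).

Definition annealed_inc x (B : set (path_space d)) : \bar R :=
  \int[P]_w quenched_inc w x B.

Section annealed_measure.
Variable x : V.

Let ann0 : annealed_inc x set0 = 0%E.
Proof. by rewrite /annealed_inc; under eq_integral do rewrite measure0; rewrite integral0. Qed.

Let ann_ge0 B : (0 <= annealed_inc x B)%E.
Proof. exact: integral_ge0. Qed.

Let ann_sigma : semi_sigma_additive (annealed_inc x).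
Proof.
move=> F mF tF mUF.
rewrite (_ : annealed_inc x (\bigcup_n F n) = (\sum_(0 <= n <oo) annealed_inc x (F n))%E).
  exact: is_cvg_ereal_nneg_natsum.
rewrite /annealed_inc -integral_nneseries//.
  by apply: eq_integral => w _; rewrite measure_semi_bigcup.
by move=> n; exact: measurable_quenched_inc.
Qed.

HB.instance Definition _ := isMeasure.Build _ _ _ (annealed_inc x) ann0 ann_ge0 ann_sigma.

Let annT : annealed_inc x setT = 1%E.
Proof.
rewrite /annealed_inc; under eq_integral do rewrite probability_setT.
by rewrite integral_cst//= mul1e probability_setT.
Qed.

HB.instance Definition _ := Measure_isProbability.Build _ _ _ (annealed_inc x) annT.

End annealed_measure.

End environment_law.

(** * Independence of disjoint parts of the environment *)

(** The cylinder events of the family of local environments at the sites of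
    A, a pi-system. *)
Definition site_events d (R : realType) (A : set (site d)) : set (set (environment d R)) :=
  [set G | exists (J : {fset site d})
     (B : site d -> set (borel (prod_topology (fun _ : site d => R)))),
     [/\ forall i, i \in J -> A i, forall i, measurable (B i) &
         G = \bigcap_(i in [set` J]) (@local_env d R i @^-1` B i)]].

(** A measurable function on this type is a function of the environment at
    the sites of A. *)
Definition env_on d (R : realType) (A : set (site d)) :=
  g_sigma_algebraType (@site_events d R A).

Section independence.
Context {d : nat} {R : realType}.
Local Notation V := (site d).
Local Notation E := (borel (environment d R)).
Implicit Types (w : environment d R) (s t : seq V) (x y : V) (A B : set V).

Lemma measurable_local_preimage x (C : set (borel (prod_topology (fun _ : V => R)))) :
  measurable C -> measurable ((@local_env d R x : E -> _) @^-1` C).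
Proof. by move=> mC; rewrite -[X in measurable X]setTI; exact: measurable_local_env. Qed.

Lemma site_events_sub A : @site_events d R A `<=` (@measurable _ E).
Proof.
move=> _ [J [B [_ mB ->]]].
apply: fin_bigcap_measurable => [|i _]; first exact: finite_fset.
exact: measurable_local_preimage.
Qed.

Lemma site_events_setI A : setI_closed (@site_events d R A).
Proof.
move=> _ _ [J1 [B1 [J1A mB1 ->]]] [J2 [B2 [J2A mB2 ->]]].
exists (J1 `|` J2)%fset, (fun i => (if i \in J1 then B1 i else setT) `&`
                                   (if i \in J2 then B2 i else setT)); split.
- by move=> i; rewrite in_fsetU => /orP[/J1A|/J2A].
- move=> i; apply: measurableI; first by case: (i \in J1).
  by case: (i \in J2).
apply/seteqP; split=> [w [w1 w2] i /= _|w w12]; last split=> i /= iJ.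
- by split; case: ifPn => //= iJ; [exact: w1|exact: w2].
- by have [] := w12 i; rewrite /= ?in_fsetU iJ.
- by have [] := w12 i; rewrite /= ?in_fsetU iJ ?orbT.
Qed.

Lemma site_events_setT A : site_events A (setT : set (environment d R)).
Proof.
exists fset0, (fun=> setT); split => //.
by apply/seteqP; split.
Qed.

Lemma measurable_to_env_on A : measurable_fun setT (id : E -> env_on R A).
Proof.
apply: (measurability _ (erefl (measurable : set (set (env_on R A))))).
by move=> _ [C CA <-]; rewrite setTI; exact: (site_events_sub CA).
Qed.

Lemma env_on_sub A (G : set (environment d R)) :
  (<<s site_events A >>) G -> (@measurable _ E) G.
Proof.
by move=> mG; have := @measurable_to_env_on A measurableT G mG; rewrite setTI.
Qed.

Lemma measurable_env_on_coord A x v : A x ->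
  measurable_fun setT (fun w : env_on R A => (w : environment d R) (x, x + v)).
Proof.
move=> Ax _ C mC; rewrite setTI; apply: sub_sigma_algebra.
exists [fset x]%fset, (fun _ => (proj v) @^-1` C); split.
- by move=> i; rewrite in_fset1 => /eqP ->.
- move=> _; rewrite -[X in measurable X]setTI.
  have mp : measurable_fun setT
      (proj v : borel (prod_topology (fun _ : V => R)) -> R).
    apply: (@borel_continuous_measurable R (prod_topology (fun _ : V => R))).
    exact: (@proj_continuous V (fun=> R) v).
  exact: mp.
- apply/seteqP; split => w /= => [wC i /=|/(_ x)/=]; last first.
    by rewrite in_fset1 eqxx; apply.
  by rewrite in_fset1 => /eqP ->.
Qed.

Lemma measurable_env_on_path_prob A x s : (forall y, y \in departures x s -> A y) ->
  measurable_fun setT (fun w : env_on R A => (path_prob w x s)%:E).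
Proof.
move=> sA; apply/measurable_EFinP; elim: s x sA => [|v s IH] x sA /=.
  exact: measurable_cst.
apply: measurable_funM.
  by apply: measurable_env_on_coord; apply: sA; rewrite /= mem_head.
by apply: IH => y ys; apply: sA; rewrite /= in_cons ys orbT.
Qed.

Context (P : probability E R) (P_indep : mutually_independent P (@local_env d R)).

Lemma site_events_prob (J : {fset V})
    (B : V -> set (borel (prod_topology (fun _ : V => R)))) :
  (forall i, measurable (B i)) ->
  P (\bigcap_(i in [set` J]) (@local_env d R i @^-1` B i)) =
  (\prod_(i <- J) P (@local_env d R i @^-1` B i))%E.
Proof. by move=> mB; exact: P_indep. Qed.

Lemma site_events_extend (J J' : {fset V})
    (B : V -> set (borel (prod_topology (fun _ : V => R)))) : {subset J <= J'} ->
  \bigcap_(i in [set` J]) (@local_env d R i @^-1` B i) =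
  \bigcap_(i in [set` J'])
    (@local_env d R i @^-1` (if i \in J then B i else setT)).
Proof.
move=> JJ'; apply/seteqP; split=> w wB i /= iJ; first by case: ifPn => //; exact: wB.
by have := wB i (JJ' _ iJ); rewrite iJ.
Qed.

Lemma indep_site_events A B G H : A `&` B = set0 ->
  site_events A G -> site_events B H -> P (G `&` H) = (P G * P H)%E.
Proof.
move=> AB [J1 [B1 [J1A mB1 ->]]] [J2 [B2 [J2B mB2 ->]]].
pose C1 i := if i \in J1 then B1 i else setT.
pose C2 i := if i \in J2 then B2 i else setT.
have mC1 i : measurable (C1 i) by rewrite /C1; case: (i \in J1).
have mC2 i : measurable (C2 i) by rewrite /C2; case: (i \in J2).
pose J := (J1 `|` J2)%fset.
rewrite (@site_events_extend J1 J) => [|i]; last by rewrite in_fsetU => ->.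
rewrite (@site_events_extend J2 J) => [|i]; last by rewrite in_fsetU orbC => ->.
rewrite -bigcapI -/(C1 _).
rewrite (site_events_prob J mC1) (site_events_prob J mC2) -big_split /=.
have mC12 i : measurable (C1 i `&` C2 i) by exact: measurableI.
transitivity (\prod_(i <- J) P (@local_env d R i @^-1` (C1 i `&` C2 i)))%E.
  by rewrite -(site_events_prob J mC12).
apply: eq_bigr => i _; rewrite /C1 /C2.
case: ifPn => [i1|_]; last by rewrite setTI preimage_setT probability_setT mul1e.
case: ifPn => [i2|_]; last by rewrite setIT preimage_setT probability_setT mule1.
have ABi : (A `&` B) i by split; [exact: J1A|exact: J2B].
by rewrite AB in ABi.
Qed.

(** Independence passes from the pi-systems to the sigma-algebras one side at
    a time: when one event is fixed, both members are finite measures in the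
    other one. *)
Lemma indep_sigma A B G H : A `&` B = set0 ->
  (<<s site_events A >>) G -> (<<s site_events B >>) H ->
  P (G `&` H) = (P G * P H)%E.
Proof.
move=> AB sG sH.
have mG := env_on_sub sG; have mH := env_on_sub sH.
have half A' B' G' H' : A' `&` B' = set0 ->
    (forall G0 H0, site_events A' G0 -> (@measurable _ E) H0 -> H0 = H' ->
      P (G0 `&` H0) = (P G0 * P H0)%E) ->
    (@measurable _ E) H' -> (<<s site_events A' >>) G' ->
    P (G' `&` H') = (P G' * P H')%E.
  move=> AB' H0 mH' sG'.
  pose r : {nonneg R} := NngNum (fine_ge0 (measure_ge0 P H')).
  have rE : (r%:num%:E = P H')%E.
    by rewrite /= fineK// fin_num_measure.
  transitivity (mrestr P mH' G'); first by [].
  rewrite muleC -rE -[RHS]/(mscale r P G').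
  apply: (@g_sigma_algebra_measure_unique _ R E (site_events A')
    (@site_events_sub A') (fun=> setT) _ _ (mrestr P mH') (mscale r P)) => //.
  - by move=> _; exact: site_events_setT.
  - by apply/seteqP; split => // x _; exists 0%N.
  - exact: site_events_setI.
  - move=> G0 AG0; rewrite /= /mrestr /mscale rE muleC; exact: H0.
  - by move=> _; rewrite /= /mrestr setTI ltey_eq fin_num_measure.
apply: (half A B) => // G0 H0 AG0 mH0 ->{H0 mH0}.
rewrite setIC muleC; apply: (half B A) => //; first by rewrite setIC.
- move=> H0 G1 BH0 mG1 ->; rewrite setIC muleC.
  exact: (indep_site_events AB).
- exact: (site_events_sub AG0).
Qed.

(** The pair formed by the environment on A and the environment on B has a
    product law, and Tonelli's theorem separates the integrals. *)
Lemma indep_integral A B (f : env_on R A -> \bar R) (g : env_on R B -> \bar R) :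
  A `&` B = set0 ->
  measurable_fun setT f -> measurable_fun setT g ->
  (forall w, 0 <= f w)%E -> (forall w, 0 <= g w)%E ->
  (\int[P]_w ((f w : \bar R) * g w) = (\int[P]_w f w) * (\int[P]_w g w))%E.
Proof.
move=> AB mf mg f0 g0.
pose iA : {mfun E >-> env_on R A} :=
  HB.pack (id : E -> env_on R A) (isMeasurableFun.Build _ _ _ _ _ (@measurable_to_env_on A)).
pose iB : {mfun E >-> env_on R B} :=
  HB.pack (id : E -> env_on R B) (isMeasurableFun.Build _ _ _ _ _ (@measurable_to_env_on B)).
pose PA : probability (env_on R A) R := distribution P iA.
pose PB : probability (env_on R B) R := distribution P iB.
pose dg (w : E) : env_on R A * env_on R B := (w : env_on R A, w : env_on R B).
have mdg : measurable_fun setT dg.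
  by apply/measurable_fun_pairP; split; exact: measurable_to_env_on.
pose h (z : env_on R A * env_on R B) : \bar R := (f z.1 * g z.2)%E.
have mh : measurable_fun setT h.
  by apply: emeasurable_funM; apply: measurableT_comp.
have h0 z : (0 <= h z)%E by exact: mule_ge0.
transitivity (\int[pushforward P dg]_z h z)%E.
  by rewrite ge0_integral_pushforward.
transitivity (\int[PA \x PB]_z h z)%E.
  apply: eq_measure_integral => C mC _; apply/esym.
  apply: product_measure_unique => // G H mG mH.
  rewrite /= /pushforward /=; exact: (indep_sigma AB).
rewrite fubini_tonelli1//= /fubini_F /h /=.
transitivity (\int[PA]_w (f w * \int[PB]_w' g w'))%E.
  apply: eq_integral => w _; rewrite ge0_integralZl//.
rewrite ge0_integralZr//; last exact: integral_ge0.
by rewrite !ge0_integral_pushforward.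
Qed.

End independence.

(** * Stationarity and the weights of words *)

Section shift.
Context {d : nat} {R : realType}.
Local Notation V := (site d).
Variables (z : V) (w : environment d R).

Definition shift_env_fun (xy : V * V) : R := w (xy.1 + z, xy.2 + z).

Lemma shift_env_itv xy : 0 <= shift_env_fun xy <= 1.
Proof. exact: env_itv. Qed.

Lemma shift_env_sum x :
  (\esum_(y in [set: V]) (shift_env_fun (x, y))%:E = 1)%E.
Proof.
rewrite -(env_sum w (x + z)).
apply/esym/(@reindex_esum _ V V setT setT (fun y => y + z)
  (fun y => (w (x + z, y))%:E)).
split => // [y y' _ _ /addIr//|y _]; by exists (y - z) => //; rewrite subrK.
Qed.

Definition shift_env : environment d R := Environment shift_env_itv shift_env_sum.

End shift.

Section stationarity.
Context {d : nat} {R : realType}.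
Local Notation V := (site d).
Local Notation E := (borel (environment d R)).
Implicit Types (w : environment d R) (s t : seq V) (x y z : V) (A B : set V).

Lemma local_shift_env x z w : local_env x (shift_env z w) = local_env (x + z) w.
Proof.
by apply/funext => y; rewrite /local_env /= /shift_env_fun /= addrAC.
Qed.

Lemma path_prob_shift_env x z w s : path_prob (shift_env z w) x s = path_prob w (x + z) s.
Proof.
elim: s x => //= v s IH x; rewrite IH {1}/env_fun/= /shift_env_fun/=.
by rewrite addrAC.
Qed.

Lemma measurable_shift_env z : measurable_fun setT (shift_env z : E -> env_on R setT).
Proof.
apply: (measurability _ (erefl (measurable : set (set (env_on R setT))))).
move=> _ [_ [J [B [_ mB ->]]] <-]; rewrite setTI.
rewrite preimage_bigcap; apply: fin_bigcap_measurable => [|i _].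
  exact: finite_fset.
rewrite (_ : _ @^-1` _ = (@local_env d R (i + z) : E -> _) @^-1` B i).
  exact: measurable_local_preimage.
by apply/seteqP; split => w /=; rewrite local_shift_env.
Qed.

Context (P : probability E R) (P_iid : iid P (@local_env d R)).

(** The shift permutes the local environments, which are independent with a
    common law: the two laws agree on the pi-system of cylinder events. *)
Lemma stationary z (G : set (environment d R)) : (<<s site_events setT >>) G ->
  P (shift_env z @^-1` G) = P G.
Proof.
have [P_indep P_id] := P_iid.
have mT : measurable_fun setT (id : E -> env_on R setT) by exact: measurable_to_env_on.
have mz : measurable_fun setT (shift_env z : E -> env_on R setT).
  exact: measurable_shift_env.
pose fT : {mfun E >-> env_on R setT} := HB.pack (id : E -> env_on R setT)
  (isMeasurableFun.Build _ _ _ _ _ mT).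
pose fz : {mfun E >-> env_on R setT} := HB.pack (shift_env z : E -> env_on R setT)
  (isMeasurableFun.Build _ _ _ _ _ mz).
pose m1 : probability (env_on R setT) R := distribution P fz.
pose m2 : probability (env_on R setT) R := distribution P fT.
move=> sG; rewrite -[LHS]/(m1 G) -[RHS]/(m2 G).
apply: (@measure_unique _ R (env_on R setT) (site_events setT) (fun=> setT)
  _ _ _ _ m1 m2) => //.
- exact: site_events_setI.
- by move=> _; exact: site_events_setT.
- by apply/seteqP; split => // x _; exists 0%N.
- move=> _ [J [B [_ mB ->]]]; rewrite /m1 /m2 /= /distribution /pushforward /=.
  rewrite preimage_id (site_events_prob P_indep J mB).
  pose J' := [fset (i + z)%R | i in J]%fset.
  have -> : shift_env z @^-1` (\bigcap_(i in [set` J]) (@local_env d R i @^-1` B i)) =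
      \bigcap_(i in [set` J']) (@local_env d R i @^-1` B (i - z)).
    apply/seteqP; split => w /= wB i /=.
      move=> /imfsetP[j /= jJ ->]; rewrite /= addrK -local_shift_env.
      exact: wB.
    move=> iJ; rewrite local_shift_env.
    by have := wB (i + z); rewrite /= addrK; apply; apply/imfsetP; exists i.
  rewrite (site_events_prob P_indep J' (fun i => mB (i - z))).
  rewrite big_imfset/=; last by move=> i j _ _ /addIr.
  apply: eq_bigr => i _; rewrite addrK; exact: P_id.
- by move=> _; rewrite ltey_eq fin_num_measure.
Qed.

(** The annealed probability of performing the steps s, from 0 or, by
    [weightE], from any other site. *)
Definition weight s : R := fine (\int[P]_w (path_prob w 0 s)%:E)%E.

Lemma path_prob_integral_fin x s :
  (\int[P]_w (path_prob w x s)%:E)%E \is a fin_num.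
Proof.
rewrite ge0_fin_numE; last by apply: integral_ge0 => w _; rewrite lee_fin path_prob_ge0.
apply: (@le_lt_trans _ _ (\int[P]_w (cst 1%E w))%E).
  apply: ge0_le_integral => //.
  - by move=> w _; rewrite lee_fin path_prob_ge0.
  - exact: measurable_path_probE.
  - by move=> w _; rewrite lee_fin path_prob_le1.
by rewrite integral_cst//= mul1e probability_setT ltry.
Qed.

Lemma weightE x s : (\int[P]_w (path_prob w x s)%:E)%E = (weight s)%:E.
Proof.
rewrite /weight fineK ?path_prob_integral_fin//.
have mf : measurable_fun setT
   (fun w : env_on R setT => (path_prob w 0 s)%:E).
  exact: measurable_env_on_path_prob.
have pos : {in setT, forall w : env_on R setT, (0 <= (path_prob w 0 s)%:E)%E}.
  by move=> w _; rewrite lee_fin path_prob_ge0.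
have mT : measurable_fun setT (id : E -> env_on R setT) by exact: measurable_to_env_on.
have mx : measurable_fun setT (shift_env x : E -> env_on R setT).
  exact: measurable_shift_env.
transitivity (\int[pushforward P (shift_env x : E -> env_on R setT)]_w
    (path_prob w 0 s)%:E)%E.
  rewrite ge0_integral_pushforward//; apply: eq_integral => w _ /=.
  by rewrite path_prob_shift_env add0r.
transitivity (\int[pushforward P (id : E -> env_on R setT)]_w
    (path_prob w 0 s)%:E)%E; last first.
  by rewrite ge0_integral_pushforward.
apply: eq_measure_integral => // C mC _.
by rewrite /= /pushforward /= preimage_id stationary.
Qed.

Lemma annealed_cyl x s : annealed_inc P x (cyl s) = (weight s)%:E.
Proof. by rewrite -(weightE x); apply: eq_integral => w _; rewrite quenched_inc_cyl. Qed.

Lemma weight_ge0 s : 0 <= weight s.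
Proof. by apply: fine_ge0; apply: integral_ge0 => w _; rewrite lee_fin path_prob_ge0. Qed.

Lemma weight_le1 s : weight s <= 1.
Proof.
by rewrite -lee_fin -(annealed_cyl 0); apply: probability_le1; exact: measurable_cyl.
Qed.

Lemma annealed_inc_shift x (B : set (path_space d)) : measurable B ->
  annealed_inc P x B = annealed_inc P 0 B.
Proof.
move=> mB; apply: path_measure_unique => //.
- by rewrite ltey_eq fin_num_measure.
- by move=> s; rewrite /= !annealed_cyl.
Qed.

Lemma weight_indep x s y t : (forall v, v \in departures x s -> v \notin departures y t) ->
  (\int[P]_w (path_prob w x s * path_prob w y t)%:E)%E =
  (weight s * weight t)%:E.
Proof.
move=> st; rewrite EFinM -(weightE x s) -(weightE y t).
pose A := [set v | v \in departures x s]; pose B := [set v | v \in departures y t].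
rewrite -(@indep_integral _ _ _ P_iid.1 A B
   (fun w => (path_prob w x s)%:E)
   (fun w => (path_prob w y t)%:E)) //.
- by apply/seteqP; split => // v [/= /st/negP].
- exact: measurable_env_on_path_prob.
- exact: measurable_env_on_path_prob.
- by move=> w; rewrite lee_fin path_prob_ge0.
- by move=> w; rewrite lee_fin path_prob_ge0.
Qed.

(** The two parts of the walk use disjoint parts of the environment. *)
Lemma weight_cat s t : (forall v, v \in departures 0 s -> v \notin departures (wsum s) t) ->
  weight (s ++ t) = weight s * weight t.
Proof.
move=> st; apply: EFin_inj; rewrite -(weight_indep st) -(weightE 0).
by apply: eq_integral => w _; rewrite path_prob_cat add0r.
Qed.

Lemma weight_nil : weight [::] = 1.
Proof.
apply: EFin_inj; rewrite -(weightE 0) /=.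
by rewrite integral_cst//= mul1e probability_setT.
Qed.

End stationarity.

(** * Prefix-free families and repeated trials *)

Section word_families.
Context {d : nat}.
Local Notation V := (site d).
Implicit Types (s t : seq V) (Z : path_space d) (W : set (seq V)).

Definition starts W : set (path_space d) := \bigcup_(s in W) cyl s.

Lemma startsP W Z : starts W Z <-> exists n, W (prefix_of Z n).
Proof.
split=> [[s Ws /cylP sZ]|[n Wn]]; first by exists (size s); rewrite sZ.
by exists (prefix_of Z n) => //; exact: cyl_prefix.
Qed.

Definition prefix_free W := forall s t, W s -> W t ->
  (size s <= size t)%N -> s = take (size s) t -> s = t.

Lemma prefix_free_trivIset W : prefix_free W -> trivIset W (@cyl d).
Proof.
move=> pf s t Ws Wt [Z [sZ tZ]].
have [st|/ltnW ts] := leqP (size s) (size t).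
  exact: pf (cyl_comparable st sZ tZ).
exact/esym/pf/(cyl_comparable ts tZ sZ).
Qed.

Lemma measurable_starts W : measurable (starts W).
Proof. by apply: measurable_countable_bigcup => s; exact: measurable_cyl. Qed.

(** Keeps the minimal words of W, so that the family becomes prefix-free
    while the paths that start with one of its words remain the same. *)
Definition first_in W : set (seq V) :=
  [set s | W s /\ forall k, (k < size s)%N -> ~ W (take k s)].

Lemma first_in_prefix_free W : prefix_free (first_in W).
Proof.
move=> s t [Ws _] [Wt nW]; rewrite leq_eqVlt => /orP[/eqP st|st] s_t.
  by rewrite s_t st take_size.
by exfalso; apply: (nW (size s)) => //; rewrite -s_t.
Qed.

Lemma first_inP W s : W s -> exists k, (k <= size s)%N /\ first_in W (take k s).
Proof.
move=> Ws; have ex : exists n, `[< (n <= size s)%N /\ W (take n s) >].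
  by exists (size s); apply/asboolP; rewrite take_size.
have [k /asboolP[ks Wk] kmin] := ex_minnP ex.
exists k; split => //; split => // j; rewrite size_takel// => jk.
rewrite take_takel ?(ltnW jk)// => Wj.
have : (k <= j)%N by apply: kmin; apply/asboolP; rewrite (leq_trans (ltnW jk)).
by rewrite leqNgt jk.
Qed.

Lemma starts_first_in W : starts (first_in W) = starts W.
Proof.
apply/seteqP; split=> Z [s]; first by move=> [Ws _] sZ; exists s.
move=> Ws sZ; have [k [ks fk]] := first_inP Ws.
by exists (take k s) => //; exact: cyl_take.
Qed.

Lemma measurable_prefix (Q : set (seq V)) k : measurable [set Z | Q (prefix_of Z k)].
Proof.
have -> : [set Z | Q (prefix_of Z k)] = starts [set s | size s = k /\ Q s].
  apply/seteqP; split=> Z /=.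
    move=> QZ; apply/startsP; exists k; split => //; exact: size_prefix_of.
  by move=> [s [/= <- Qs] /cylP sZ]; rewrite sZ.
exact: measurable_starts.
Qed.

Lemma measurable_io (Q : set (seq V)) :
  measurable [set Z | forall n, exists2 k, (n <= k)%N & Q (prefix_of Z k)].
Proof.
rewrite (_ : [set _ | _] = \bigcap_n \bigcup_k
    (if (n <= k)%N then [set Z | Q (prefix_of Z k)] else set0)).
  apply: bigcapT_measurable => n; apply: bigcupT_measurable => k.
  by case: ifP => // _; exact: measurable_prefix.
apply/seteqP; split => Z H n.
  by move=> _; have [k nk kh] := H n; exists k => //; rewrite nk.
by have [k _] := H n Logic.I; case: ifP => // nk kh; exists k.
Qed.

Lemma measurable_always (Q : set (seq V)) : measurable [set Z | forall k, Q (prefix_of Z k)].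
Proof.
rewrite (_ : [set _ | _] = \bigcap_k [set Z | Q (prefix_of Z k)]).
  by apply: bigcapT_measurable => k; exact: measurable_prefix.
by apply/seteqP; split => Z H k; [move=> _|]; apply: H.
Qed.

Lemma cyl_starts_cat s W :
  cyl s `&` shiftp (size s) @^-1` starts W = \bigcup_(t in W) cyl (s ++ t).
Proof.
by rewrite preimage_bigcup setI_bigcupr; apply: eq_bigcupr => t _; rewrite cyl_cat.
Qed.

Lemma cat_prefix_free s W : prefix_free W -> trivIset W (fun t => cyl (s ++ t)).
Proof.
move=> pf t u Wt Wu [Z []]; rewrite !cyl_cat => -[_ tZ] [_ uZ].
by apply: (prefix_free_trivIset pf) => //; exists (shiftp (size s) Z).
Qed.

Lemma prefix_of_shiftp Z n k :
  prefix_of Z (n + k) = prefix_of Z n ++ prefix_of (shiftp n Z) k.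
Proof.
apply: (@eq_from_nth _ 0).
  by rewrite size_cat !size_prefix_of.
move=> i; rewrite size_prefix_of => ink; rewrite nth_prefix_of// nth_cat.
rewrite size_prefix_of; case: ltnP => [i_n|n_i]; first by rewrite nth_prefix_of.
by rewrite nth_prefix_of ?ltn_subLR// /shiftp subnKC.
Qed.

Context {R : realType} (m : probability (path_space d) R).

Lemma measure_starts W : prefix_free W ->
  m (starts W) = \esum_(s in W) m (cyl s).
Proof.
move=> pf; apply: measure_bigcup_esum; first exact: prefix_free_trivIset.
exact: measurable_cyl.
Qed.

(** A conditional Borel-Cantelli argument. A trial starts when the prefix s
    of the path belongs to W. Given s it succeeds with probability at least
    p, and a failure is detected after finitely many steps. A path of B meets
    infinitely many trials and fails them all. By waiting for the failure of
    each trial before considering the next one, one covers B by the paths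
    that fail k trials, of measure at most (1 - p) ^ k. *)
Lemma repeated_trials (W : set (seq V)) (S : seq V -> set (path_space d))
    (B : set (path_space d)) (p : R) :
  0 < p <= 1 -> measurable B -> (forall s, measurable (S s)) ->
  (forall s Z, W s -> cyl s Z -> ~ S s Z ->
     exists n, forall Z', cyl (prefix_of Z n) Z' -> ~ S s Z') ->
  (forall s, W s -> (p%:E * m (cyl s) <= m (cyl s `&` S s))%E) ->
  (forall Z, B Z -> forall n, exists2 k, (n <= k)%N & W (prefix_of Z k)) ->
  (forall Z s, B Z -> W s -> cyl s Z -> ~ S s Z) ->
  m B = 0%E.
Proof.
move=> /andP[p0 p1] mB mS clS WS BW BS.
have q0 : 0 <= 1 - p by rewrite subr_ge0.
(* D: the words at the end of which k trials have failed *)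
have cover k : exists2 D : set (seq V),
    B `<=` starts D & (m (starts D) <= ((1 - p) ^+ k)%:E)%E.
  elim: k => [|k [D BD mD]].
    exists [set [::]] => [Z _|]; first by exists [::].
    by rewrite expr0 probability_le1//; exact: measurable_starts.
  (* T: the words that start the next trial *)
  pose T := first_in [set s | W s /\ exists2 t, D t & t = take (size t) s].
  have pT : prefix_free T by exact: first_in_prefix_free.
  have TW s : T s -> W s by case=> -[].
  exists [set t | exists2 s, T s & cyl t `<=` cyl s `\` S s].
    move=> Z BZ; have [t Dt tZ] := BD _ BZ.
    have [n tn Wn] := BW _ BZ (size t).
    have : starts T Z.
      rewrite starts_first_in; exists (prefix_of Z n); last exact: cyl_prefix.
      split=> //; exists t => //.
      by rewrite take_prefix_of//; move/cylP: tZ => {1}<-.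
    move=> [s Ts sZ]; have [j jS] := clS _ _ (TW _ Ts) sZ (BS _ _ BZ (TW _ Ts) sZ).
    exists (prefix_of Z (maxn (size s) j)); last exact: cyl_prefix.
    exists s => // Z' Z'c; split.
      move/cyl_take: (Z'c) => /(_ (size s)).
      by rewrite take_prefix_of ?leq_maxl//; move/cylP: sZ => ->.
    by apply: jS; move/cyl_take: (Z'c) => /(_ j); rewrite take_prefix_of ?leq_maxr.
  apply: (@le_trans _ _ (m (\bigcup_(s in T) (cyl s `\` S s)))).
    apply: le_measure; rewrite ?inE; first exact: measurable_starts.
      apply: measurable_countable_bigcup => s; apply: measurableD => //.
      exact: measurable_cyl.
    by move=> Z [t [s Ts ts] tZ]; exists s => //; exact: ts.
  rewrite measure_bigcup_esum; last 2 first.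
  - move=> s t Ts Tt [Z [[sZ _] [tZ _]]].
    by apply: (prefix_free_trivIset pT) => //; exists Z.
  - by move=> s; apply: measurableD => //; exact: measurable_cyl.
  apply: (@le_trans _ _ (\esum_(s in T) ((1 - p)%:E * m (cyl s)))%E).
    apply: le_esum => s Ts; rewrite measureD//=; last 2 first.
    - exact: measurable_cyl.
    - by rewrite ltey_eq fin_num_measure//; exact: measurable_cyl.
    have [a aE] : exists a, m (cyl s) = a%:E.
      exists (fine (m (cyl s))); rewrite fineK// fin_num_measure//.
      exact: measurable_cyl.
    have [b bE] : exists b, m (cyl s `&` S s) = b%:E.
      exists (fine (m (cyl s `&` S s))); rewrite fineK// fin_num_measure//.
      by apply: measurableI => //; exact: measurable_cyl.
    have := WS _ (TW _ Ts); rewrite aE bE -EFinB -!EFinM !lee_fin mulrBl mul1r.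
    by rewrite lerD2l lerN2.
  rewrite esumZl// exprS EFinM lee_wpmul2l ?lee_fin//.
  rewrite -measure_starts// starts_first_in; apply: le_trans mD.
  apply: le_measure; rewrite ?inE; [exact: measurable_starts..|].
  move=> Z [s [_ [t Dt ts]] sZ]; exists t => //; rewrite ts; exact: cyl_take.
apply/eqP; rewrite eq_le measure_ge0 andbT.
apply/lee_addgt0Pr => e e0; rewrite add0e.
have [k ke] : exists k, (1 - p) ^+ k < e.
  have : (1 - p) ^+ n @[n --> \oo] --> (0 : R).
    by apply: cvg_expr; rewrite ger0_norm// gtrBl.
  move=> /cvgrPdist_lt/(_ e e0)[N _ /(_ N (leqnn N))].
  by rewrite sub0r normrN ger0_norm ?exprn_ge0// => ?; exists N.
have [D BD mD] := cover k.
apply: (@le_trans _ _ (m (starts D))).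
  by apply: le_measure; rewrite ?inE//; exact: measurable_starts.
by apply: le_trans mD _; rewrite lee_fin ltW.
Qed.

Lemma measure_bigcap_ge (F : nat -> set (path_space d)) (c : \bar R) :
  (forall n, measurable (F n)) -> (forall i j, (i <= j)%N -> F j `<=` F i) ->
  (forall n, (c <= m (F n))%E) -> (c <= m (\bigcap_n F n))%E.
Proof.
move=> mF dF cF.
have H : m (F n) @[n --> \oo] --> m (\bigcap_n F n).
  apply: nonincreasing_cvg_mu => //.
  - by rewrite ltey_eq fin_num_measure.
  - exact: bigcapT_measurable.
  - by move=> i j ij; apply/subsetPset; exact: dF.
rewrite -(cvg_lim _ H)//; apply: lime_ge; first by apply/cvg_ex; eexists; exact: H.
exact: nearW.
Qed.

End word_families.

(** * Heights and climbs *)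

Lemma multiple_above {R : realType} (x a : R) : 0 < a -> exists n : nat, x < a *+ n.
Proof.
move=> a0; exists (Num.truncn (x / a)).+1.
by rewrite -(mulr_natl a) -ltr_pdivrMr// truncnS_gt.
Qed.

Section heights.
Context {d : nat} {R : realType}.
Local Notation V := (site d).
Implicit Types (s t : seq V) (Z : path_space d).
Variable f : V -> R.

Definition height Z k : R := f (wsum (prefix_of Z k)).

(** The climbs of height L. They form a prefix-free family, and starting with
    one of them decreases, as L grows, to never going below 0 and being
    unbounded: [up_words_cap]. *)
Definition up_words (L : R) : set (seq V) :=
  [set s | [/\ forall k, (k <= size s)%N -> 0 <= f (wsum (take k s)),
               forall k, (k < size s)%N -> f (wsum (take k s)) < L &
               L <= f (wsum s)]].

Definition stay : set (path_space d) := [set Z | forall k, 0 <= height Z k].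

Definition unbounded : set (path_space d) :=
  [set Z | forall M : nat, exists k, M%:R <= height Z k].

Definition transient : set (path_space d) :=
  [set Z | forall M : nat, exists n, forall k, (n <= k)%N -> M%:R <= height Z k].

Lemma up_words_prefix_free L : prefix_free (up_words L).
Proof.
move=> s t [_ _ sL] [_ tL _]; rewrite leq_eqVlt => /orP[/eqP st|st] s_t.
  by rewrite s_t st take_size.
by have := lt_le_trans (tL _ st); rewrite -s_t => /(_ _ sL); rewrite ltxx.
Qed.

Lemma measurable_height k (Q : set R) : measurable [set Z | Q (height Z k)].
Proof. exact: (measurable_prefix (fun s => Q (f (wsum s)))). Qed.

Lemma measurable_stay : measurable stay.
Proof. exact: (measurable_always (fun s => 0 <= f (wsum s))). Qed.

Lemma measurable_unbounded : measurable unbounded.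
Proof.
rewrite (_ : unbounded = \bigcap_M \bigcup_k [set Z | M%:R <= height Z k]).
  apply: bigcapT_measurable => M; apply: bigcupT_measurable => k.
  exact: (@measurable_height k (fun x => M%:R <= x)).
apply/seteqP; split => Z H M; first by move=> _; have [k] := H M; exists k.
by have [k _ ?] := H M Logic.I; exists k.
Qed.

Lemma measurable_transient : measurable transient.
Proof.
rewrite (_ : transient = \bigcap_M \bigcup_n \bigcap_k
    (if (n <= k)%N then [set Z | M%:R <= height Z k] else setT)).
  apply: bigcapT_measurable => M; apply: bigcupT_measurable => n.
  apply: bigcapT_measurable => k; case: ifP => // _.
  exact: (@measurable_height k (fun x => M%:R <= x)).
apply/seteqP; split => Z H M; first move=> _.
  have [n nH] := H M; exists n => // k _; case: ifP => //; exact: nH.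
have [n _ nH] := H M Logic.I; exists n => k nk.
by have := nH k Logic.I; rewrite nk.
Qed.

Lemma up_words_event L Z : starts (up_words L) Z <->
  exists2 n, L <= height Z n & forall k, (k <= n)%N -> 0 <= height Z k.
Proof.
split=> [/startsP[n [s0 _ sL]]|[n nL n0]].
  exists n => // k kn; have := s0 k; rewrite size_prefix_of take_prefix_of//.
  exact.
have ex : exists n, L <= height Z n by exists n.
have [i iL imin] := ex_minnP ex.
have i_n : (i <= n)%N by exact: imin.
apply/startsP; exists i; split => [k|k|//]; rewrite size_prefix_of => ki.
  by rewrite take_prefix_of// n0// (leq_trans ki).
rewrite take_prefix_of ?(ltnW ki)// ltNge; apply/negP => /imin.
by rewrite leqNgt ki.
Qed.

Lemma up_words_decr L L' : L <= L' -> starts (up_words L') `<=` starts (up_words L).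
Proof.
move=> LL' Z /up_words_event[n nL n0]; apply/up_words_event; exists n => //.
exact: le_trans nL.
Qed.

(** If the walk were below 0 at time k, it would have climbed before k to a
    level higher than all its heights up to time k. *)
Lemma up_words_cap :
  \bigcap_n starts (up_words n%:R) = stay `&` unbounded.
Proof.
apply/seteqP; split=> [Z H|Z [Zs Zu] M _]; last first.
  by have [k Mk] := Zu M; apply/up_words_event; exists k => // j _; exact: Zs.
split=> [k|M]; last by have /up_words_event[n ? _] := H M Logic.I; exists n.
pose b := \sum_(i < k.+1) `|height Z i|.
have [n bn] := multiple_above b ltr01.
have /up_words_event[i iM i0] := H n Logic.I.
apply: i0; rewrite leqNgt; apply/negP => ik.
have : height Z i <= b.
  rewrite /b (bigD1 (Ordinal (leqW ik)))//= (le_trans (ler_norm _))// lerDl.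
  exact: sumr_ge0.
by rewrite leNgt (lt_le_trans bn iM).
Qed.

Hypothesis fD : forall x y, f (x + y) = f x + f y.

Lemma additive0 : f 0 = 0.
Proof. by have /eqP := fD 0 0; rewrite addr0 -subr_eq0 opprD addNKr oppr_eq0 => /eqP. Qed.

Lemma additive_mulrn (x : V) n : f (x *+ n) = f x *+ n.
Proof. by elim: n => [|n IH]; rewrite ?mulr0n ?additive0// !mulrS fD IH. Qed.

Lemma height_shift Z n k : height Z (n + k) = height Z n + height (shiftp n Z) k.
Proof. by rewrite /height prefix_of_shiftp wsum_cat fD. Qed.

Lemma transient_shift n Z : transient (shiftp n Z) <-> transient Z.
Proof.
have [N1 N1P] := multiple_above `|height Z n| ltr01.
split=> H M; have [j jP] := H (M + N1)%N.
  exists (n + j)%N => k nk; rewrite -(subnKC (leq_trans (leq_addr _ _) nk)).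
  rewrite height_shift; have := jP (k - n)%N.
  rewrite leq_subRL ?(leq_trans (leq_addr _ _) nk)// => /(_ nk).
  rewrite natrD; have := ler_norm (- height Z n); rewrite normrN.
  by lra.
exists j => k jk; have := jP (n + k)%N; rewrite (leq_trans jk) ?leq_addl// => /(_ isT).
rewrite height_shift natrD; have := ler_norm (height Z n).
by lra.
Qed.

(** Seen from the time at which its height is minimal, a transient walk never
    goes below its starting point. *)
Lemma transient_stay Z : transient Z ->
  exists n, (stay `&` unbounded) (shiftp n Z).
Proof.
move=> tZ; have [n nP] := tZ 0%N.
pose k : 'I_n.+1 := [arg min_(i < ord0) height Z (i : 'I_n.+1)]%O.
have kP (i : nat) : height Z k <= height Z i.
  rewrite /k; case: arg_minP => //= j _ jmin.
  have [i_n|n_i] := ltnP i n.+1; first exact: (jmin (Ordinal i_n)).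
  apply: (@le_trans _ _ (height Z 0)); first exact: (jmin ord0).
  by rewrite {1}/height /= wsum_nil additive0 nP// ltnW.
exists k; split=> [i|M].
  by have := kP (k + i)%N; rewrite height_shift lerDl.
have tk := (transient_shift k Z).2 tZ.
by have [i iP] := tk M; exists i; exact: iP.
Qed.

End heights.

(** * Transience of the walks that are unbounded above *)

Section annealed_heights.
Context {d : nat} {R : realType}.
Local Notation V := (site d).
Local Notation E := (borel (environment d R)).
Implicit Types (w : environment d R) (s t : seq V) (Z : path_space d).
Context (P : probability E R) (P_iid : iid P (@local_env d R)).
Local Notation ann := (annealed_inc P 0).
Local Notation weight := (weight P).

Lemma annealed_starts (x : V) (W : set (seq V)) : prefix_free W ->
  annealed_inc P x (starts W) = \esum_(s in W) (weight s)%:E.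
Proof.
move=> pf; rewrite measure_starts//; apply: eq_esum => s _.
exact: (annealed_cyl P_iid).
Qed.

Lemma annealed_cat s (W : set (seq V)) : prefix_free W ->
  (forall t, W t -> weight (s ++ t) = weight s * weight t) ->
  ann (cyl s `&` shiftp (size s) @^-1` starts W) = ((weight s)%:E * ann (starts W))%E.
Proof.
move=> pf Wst; rewrite cyl_starts_cat measure_bigcup_esum; last 2 first.
- exact: cat_prefix_free.
- by move=> t; exact: measurable_cyl.
rewrite annealed_starts// -esumZl ?weight_ge0// => [|t]; last by rewrite lee_fin weight_ge0.
by apply: eq_esum => t Wt; rewrite -EFinM -Wst//; exact: (annealed_cyl P_iid).
Qed.

Lemma measurable_cyl_shift s (B : set (path_space d)) : measurable B ->
  measurable (cyl s `&` shiftp (size s) @^-1` B).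
Proof.
move=> mB; apply: measurableI; first exact: measurable_cyl.
exact: measurable_shift_preimage.
Qed.

(** Conditioning on the word s biases the environment seen afterwards, but
    only by the density path_prob, which is at most 1. *)
Lemma annealed_shift_null s (B : set (path_space d)) : measurable B ->
  ann B = 0%E -> ann (cyl s `&` shiftp (size s) @^-1` B) = 0%E.
Proof.
move=> mB B0; apply/eqP; rewrite eq_le measure_ge0 andbT.
rewrite -{}B0 -(annealed_inc_shift P_iid (wsum s) mB).
apply: ge0_le_integral => //.
- by apply: measurable_quenched_inc; exact: measurable_cyl_shift.
- exact: measurable_quenched_inc.
move=> w _; rewrite quenched_inc_markov// add0r.
rewrite -[leRHS]mul1e lee_wpmul2r ?lee_fin ?path_prob_le1//; exact: measure_ge0.
Qed.

Lemma annealed_tail_null (B : set (path_space d)) : measurable B ->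
  ann B = 0%E -> ann (\bigcup_n shiftp n @^-1` B) = 0%E.
Proof.
move=> mB B0.
apply: (null_countable_bigcup (F := fun s : seq V => cyl s `&` shiftp (size s) @^-1` B)).
- by apply: bigcupT_measurable => n; exact: measurable_shift_preimage.
- by move=> s; exact: measurable_cyl_shift.
- by move=> s; exact: annealed_shift_null.
- move=> Z [n _ BZ]; exists (prefix_of Z n) => //; split; first exact: cyl_prefix.
  by rewrite size_prefix_of.
Qed.

Variable f : V -> R.
Hypothesis fD : forall x y, f (x + y) = f x + f y.

(** The sites from which s departs are lower than its end, those from which t
    departs then are not: the two words use disjoint parts of the
    environment. *)
Lemma weight_cat_up s t :
  (forall k, (k < size s)%N -> f (wsum (take k s)) < f (wsum s)) ->
  (forall k, (k <= size t)%N -> 0 <= f (wsum (take k t))) ->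
  weight (s ++ t) = weight s * weight t.
Proof.
move=> s_rec t_pos; apply: (weight_cat P_iid) => v /departuresP[k ks ->].
apply/negP => /departuresP[j jt] /(congr1 f); rewrite add0r fD => e.
have := s_rec _ ks; rewrite e gtrDl ltNge t_pos//; exact: ltnW.
Qed.

(** Otherwise the walk would almost surely go below its starting point or be
    bounded above, and by [annealed_tail_null] this would be true after each
    finite time, including the time of the minimum of a transient walk. *)
Lemma up_mass_pos : ann (transient f) != 0%E ->
  exists2 a : R, 0 < a & forall L, (a%:E <= ann (starts (up_words f L)))%E.
Proof.
move=> A0; pose F := stay f `&` unbounded f.
have mF : measurable F.
  by apply: measurableI; [exact: measurable_stay|exact: measurable_unbounded].
have F0 : ann F != 0%E.
  apply: contra_neq A0 => F0; apply/eqP; rewrite eq_le measure_ge0 andbT.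
  rewrite -(annealed_tail_null mF F0); apply: le_measure; rewrite ?inE.
  - exact: measurable_transient.
  - by apply: bigcupT_measurable => n; exact: measurable_shift_preimage.
  - by move=> Z /(transient_stay fD)[n nF]; exists n.
have Ffin : ann F \is a fin_num by exact: fin_num_measure.
exists (fine (ann F)); first by rewrite fine_gt0// lt0e F0 measure_ge0/= ltey_eq Ffin.
move=> L; rewrite fineK//.
apply: le_measure; rewrite ?inE//; first exact: measurable_starts.
rewrite /F -up_words_cap => Z.
have [n Ln] := multiple_above L ltr01.
by move=> /(_ n Logic.I); apply: up_words_decr; exact: ltW.
Qed.

Hypothesis a_pos : exists2 a : R, 0 < a &
  forall L, (a%:E <= ann (starts (up_words f L)))%E.

(** The walk that sets a record has not seen the environment at or above its
    present height; hence it stays there with the same probability as at the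
    start. *)
Lemma fresh_stay s :
  (forall k, (k < size s)%N -> f (wsum (take k s)) < f (wsum s)) ->
  forall a : R, (forall L, (a%:E <= ann (starts (up_words f L)))%E) ->
  (a%:E * ann (cyl s) <= ann (cyl s `&` shiftp (size s) @^-1` stay f))%E.
Proof.
move=> s_rec a aP.
apply: (@le_trans _ _ (ann (\bigcap_n (cyl s `&`
   shiftp (size s) @^-1` starts (up_words f n%:R))))); last first.
  apply: le_measure; rewrite ?inE.
  - apply: bigcapT_measurable => n; apply: measurable_cyl_shift.
    exact: measurable_starts.
  - by apply: measurable_cyl_shift; exact: measurable_stay.
  - move=> Z H; split; first by have [] := H 0%N Logic.I.
    have : (stay f `&` unbounded f) (shiftp (size s) Z).
      by rewrite -up_words_cap => n _; have [] := H n Logic.I.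
    by case.
apply: measure_bigcap_ge => [n|i j ij Z [sZ jZ]|n].
- apply: measurable_cyl_shift; exact: measurable_starts.
- by split => //; apply: up_words_decr jZ; rewrite ler_nat.
rewrite [leRHS](_ : _ = ((weight s)%:E * ann (starts (up_words f n%:R)))%E); last first.
  apply: annealed_cat; first exact: up_words_prefix_free.
  by move=> t [tpos _ _]; exact: weight_cat_up.
rewrite (annealed_cyl P_iid 0) muleC lee_wpmul2l ?lee_fin ?weight_ge0//.
Qed.

(** Each record above h starts a trial, that of staying above the record for
    ever. An unbounded walk that is below h infinitely often fails all these
    trials, and is covered by [repeated_trials]. *)
Lemma unbounded_not_transient_null : ann (unbounded f `\` transient f) = 0%E.
Proof.
have [a a0 aP] := a_pos.
pose B (h : nat) := unbounded f `&`
  [set Z | forall n, exists2 k, (n <= k)%N & height f Z k < h%:R].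
have mB h : measurable (B h).
  apply: measurableI; first exact: measurable_unbounded.
  exact: (measurable_io (fun s => f (wsum s) < h%:R)).
have B0 h : ann (B h) = 0%E.
  pose W := [set s : seq V | h%:R <= f (wsum s) /\
    forall k, (k < size s)%N -> f (wsum (take k s)) < f (wsum s)].
  apply: (@repeated_trials _ _ (annealed_inc P 0) W
    (fun s => shiftp (size s) @^-1` stay f) (B h) a) => //.
  - rewrite a0 /= -lee_fin; apply: le_trans (aP 0) _.
    by apply: probability_le1; exact: measurable_starts.
  - by move=> s; apply: measurable_shift_preimage; exact: measurable_stay.
  - move=> s Z _ sZ /existsNP[k /negP]; rewrite -ltNge => kZ.
    exists (size s + k)%N => Z' /cylP; rewrite size_prefix_of => Z'Z /(_ k).
    have e1 : height f Z' (size s) = height f Z (size s).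
      rewrite /height -(@take_prefix_of _ Z' _ (size s + k)) ?leq_addr// Z'Z.
      by rewrite take_prefix_of ?leq_addr.
    have e2 : height f Z' (size s + k) = height f Z (size s + k).
      by rewrite /height Z'Z.
    move: e2; rewrite !(height_shift fD) e1 => /addrI ->.
    by rewrite leNgt kZ.
  - by move=> s [_ s_rec]; exact: fresh_stay.
  - move=> Z [Zu _] n.
    pose b := \sum_(i < n) `|height f Z i| + h%:R.
    have [M bM] := multiple_above b ltr01.
    have [i iM imin] := ex_minnP (Zu M).
    have n_i : (n <= i)%N.
      rewrite leqNgt; apply/negP => i_n.
      have : height f Z i <= b.
        rewrite /b (bigD1 (Ordinal i_n))//= -addrA (le_trans (ler_norm _))// lerDl.
        by rewrite addr_ge0// sumr_ge0.
      by rewrite leNgt (lt_le_trans bM iM).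
    exists i => //; split.
      apply: le_trans iM; apply: le_trans (ltW bM).
      by rewrite lerDr sumr_ge0.
    move=> k; rewrite size_prefix_of => ki; rewrite take_prefix_of ?(ltnW ki)//.
    apply: lt_le_trans iM; rewrite ltNge; apply/negP => /imin.
    by rewrite leqNgt ki.
  - move=> Z s [_ /(_ (size s))[k sk kh]] [hs _] /cylP sZ /(_ (k - size s)%N).
    apply/negP; rewrite -ltNge.
    have := height_shift fD Z (size s) (k - size s); rewrite subnKC//.
    rewrite {2}/height sZ => e; rewrite -(ltrD2l (f (wsum s))) -e addr0.
    exact: lt_le_trans kh hs.
apply: (null_countable_bigcup (F := B)) => //.
  apply: measurableD; [exact: measurable_unbounded|exact: measurable_transient].
move=> Z [Zu /existsNP[M /forallNP MZ]]; exists M => //; split => // n.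
by have /existsNP[k /not_implyP[nk /negP kM]] := MZ n; exists k => //; rewrite ltNge.
Qed.

(** As L grows, these events decrease to a subset of a null event, the walk
    being unbounded but not transient. *)
Lemma reach_not_transient_small (e : R) : 0 < e -> exists n : nat, forall L, n%:R <= L ->
  (ann (starts (up_words f L) `\` transient f) <= e%:E)%E.
Proof.
move=> e0.
pose F (n : nat) := starts (up_words f n%:R) `\` transient f.
have mF n : measurable (F n).
  apply: measurableD; [exact: measurable_starts|exact: measurable_transient].
have F0 : ann (\bigcap_n F n) = 0%E.
  apply/eqP; rewrite eq_le measure_ge0 andbT -unbounded_not_transient_null.
  apply: le_measure; rewrite ?inE.
  - exact: bigcapT_measurable.
  - apply: measurableD; [exact: measurable_unbounded|exact: measurable_transient].
  move=> Z H0; split; last by have [] := H0 0%N Logic.I.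
  have : (stay f `&` unbounded f) Z.
    by rewrite -up_words_cap => n _; have [] := H0 n Logic.I.
  by case.
have [n nP] : exists n, (ann (F n) <= e%:E)%E.
  apply: contrapT => /forallNP nF.
  suff : (e%:E <= ann (\bigcap_n F n))%E.
    by rewrite F0 lee_fin leNgt e0.
  apply: measure_bigcap_ge => // [i j ij Z [jZ nZ]|n].
    by split => //; apply: up_words_decr jZ; rewrite ler_nat.
  by have /negP := nF n; rewrite -ltNge => /ltW.
exists n => L nL; apply: le_trans nP; apply: le_measure; rewrite ?inE//.
  apply: measurableD; [exact: measurable_starts|exact: measurable_transient].
by move=> Z [LZ nZ]; split => //; apply: up_words_decr LZ.
Qed.

End annealed_heights.

(** * Sites that are reachable from everywhere *)

Section reachability.
Context {d : nat} {R : realType}.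
Local Notation V := (site d).
Local Notation E := (borel (environment d R)).
Implicit Types (w : environment d R) (s t : seq V) (x y z : V).

Lemma reachable_path_prob w x y : reachable w x y <->
  exists2 s, 0 < path_prob w x s & x + wsum s = y.
Proof.
split=> [[p]|[s]].
  elim: p x => [|z p IH] x /=; first by move=> _ <-; exists [::]; rewrite ?ltr01 ?wsum_nil ?addr0.
  move=> /andP[xz /IH zp] /zp[s s0 <-]; exists (z - x :: s) => /=.
    by rewrite (_ : x + (z - x) = z) ?mulr_gt0// addrC subrK.
  by rewrite wsum_cons addrA (_ : x + (z - x) = z)// addrC subrK.
elim: s x => [|v s IH] x /=; first by move=> _ <-; exists [::]; rewrite // wsum_nil addr0.
move=> vs; rewrite wsum_cons addrA => e.
have v0 : 0 < w (x, x + v).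
  by rewrite lt0r env_ge0 andbT; apply: contraTneq vs => ->; rewrite mul0r ltxx.
have s0 : 0 < path_prob w (x + v) s by rewrite -(pmulr_rgt0 _ v0).
by have [p pp lp] := IH _ s0 e; exists (x + v :: p) => //=; rewrite v0.
Qed.

Lemma reachable_shift z w x y :
  reachable (shift_env z w) x y <-> reachable w (x + z) (y + z).
Proof.
rewrite !reachable_path_prob; split=> -[s s0 e]; exists s; rewrite -?path_prob_shift_env//.
- by rewrite -e addrAC.
- by rewrite path_prob_shift_env.
- by apply: (addIr z); rewrite -e addrAC.
Qed.

Lemma measurable_reachable x y :
  (<<s site_events setT >>) [set w : environment d R | reachable w x y].
Proof.
pose T := env_on R [set: V].
have -> : [set w : environment d R | reachable w x y] = \bigcup_(s in setT)
    (if x + wsum s == y then [set w : environment d R | 0 < path_prob w x s] else set0).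
  apply/seteqP; split => w /=.
    by move=> /reachable_path_prob[s s0 e]; exists s => //; rewrite e eqxx.
  by move=> [s _]; case: eqP => // e s0; apply/reachable_path_prob; exists s.
apply: (@countable_bigcupT_measurable _ T) => [|s]; first exact: countableP.
case: eqP => _; last exact: (@measurable0 _ T).
have := @measurable_env_on_path_prob d R setT x s (fun _ _ => I).
move=> /measurable_EFinP/(_ measurableT `]0, +oo[%classic (measurable_itv _)).
rewrite setTI; congr (_ _); apply/seteqP; split => w /=; rewrite in_itv/= andbT//.
Qed.

Context (P : probability E R) (P_iid : iid P (@local_env d R)).
Hypothesis P_sink : {ae P, forall w : environment d R, exists c, forall x, reachable w x c}.
Variable f : V -> R.
Hypothesis fD : forall x y, f (x + y) = f x + f y.
Variable v : V.
Hypothesis fv : 0 < f v.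

Definition high_sink (h : R) : set (environment d R) :=
  [set w | exists2 c, h < f c & forall x, reachable w x c].

Lemma measurable_high_sink h : (<<s site_events setT >>) (high_sink h).
Proof.
pose T := env_on R [set: V].
have -> : high_sink h = \bigcup_(c in setT)
   (if h < f c then \bigcap_(x in setT) [set w : environment d R | reachable w x c] else set0).
  apply/seteqP; split => w.
    by move=> [c hc cr]; exists c => //; rewrite hc => x _; exact: cr.
  by move=> [c _]; case: ifP => // hc cr; exists c => // x; exact: cr.
apply: (@countable_bigcupT_measurable _ T) => [|c]; first exact: countableP.
case: ifP => _; last exact: (@measurable0 _ T).
have -> : \bigcap_(x in [set: V]) [set w : environment d R | reachable w x c] =
    ~` \bigcup_(x in [set: V]) ~` [set w : environment d R | reachable w x c].
  by rewrite setC_bigcup; apply: eq_bigcapr => x _; rewrite setCK.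
apply: (@measurableC _ T).
apply: (@countable_bigcupT_measurable _ T) => [|x]; first exact: countableP.
by apply: (@measurableC _ T); exact: measurable_reachable.
Qed.

(** Shifting the environment along v shows that the probability does not
    depend on h; when h tends to minus infinity, the event becomes the
    existence of a site reachable from everywhere. *)
Lemma high_sink_prob h : P (high_sink h) = 1%E.
Proof.
have mH g : measurable (high_sink g : set E) by exact: (env_on_sub (measurable_high_sink g)).
have sh n : P (high_sink (h - f v *+ n)) = P (high_sink h).
  rewrite -(stationary P_iid (- (v *+ n)) (measurable_high_sink h)).
  congr (P _); apply/seteqP; split => w /=.
    move=> [c hc cr]; exists (c + v *+ n).
      by rewrite fD (additive_mulrn fD) -ltrBlDr.
    by move=> x; apply/reachable_shift; rewrite addrK; exact: cr.
  move=> [c hc cr]; exists (c - v *+ n).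
    rewrite -(ltrD2r (f (v *+ n))) -fD subrK (additive_mulrn fD) subrK//.
  by move=> x; have /reachable_shift := cr (x + v *+ n); rewrite addrK.
have H : P (high_sink (h - f v *+ n)) @[n --> \oo] -->
    P (\bigcup_n high_sink (h - f v *+ n)).
  apply: nondecreasing_cvg_mu => //; first exact: bigcupT_measurable.
  move=> i j ij; apply/subsetPset => w [c hc cr]; exists c => //.
  by apply: le_lt_trans hc; rewrite lerD2l lerN2; rewrite ler_wpMn2l// ltW.
have -> : P (high_sink h) = P (\bigcup_n high_sink (h - f v *+ n)).
  rewrite -(cvg_lim _ H)//; under eq_fun do rewrite sh.
  by rewrite lim_cst.
set U := \bigcup_n _.
have mU : measurable (U : set E) by exact: bigcupT_measurable.
have UC : P (~` U) = 0%E.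
  apply: measure_negligible; first exact: measurableC.
  apply: negligibleS P_sink => w /= nU; apply: contra_not nU => -[c cr].
  have [n hn] := multiple_above (h - f c) fv.
  by exists n => //; exists c => //; lra.
have := probability_setC P mU; rewrite UC => e.
have : P U \is a fin_num by exact: fin_num_measure.
move: e; case: (P U) => // r /eqP; rewrite -EFinB eqe eq_sym subr_eq0 => /eqP <- //.
Qed.

(** * Walks bounded above *)

Lemma missed_word s u (Z : path_space d) : ~ (shiftp (size s) @^-1` cyl u) Z ->
  exists n, forall Z', cyl (prefix_of Z n) Z' -> ~ (shiftp (size s) @^-1` cyl u) Z'.
Proof.
move=> nu; exists (size s + size u)%N => Z' /cylP; rewrite size_prefix_of.
rewrite !prefix_of_shiftp => /eqP; rewrite eqseq_cat ?size_prefix_of//.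
by move=> /andP[_ /eqP e] /cylP u'; apply: nu; apply/cylP; rewrite -e.
Qed.

Hypothesis wv : 0 < weight P [:: v].
Local Notation ann := (annealed_inc P 0).
Local Notation weight := (weight P).

Definition bounded_by (h : R) : set (path_space d) :=
  [set Z | forall k, height f Z k <= h].

Let fresh_near (h : R) : set (seq V) := [set s | h - f v < f (wsum s) /\
  forall k, (k < size s)%N -> wsum (take k s) <> wsum s].

Let io (Q : set (seq V)) : set (path_space d) :=
  [set Z | forall n, exists2 k, (n <= k)%N & Q (prefix_of Z k)].

Lemma measurable_bounded_by h : measurable (bounded_by h).
Proof. exact: (measurable_always (fun s => f (wsum s) <= h)). Qed.

(** At a site visited for the first time, at a height within f v of the
    bound, the step v would break the bound, and it has its annealed
    probability whatever the past. *)
Lemma bounded_fresh_null h : ann (bounded_by h `&` io (fresh_near h)) = 0%E.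
Proof.
apply: (@repeated_trials _ _ (annealed_inc P 0) (fresh_near h)
  (fun s => shiftp (size s) @^-1` cyl [:: v]) _ (weight [:: v])).
- by rewrite wv; exact: (weight_le1 P_iid).
- by apply: measurableI; [exact: measurable_bounded_by|exact: measurable_io].
- by move=> s; apply: measurable_shift_preimage; exact: measurable_cyl.
- by move=> s Z _ _; exact: missed_word.
- move=> s [_ fresh]; rewrite -cyl_cat.
  rewrite [X in (_ * X)%E](annealed_cyl P_iid 0) [leRHS](annealed_cyl P_iid 0).
  rewrite -EFinM lee_fin mulrC.
  rewrite (weight_cat P_iid)// => y /departuresP[k ks ->]; rewrite add0r /= inE.
  by apply/eqP; exact: fresh.
- by move=> Z [].
- move=> Z s [bZ _] [sh _] /cylP sZ /cylP /= e.
  have := bZ (size s + 1)%N; rewrite (height_shift fD) {1}/height sZ.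
  rewrite /height e wsum_cons wsum_nil addr0; lra.
Qed.

(** From y, some site c above the bound is reachable; each visit to y starts
    a trial, that of following the word which leads to c. The environment is
    fixed here, since the successive visits to y are not independent under
    the annealed law. *)
Lemma bounded_recurrent_null h y :
  ann (bounded_by h `&` io [set s | wsum s = y]) = 0%E.
Proof.
have mB : measurable (bounded_by h `&` io [set s | wsum s = y]).
  by apply: measurableI; [exact: measurable_bounded_by|exact: measurable_io].
have mH : measurable (high_sink h : set E).
  exact: (env_on_sub (measurable_high_sink h)).
have mf := @measurable_quenched_inc d R 0 _ mB.
rewrite /annealed_inc (@ge0_negligible_integral _ _ _ P setT (~` high_sink h))//=.
- rewrite setTD setCK; apply: integral0_eq => w [c hc cr].
  have /reachable_path_prob[r r0 rc] := cr y.
  apply: (@repeated_trials _ _ (quenched_inc w 0) [set s | wsum s = y]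
    (fun s => shiftp (size s) @^-1` cyl r) _ (path_prob w y r)) => //.
  + by rewrite r0 path_prob_le1.
  + by move=> s; apply: measurable_shift_preimage; exact: measurable_cyl.
  + by move=> s Z _ _; exact: missed_word.
  + by move=> s sy; rewrite -cyl_cat !quenched_inc_cyl -EFinM lee_fin path_prob_cat add0r sy mulrC.
  + by move=> Z [].
  + move=> Z s [bZ _] sy /cylP sZ /cylP /= e.
    have := bZ (size s + size r)%N; rewrite (height_shift fD) {1}/height sZ sy.
    by rewrite /height e -fD rc leNgt hc.
- exact: measurableC.
- by rewrite probability_setC// high_sink_prob subee.
Qed.

(** A walk that is infinitely often in the strip visits infinitely many new
    sites there, or visits one site infinitely often. *)
Lemma bounded_io_null h :
  ann (bounded_by h `&` io [set s | h - f v < f (wsum s)]) = 0%E.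
Proof.
pose F (o : option V) := bounded_by h `&`
  io (if o is Some y then [set s | wsum s = y] else fresh_near h).
have mF o : measurable (F o).
  by apply: measurableI; [exact: measurable_bounded_by|exact: measurable_io].
apply: (null_countable_bigcup (F := F)) => //.
- by apply: measurableI; [exact: measurable_bounded_by|exact: measurable_io].
- by move=> [y|]; [exact: bounded_recurrent_null|exact: bounded_fresh_null].
move=> Z [bZ ioZ].
have [io1|nio1] := pselect (io (fresh_near h) Z); first by exists None.
have /existsNP[n nP] := nio1.
have old k : h - f v < height f Z k ->
    exists2 j, (j <= n)%N & wsum (prefix_of Z j) = wsum (prefix_of Z k).
  elim/ltn_ind: k => k IH hk.
  have [kn|nk] := leqP k n; first by exists k.
  have [j jk jE] : exists2 j, (j < k)%N & wsum (prefix_of Z j) = wsum (prefix_of Z k).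
    apply: contrapT => nj; apply: nP; exists k; first exact: ltnW.
    split => // j; rewrite size_prefix_of => jk; rewrite take_prefix_of ?(ltnW jk)// => jE.
    by apply: nj; exists j.
  have [|i i_n iE] := IH j jk; first by rewrite /height jE.
  by exists i => //; rewrite iE.
have [j jP] : exists j, io [set s | wsum s = wsum (prefix_of Z j)] Z.
  apply: contrapT => /forallNP nio.
  have [N NP] := choice (fun j => (existsNP _).2 (nio j)).
  have [k kN hk] := ioZ (\sum_(j < n.+1) N j)%N.
  have [j jn jE] := old k hk.
  apply: (NP j); exists k => //.
  apply: leq_trans kN; rewrite (bigD1 (Ordinal (jn : (j < n.+1)%N)))//=.
  exact: leq_addr.
by exists (Some (wsum (prefix_of Z j))).
Qed.

(** Consider levels spaced by f v / 2. There is a largest level that the walk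
    exceeds infinitely often; after some time it remains below the next one,
    while it comes infinitely often within f v of it, and [bounded_io_null]
    applies to the walk seen from that time. *)
Lemma bounded_not_down_null :
  ann (~` unbounded f `&` ~` transient (fun x => - f x)) = 0%E.
Proof.
pose B h := bounded_by h `&` io [set s | h - f v < f (wsum s)].
have mB h : measurable (B h).
  by apply: measurableI; [exact: measurable_bounded_by|exact: measurable_io].
pose lev (M j : nat) : R := - M%:R + (f v / 2) * j%:R.
pose F (z : nat * nat * seq V) := cyl z.2 `&`
  shiftp (size z.2) @^-1` B (lev z.1.1 z.1.2 - f (wsum z.2)).
have mF q : measurable (F q) by exact: measurable_cyl_shift.
have mT : measurable (~` unbounded f `&` ~` transient (fun x => - f x)).
  apply: measurableI; apply: measurableC; first exact: measurable_unbounded.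
  exact: measurable_transient.
apply: (null_countable_bigcup (F := F)) => // [q|].
  by apply: (annealed_shift_null P_iid) => //; exact: bounded_io_null.
move=> Z [/existsNP[M0 /forallNP M0Z] /existsNP[M /forallNP MZ]].
have ub k : height f Z k < M0%:R by rewrite ltNge; apply/negP; exact: M0Z.
have io0 n : exists2 k, (n <= k)%N & lev M 0%N < height f Z k.
  have /existsNP[k /not_implyP[nk /negP kM]] := MZ n; exists k => //.
  by move: kM; rewrite -ltNge /height /lev mulr0 addr0 ltrNl.
pose Q j := `[< forall n, exists2 k, (n <= k)%N & lev M j < height f Z k >].
have exQ : exists j, Q j by exists 0%N; apply/asboolP.
have [J JP] := multiple_above ((M + M0)%:R / (f v / 2)) ltr01.
have bQ j : Q j -> (j <= J)%N.
  move=> /asboolP/(_ 0%N)[k _ jk]; rewrite leqNgt; apply/negP => Jj.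
  have : lev M j < M0%:R by apply: lt_trans (ub k).
  apply/negP; rewrite -leNgt /lev addrC lerBrDr -natrD addnC.
  have fv2 : 0 < f v / 2 by rewrite divr_gt0.
  rewrite mulrC -ler_pdivrMr// ltW// (lt_le_trans JP)// ler_nat ltnW//.
have [j /asboolP jQ jmax] := ex_maxnP exQ bQ.
have /existsNP[N NP] : ~ forall n, exists2 k, (n <= k)%N & lev M j.+1 < height f Z k.
  by move=> /asboolP/jmax; rewrite ltnn.
exists (M, j.+1, prefix_of Z N) => //; split => /=; first exact: cyl_prefix.
rewrite size_prefix_of -/(height f Z N); split => [k|n].
  rewrite lerBrDl -(height_shift fD) leNgt; apply/negP => kj; apply: NP.
  by exists (N + k)%N => //; exact: leq_addr.
have [k nk kj] := jQ (N + n)%N; exists (k - N)%N.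
  by rewrite leq_subRL// (leq_trans _ nk)// leq_addr.
have Nk : (N <= k)%N by rewrite (leq_trans _ nk)// leq_addr.
have := height_shift fD Z N (k - N); rewrite subnKC// => e.
rewrite /= -/(height f (shiftp N Z) (k - N)); move: kj; rewrite e /lev -[j.+1%:R]natr1 mulrDr mulr1.
move: (f v / 2 * j%:R) (height f Z N) (height f _ _) (- M%:R) (f v) fv.
by move=> x y z' m u u0 kj; lra.
Qed.

End reachability.

(** * The zero-one law when the opposite direction is null *)

Section dichotomy.
Context {d : nat} {R : realType}.
Local Notation V := (site d).
Local Notation E := (borel (environment d R)).
Implicit Types (w : environment d R) (s t : seq V) (Z : path_space d) (x y u v : V).
Context (P : probability E R) (P_iid : iid P (@local_env d R)).
Local Notation ann := (annealed_inc P 0).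
Local Notation weight := (weight P).

Lemma transient_opp_disjoint (f : V -> R) Z :
  transient f Z -> ~ transient (fun x => - f x) Z.
Proof.
move=> /(_ 1%N)[n nP] /(_ 1%N)[m mP].
have := nP (maxn n m) (leq_maxl _ _); have := mP (maxn n m) (leq_maxr _ _).
by rewrite /height; lra.
Qed.

(** The integral that defines a weight does not see the environments outside
    Q. *)
Lemma weight_pos_witness (Q : environment d R -> Prop) s :
  {ae P, forall w : environment d R, Q w} -> 0 < weight s ->
  exists2 w, Q w & 0 < path_prob w 0 s.
Proof.
move=> [N [mN N0 QN]] s0; apply: contrapT => nex.
have : (\int[P]_w (path_prob w 0 s)%:E)%E = 0%E.
  rewrite (@ge0_negligible_integral _ _ _ P setT N)//=; last 2 first.
  - exact: measurable_path_probE.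
  - by move=> w _; rewrite lee_fin path_prob_ge0.
  apply: integral0_eq => w [_ nN]; apply/eqP; rewrite eqe.
  apply: contra_notT nN => pw0; apply: QN => /= Qw; apply: nex; exists w => //.
  by rewrite lt0r pw0 path_prob_ge0.
by rewrite (weightE P_iid) => /eqP; rewrite eqe gt_eqF.
Qed.

Lemma ae_nonempty (Q : environment d R -> Prop) :
  {ae P, forall w : environment d R, Q w} -> exists w, Q w.
Proof.
by move=> /(@weight_pos_witness Q [::]); rewrite (weight_nil P_iid) ltr01 => /(_ isT)[w]; exists w.
Qed.

(** The pairs (x, v) are countably many, and a step of weight 0 is almost
    surely impossible at each site. *)
Lemma weight_cons_positive :
  {ae P, forall w : environment d R, forall x v, 0 < w (x, x + v) -> 0 < weight [:: v]}.
Proof.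
pose F (xv : V * V) := if 0 < weight [:: xv.2] then set0 else
   [set w : environment d R | 0 < w (xv.1, xv.1 + xv.2)].
have mpos x v : measurable ([set w : environment d R | 0 < w (x, x + v)] : set E).
  rewrite (_ : [set _ | _] = setT `&` (fun w : E => (w : environment d R) (x, x + v)) @^-1` `]0, +oo[%classic).
    by apply: measurable_env_coord.
  by apply/seteqP; split => w /=; rewrite in_itv/= andbT => // -[].
have mF xv : measurable (F xv : set E) by rewrite /F; case: ifP.
exists (\bigcup_xv F xv); split.
- exact: measurable_countable_bigcup.
- apply: (@null_countable_bigcup R _ _ E P F) => // [|[x v]].
    exact: measurable_countable_bigcup.
  rewrite /F /=; case: ifPn => [_|nv]; first exact: measure0.
  have : (\int[P]_w `|(path_prob w x [:: v])%:E|)%E = 0%E.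
    under eq_integral do rewrite gee0_abs ?lee_fin ?path_prob_ge0//.
    rewrite (weightE P_iid); congr EFin; apply/eqP; rewrite eq_le weight_ge0 andbT.
    by rewrite leNgt.
  move=> /ae_eq_integral_abs => /(_ measurableT (measurable_path_probE _ _)) H.
  apply: measure_negligible => //; apply: negligibleS H => w /= w0 /(_ Logic.I) /eqP.
  by rewrite eqe mulr1 gt_eqF.
- move=> w /= /existsNP[x /existsNP[v /not_implyP[xv nv]]].
  by exists (x, v) => //; rewrite /F; case: ifP.
Qed.

Hypothesis P_sink : {ae P, forall w : environment d R, exists c, forall x, reachable w x c}.

(** In a typical environment, a sink c is reachable from c - u, through steps
    that are all of positive weight. *)
Lemma steps_span u : exists2 s, all (fun v => 0 < weight [:: v]) s & wsum s = u.
Proof.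
have H : {ae P, forall w : environment d R,
    (forall x v, 0 < w (x, x + v) -> 0 < weight [:: v]) /\
    exists c, forall x, reachable w x c}.
  move: weight_cons_positive P_sink; apply: filterS2 => [|w]; last by split.
  exact: (@ae_filter_ringOfSetsType _ E).
have [w [wpos [c cr]]] := ae_nonempty H.
have /reachable_path_prob[s s0 sc] := cr (c - u).
exists s; last by apply: (addrI (c - u)); rewrite sc subrK.
elim: s (c - u) s0 {sc} => //= v s IH x vs.
have v0 : 0 < w (x, x + v).
  by rewrite lt0r env_ge0 andbT; apply: contraTneq vs => ->; rewrite mul0r ltxx.
rewrite (wpos _ _ v0) /=; apply: (IH (x + v)).
by rewrite -(pmulr_rgt0 _ v0).
Qed.

Variable f : V -> R.
Hypothesis fD : forall x y, f (x + y) = f x + f y.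
Hypothesis f_neq0 : exists u, f u != 0.

Lemma positive_step : exists2 v, 0 < f v & 0 < weight [:: v].
Proof.
have [u u0] : exists u, 0 < f u.
  have [u] := f_neq0; rewrite neq_lt => /orP[u0|]; last by exists u.
  exists (- u); have := fD u (- u); rewrite subrr (additive0 fD) => e; lra.
have [s] := steps_span u; elim: s u u0 => [|v s IH] u u0 /=.
  by move=> _; rewrite wsum_nil => e; move: u0; rewrite -e (additive0 fD) ltxx.
move=> /andP[v0 sp]; rewrite wsum_cons => e.
have [fv|fv] := ltP 0 (f v); first by exists v.
apply: (IH (wsum s)) => //; move: u0; rewrite -e fD; lra.
Qed.

(** Almost surely, the walk is either unbounded above, and then transient, or
    bounded above, and then transient in the opposite direction. *)
Lemma transient_one : ann (transient f) != 0%E ->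
  ann (transient (fun x => - f x)) = 0%E -> ann (transient f) = 1%E.
Proof.
move=> A0 B0; have [v fv wv] := positive_step.
have a_pos := up_mass_pos P_iid fD A0.
have mA := @measurable_transient d R f.
have mB := @measurable_transient d R (fun x => - f x).
have mU := @measurable_unbounded d R f.
have : ann (~` transient f) = 0%E.
  apply/eqP; rewrite eq_le measure_ge0 andbT.
  apply: (@le_trans _ _ (ann ((unbounded f `\` transient f) `|`
    ((~` unbounded f `&` ~` transient (fun x => - f x)) `|` transient (fun x => - f x))))).
    apply: le_measure; rewrite ?inE.
    - exact: measurableC.
    - by apply: measurableU; [exact: measurableD|apply: measurableU => //;
        apply: measurableI; exact: measurableC].
    - move=> Z nA; have [U|U] := pselect (unbounded f Z); first by left.
      by right; have [B|B] := pselect (transient (fun x => - f x) Z); [right|left].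
  apply: le_trans; first apply: measureU2.
  - exact: measurableD.
  - by apply: measurableU => //; apply: measurableI; exact: measurableC.
  rewrite [X in (X + _)%E](unbounded_not_transient_null P_iid fD a_pos) add0e.
  apply: le_trans; first apply: measureU2 => //.
    by apply: measurableI; exact: measurableC.
  by rewrite [X in (X + _)%E](bounded_not_down_null P_iid P_sink fD fv wv) add0e [leLHS]B0.
have -> : ann (~` transient f) = (1 - ann (transient f))%E.
  exact: (probability_setC (annealed_inc P 0)).
have : ann (transient f) \is a fin_num by exact: fin_num_measure.
case: (ann (transient f)) => // r _ /eqP.
by rewrite -EFinB eqe subr_eq0 eq_sym => /eqP ->.
Qed.

End dichotomy.

Section directions.
Context {d : nat} {R : realType}.
Implicit Types (w : environment d R) (l : 'rV[R]_d).

Definition level l (v : site d) : R := dot (site_vec R v) l.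

Lemma levelD l u v : level l (u + v) = level l u + level l v.
Proof.
rewrite /level /dot -big_split/=; apply: eq_bigr => i _.
by rewrite !mxE intrD mulrDl.
Qed.

Lemma height_increments (f : site d -> R) (X : path_space d) n :
  (forall x y, f (x + y) = f x + f y) ->
  height f (increments X) n = f (X n) - f (X 0%N).
Proof.
move=> fD; elim: n => [|n IH]; first by rewrite /height /= wsum_nil (additive0 fD) subrr.
have -> : height f (increments X) n.+1 = height f (increments X) n + f (increments X n).
  rewrite -addn1 (height_shift fD); congr (_ + _).
  by rewrite /height /prefix_of /= wsum_cons wsum_nil addr0 /shiftp addn0.
rewrite IH /increments; have := fD (X n.+1 - X n) (X n); rewrite subrK => ->; ring.
Qed.

Lemma directionally_transientE l (X : path_space d) :
  directionally_transient l X <-> transient (level l) (increments X).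
Proof.
have hE n : height (level l) (increments X) n = level l (X n) - level l (X 0%N).
  by apply: height_increments; exact: levelD.
split=> [H M|H].
  have [n _ nP] := (cvgryPge _).1 H (M%:R + level l (X 0%N)).
  by exists n => k nk; rewrite hE lerBrDr; exact: nP.
apply/cvgryPge => A.
have [m mA] := multiple_above (A - level l (X 0%N)) ltr01; have [n nP] := H m.
exists n => // k /= nk; have := nP k nk; rewrite hE -/(level l (X k)); lra.
Qed.

(** The walk from 0 almost surely starts at 0, so that its positions are the
    sums of its steps. *)
Lemma annealed_transientE (P : probability (borel (environment d R)) R) l :
  annealed P 0 setT (directionally_transient l) =
  annealed_inc P 0 (transient (level l)).
Proof.
apply: eq_integral => w _.
rewrite -[RHS]/(quenched w 0 (@increments d @^-1` transient (level l))).
congr (quenched _ _ _); apply/seteqP.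
by split => X /directionally_transientE.
Qed.

End directions.

(** * Two planar paths that must meet *)

Section crossing.
Variable R : realDomainType.
Variables (tx hx ty hy : nat -> R) (I J : nat) (r : R).

Let T i j := ty j - tx i.
Let H i j := hy j - hx i.
Let b i j := 0 < H i j.
Let l i j := T i j < 0.

(** Signed crossings of the half-line {T < 0, H = 0} by a move in the grid of
    the pairs (i, j). *)
Let c i j i' j' : int := if l i j then (b i' j')%:R - (b i j)%:R else 0.

(** A discrete winding number. If the two paths never come close to each
    other, the differences (T, H) of their positions avoid a neighbourhood of
    the origin. Then the signed crossings along the boundary of each cell of
    the grid cancel, and so do those along the boundary of the whole grid.
    But the sign of H is known on its four sides, so that only the last move
    of the bottom side and the last move of the left side can cross H = 0;
    the conditions on tx and ty decide that exactly one of them crosses the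
    half-line. *)
Lemma grid_paths_meet :
  0 <= r ->
  (forall i, (i < I)%N -> `|tx i.+1 - tx i| <= r /\ `|hx i.+1 - hx i| <= r) ->
  (forall j, (j < J)%N -> `|ty j.+1 - ty j| <= r /\ `|hy j.+1 - hy j| <= r) ->
  (forall i, (i < I)%N -> hx i < hy 0%N) ->
  (forall j, (j <= J)%N -> hy j <= hx I) ->
  (forall i, (i <= I)%N -> hy J <= hx i) ->
  (forall j, (j < J)%N -> hx 0%N < hy j) ->
  tx I < ty 0%N -> ty J < tx 0%N ->
  exists i j, [/\ (i <= I)%N, (j <= J)%N, `|ty j - tx i| <= 4 * r &
                  `|hy j - hx i| <= 4 * r].
Proof.
move=> r0 stepX stepY bot right_ top left_ tI tJ; apply: contrapT => far.
have apart i j : (i <= I)%N -> (j <= J)%N -> `|H i j| <= 3 * r -> 4 * r < `|T i j|.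
  move=> iI jJ h; rewrite ltNge; apply/negP => h'; apply: far.
  exists i, j; split => //; rewrite /H in h; lra.
have square i j : (i < I)%N -> (j < J)%N ->
    c i j i.+1 j + c i.+1 j i.+1 j.+1 = c i j i j.+1 + c i j.+1 i.+1 j.+1.
  move=> iI jJ; have [+ +] := stepX _ iI; have [+ +] := stepY _ jJ.
  rewrite !ler_norml => /andP[? ?] /andP[? ?] /andP[? ?] /andP[? ?].
  have [bE|bN] := boolP [&& b i j == b i.+1 j, b i j == b i j.+1 & b i j == b i.+1 j.+1].
    move: bE => /and3P[/eqP e1 /eqP e2 /eqP e3]; rewrite /c -e1 -e2 -e3 subrr.
    by do ![case: ifP => _]; rewrite ?addr0.
  (* H changes sign in the cell, so it is small there and T keeps its sign *)
  have h3 : `|H i j| <= 3 * r.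
    rewrite leNgt; apply: contra bN; rewrite lter_normr => /orP[h|h].
      have e i' j' : hy j - hx i - 2 * r <= hy j' - hx i' -> b i' j' = true.
        by rewrite /b /H => ?; rewrite /H in h; apply/idP; lra.
      by rewrite !e //; lra.
    have e i' j' : hy j' - hx i' <= hy j - hx i + 2 * r -> b i' j' = false.
      by rewrite /b /H => ?; rewrite /H in h; apply/negbTE; rewrite -leNgt; lra.
    by rewrite !e //; lra.
  have := apart i j (ltnW iI) (ltnW jJ) h3; rewrite lter_normr /T => /orP[t4|t4].
    have e i' j' : ty j - tx i - 2 * r <= ty j' - tx i' -> l i' j' = false.
      by rewrite /l /T => ?; apply/negbTE; rewrite -leNgt; lra.
    by rewrite /c !e //; lra.
  have e i' j' : ty j' - tx i' <= ty j - tx i + 2 * r -> l i' j' = true.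
    by rewrite /l /T => ?; apply/idP; lra.
  by rewrite /c !e; [ring|lra..].
have rect k m : (k <= I)%N -> (m <= J)%N ->
    \sum_(i < k) c i 0%N i.+1 0%N + \sum_(j < m) c k j k j.+1 =
    \sum_(j < m) c 0%N j 0%N j.+1 + \sum_(i < k) c i m i.+1 m.
  elim: m k => [|m IHm] k kI mJ; first by rewrite !big_ord0 add0r addr0.
  rewrite !big_ord_recr /= addrA IHm ?(ltnW mJ)// -!addrA; congr (_ + _).
  elim: k kI => [|k IHk] kI; first by rewrite !big_ord0 add0r addr0.
  rewrite !big_ord_recr /=.
  transitivity (\sum_(i < k) c i m i.+1 m + c k m k m.+1 + c k m.+1 k.+1 m.+1).
    by rewrite -!addrA square.
  by rewrite IHk ?(ltnW kI)// -addrA.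
have b_bot i : (i < I)%N -> b i 0%N = true by move=> /bot; rewrite /b /H subr_gt0.
have b_right j : (j <= J)%N -> b I j = false.
  by move=> /right_; rewrite /b /H subr_gt0 ltNge => ->.
have b_top i : (i <= I)%N -> b i J = false.
  by move=> /top; rewrite /b /H subr_gt0 ltNge => ->.
have b_left j : (j < J)%N -> b 0%N j = true by move=> /left_; rewrite /b /H subr_gt0.
have [I0|I0] := posnP I.
  have [J0|J0] := posnP J.
    by move: tI tJ; rewrite I0 J0; lra.
  by have := b_right 0%N (ltnW J0); rewrite I0 b_left.
have [J0|J0] := posnP J.
  by have := b_top 0%N (ltnW I0); rewrite J0 b_bot.
have := rect I J (leqnn _) (leqnn _).
rewrite [X in _ + X]big1 => [|j _]; last first.
  by rewrite /c !b_right// ?subrr ?if_same// ltnW.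
rewrite [X in _ = _ + X]big1 => [|i _]; last first.
  by rewrite /c !b_top// ?subrr ?if_same// ltnW.
rewrite !addr0.
have [I' IE] : exists I', I = I'.+1 by exists I.-1; rewrite prednK.
have [J' JE] : exists J', J = J'.+1 by exists J.-1; rewrite prednK.
have -> : \sum_(i < I) c i 0%N i.+1 0%N = c I' 0%N I 0%N.
  have e : \sum_(i < I'.+1) c i 0%N i.+1 0%N = c I' 0%N I'.+1 0%N.
    rewrite big_ord_recr /= big1 ?add0r// => i _.
    rewrite /c !b_bot ?subrr ?if_same// IE ?ltnS//; exact: ltnW.
  by rewrite -IE in e.
have -> : \sum_(j < J) c 0%N j 0%N j.+1 = c 0%N J' 0%N J.
  have e : \sum_(j < J'.+1) c 0%N j 0%N j.+1 = c 0%N J' 0%N J'.+1.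
    rewrite big_ord_recr /= big1 ?add0r// => j _.
    rewrite /c !b_left ?subrr ?if_same// JE ?ltnS//; exact: ltnW.
  by rewrite -JE in e.
have I'I : (I' < I)%N by rewrite IE.
have J'J : (J' < J)%N by rewrite JE.
rewrite /c (b_bot _ I'I) b_right// (b_left _ J'J) b_top//.
have -> : l I' 0%N = false.
  have := b_bot _ I'I; have := b_right 0%N (leq0n _); rewrite /b => /negbT.
  rewrite -leNgt /H => h1 h2.
  have := stepX _ I'I; rewrite -IE !ler_norml => -[/andP[? ?] /andP[? ?]].
  have : 4 * r < `|T I 0|.
    by apply: apart => //; rewrite /H ler_norml; apply/andP; split; lra.
  rewrite /T /l lter_normr => /orP[?|?]; last by exfalso; lra.
  by apply/negbTE; rewrite -leNgt /T; lra.
have -> : l 0%N J' = true.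
  have := b_left _ J'J; have := b_top 0%N (leq0n _); rewrite /b => /negbT.
  rewrite -leNgt /H => h1 h2.
  have := stepY _ J'J; rewrite -JE !ler_norml => -[/andP[? ?] /andP[? ?]].
  have : 4 * r < `|T 0 J|.
    by apply: apart => //; rewrite /H ler_norml; apply/andP; split; lra.
  rewrite /T /l lter_normr => /orP[?|?]; first by exfalso; lra.
  rewrite /T; lra.
by [].
Qed.

End crossing.

(** * Words without loops and upward words *)

Section simple_words.
Context {d : nat} {R : realType}.
Local Notation V := (site d).
Local Notation E := (borel (environment d R)).
Implicit Types (w : environment d R) (s t : seq V) (x y u v : V) (p : seq V).
Context (P : probability E R) (P_iid : iid P (@local_env d R)).
Local Notation weight := (weight P).
Local Notation allowed := (all (fun v => 0 < weight [:: v])).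

Fixpoint sites_of x s : seq V :=
  if s is v :: s' then x + v :: sites_of (x + v) s' else [::].

Fixpoint steps_of x p : seq V :=
  if p is y :: p' then y - x :: steps_of y p' else [::].

Lemma last_sites x s : last x (sites_of x s) = x + wsum s.
Proof.
elim: s x => [|v s IH] x /=; first by rewrite wsum_nil addr0.
by rewrite IH wsum_cons addrA.
Qed.

Lemma wsum_steps x p : wsum (steps_of x p) = last x p - x.
Proof.
elim: p x => [|y p IH] x /=; first by rewrite wsum_nil subrr.
by rewrite wsum_cons IH addrC addrA subrK.
Qed.

Lemma departures_sites x s : departures x s = belast x (sites_of x s).
Proof. by elim: s x => //= v s IH x; rewrite IH. Qed.

Lemma departures_steps x p : departures x (steps_of x p) = belast x p.
Proof.
elim: p x => //= y p IH x; congr (_ :: _).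
by rewrite addrC subrK IH.
Qed.

Lemma path_sites x s :
  path (fun a b => 0 < weight [:: b - a]) x (sites_of x s) = allowed s.
Proof.
elim: s x => //= v s IH x; rewrite IH; congr (_ && _).
by rewrite addrAC subrr add0r.
Qed.

Lemma allowed_steps x p :
  allowed (steps_of x p) = path (fun a b => 0 < weight [:: b - a]) x p.
Proof. by elim: p x => //= y p IH x; rewrite IH. Qed.

(** Loop erasure. As the departures of the new word are distinct, its weight
    is the product of the weights of its steps: [weight_simple]. *)
Lemma simple_word x s : allowed s -> exists s',
  [/\ allowed s', uniq (departures x s'), wsum s' = wsum s,
      {subset departures x s' <= departures x s} & x + wsum s \notin departures x s'].
Proof.
rewrite -(path_sites x) => sa; have := last_sites x s.
case/shortenP: sa => p pe pu ps pl.
have pu' : uniq (rcons (belast x p) (last x p)) by rewrite -lastI.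
move: pu'; rewrite rcons_uniq => /andP[lp bu].
exists (steps_of x p); rewrite allowed_steps departures_steps wsum_steps pl; split => //; last 2 first.
- move=> y yp; rewrite departures_sites.
  have : y \in x :: sites_of x s.
    by have := mem_belast yp; rewrite !inE => /orP[->//|/ps ->]; rewrite orbT.
  rewrite lastI mem_rcons inE last_sites => /orP[/eqP ye|//].
  by move: lp; rewrite pl -ye yp.
- by rewrite -pl.
- by rewrite addrC addKr.
Qed.

Lemma weight_simple s : allowed s -> uniq (departures 0 s) -> 0 < weight s.
Proof.
elim/last_ind: s => [|s v IH]; first by rewrite (weight_nil P_iid).
rewrite all_rcons -cats1 departures_cat cat_uniq => /andP[v0 sa] /and3P[us /hasPn nv _].
rewrite (weight_cat P_iid) ?mulr_gt0// ?IH// => y ys; apply/negP => yv.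
by rewrite add0r in nv; have := nv _ yv; rewrite ys.
Qed.

Lemma departures_shift x s y : (y \in departures x s) = (y - x \in departures 0 s).
Proof.
apply/departuresP/departuresP => -[k ks e]; exists k => //.
  by rewrite e addrC addKr add0r.
by rewrite -(add0r (wsum _)) -e addrC subrK.
Qed.

Lemma weight_cat_le s t : weight (s ++ t) <= weight s.
Proof.
rewrite -lee_fin -(annealed_cyl P_iid 0) -(annealed_cyl P_iid 0 s).
apply: le_measure; rewrite ?inE; [exact: measurable_cyl..|].
by rewrite cyl_cat => Z [].
Qed.

End simple_words.

Section upward.
Context {d : nat} {R : realType}.
Local Notation V := (site d).
Local Notation E := (borel (environment d R)).
Implicit Types (s t : seq V) (x y u v : V).
Variable f : V -> R.
Hypothesis fD : forall x y, f (x + y) = f x + f y.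

(** Successive upward words depart from disjoint sites, at heights separated
    by the end of the first one; so their weights multiply. *)
Definition upward s : Prop :=
  0 <= f (wsum s) /\ forall y, y \in departures 0 s -> 0 <= f y < f (wsum s).

Lemma up_wordsP L s : 0 <= L -> up_words f L s <->
  L <= f (wsum s) /\ forall y, y \in departures 0 s -> 0 <= f y < L.
Proof.
move=> L0; split=> [[s0 sL Ls]|[Ls sL]].
  split => // y /departuresP[k ks ->]; rewrite add0r s0 ?sL//; exact: ltnW.
have sL' k : (k < size s)%N -> 0 <= f (wsum (take k s)) < L.
  by move=> ks; apply: sL; apply/departuresP; exists k; rewrite ?add0r.
split=> // [k|k /sL'/andP[]//].
rewrite leq_eqVlt => /orP[/eqP ->|/sL'/andP[]//].
by rewrite take_size (le_trans L0).
Qed.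

Lemma up_words_upward L s : 0 <= L -> up_words f L s -> upward s.
Proof.
move=> L0 /(up_wordsP _ L0)[Ls sL]; split; first exact: le_trans Ls.
by move=> y /sL/andP[-> yL] /=; exact: lt_le_trans Ls.
Qed.

Lemma upward_cat s t : upward s -> upward t -> upward (s ++ t).
Proof.
move=> [s0 sP] [t0 tP]; rewrite /upward wsum_cat fD; split; first exact: addr_ge0.
move=> y; rewrite departures_cat mem_cat add0r => /orP[/sP/andP[-> ys]|].
  by rewrite (lt_le_trans ys)// lerDl.
rewrite departures_shift => /tP; rewrite -[in X in X -> _](addrK (wsum s) y) => yt.
have fy : f y = f (y - wsum s) + f (wsum s) by rewrite -fD subrK.
rewrite addrK in yt; rewrite fy; lra.
Qed.

Lemma upward_nseq k v : 0 < f v -> upward (nseq k v).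
Proof.
move=> fv; elim: k => [|k IH]; first by split; rewrite ?wsum_nil ?(additive0 fD).
rewrite -[k.+1]addn1 nseqD; apply: upward_cat => //; split.
  by rewrite /= wsum_cons wsum_nil addr0 ltW.
by move=> y; rewrite /= inE wsum_cons wsum_nil addr0 => /eqP ->; rewrite (additive0 fD) lexx.
Qed.

Context (P : probability E R) (P_iid : iid P (@local_env d R)).
Local Notation weight := (weight P).

Lemma weight_upward_cat s t : upward s -> upward t -> weight (s ++ t) = weight s * weight t.
Proof.
move=> [_ sP] [t0 tP]; apply: (weight_cat P_iid) => y /sP/andP[_ ys].
apply/negP; rewrite departures_shift => /tP/andP[+ _].
have fy : f y = f (y - wsum s) + f (wsum s) by rewrite -fD subrK.
lra.
Qed.

Lemma weight_nseq k v : 0 < f v -> weight (nseq k v) = weight [:: v] ^+ k.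
Proof.
move=> fv; elim: k => [|k IH]; first by rewrite (weight_nil P_iid).
rewrite -[k.+1]addn1 nseqD weight_upward_cat ?IH ?exprD//; exact: upward_nseq.
Qed.

Lemma up_words_cat L M s t : 0 <= L -> 0 <= M -> upward s -> f (wsum s) + M = L ->
  up_words f M t -> up_words f L (s ++ t).
Proof.
move=> L0 M0 [s0 sP] e /(up_wordsP _ M0)[tM tP]; apply/up_wordsP => //.
rewrite wsum_cat fD; split; first by rewrite -e lerD2l.
move=> y; rewrite departures_cat mem_cat add0r => /orP[/sP|]; first by lra.
rewrite departures_shift => /tP.
have fy : f y = f (y - wsum s) + f (wsum s) by rewrite -fD subrK.
lra.
Qed.

End upward.

(** * Lateral spread of the climbs *)

Section spread.
Context {d : nat} {R : realType}.
Local Notation V := (site d).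
Local Notation E := (borel (environment d R)).
Implicit Types (s : seq V) (x y u v : V).
Context (P : probability E R) (P_iid : iid P (@local_env d R)).
Hypothesis P_sink : {ae P, forall w : environment d R, exists c, forall x, reachable w x c}.
Local Notation weight := (weight P).
Local Notation allowed := (all (fun v => 0 < weight [:: v])).

(** By [mass_starts], the annealed probability of starting with a word of W,
    when W is prefix-free. *)
Definition mass (W : set (seq V)) : \bar R := \esum_(s in W) (weight s)%:E.

Lemma mass_ge0 W : (0 <= mass W)%E.
Proof. by apply: esum_ge0 => s _; rewrite lee_fin weight_ge0. Qed.

Lemma mass_starts x W : prefix_free W -> annealed_inc P x (starts W) = mass W.
Proof. exact: annealed_starts. Qed.

Lemma mass_le1 W : prefix_free W -> (mass W <= 1)%E.
Proof.
move=> pf; rewrite -(mass_starts 0 pf); apply: probability_le1.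
exact: measurable_starts.
Qed.

Lemma mass_split W (Q : set (seq V)) :
  mass W = (mass (W `&` Q) + mass (W `&` ~` Q))%E.
Proof. by rewrite /mass (esumID Q)// => s _; rewrite lee_fin weight_ge0. Qed.

Lemma mass_inj (p : R) (W W' : set (seq V)) (e : seq V -> seq V) : 0 <= p ->
  (forall s, W s -> W' (e s)) -> {in W &, injective e} ->
  (forall s, W s -> p * weight s <= weight (e s)) -> (p%:E * mass W <= mass W')%E.
Proof.
move=> p0 We einj wte; rewrite /mass -esumZl//; last first.
  by move=> s; rewrite lee_fin weight_ge0.
have wt0 s : (0 <= (weight s)%:E)%E by rewrite lee_fin weight_ge0.
have pwt0 s : (0 <= p%:E * (weight s)%:E)%E by rewrite mule_ge0.
apply: (esum_le_inj pwt0 wt0 We einj) => s Ws.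
by rewrite -EFinM lee_fin wte.
Qed.

Variables (f t : V -> R).
Hypothesis fD : forall x y, f (x + y) = f x + f y.
Hypothesis tD : forall x y, t (x + y) = t x + t y.
Variable v : V.
Hypotheses (fv : 0 < f v) (wv : 0 < weight [:: v]).

Lemma nseq_wsum k : wsum (nseq k v) = v *+ k.
Proof. by elim: k => [|k IH]; rewrite ?wsum_nil ?mulr0n// wsum_cons IH mulrS. Qed.

(** A word that leads to u may go too low or too high on its way; i steps v
    in front of it and i steps v behind make room on both sides. Loop erasure
    then gives the word a positive weight. *)
Lemma upward_to u : exists i0 : nat, forall i : nat, (i0 <= i)%N -> exists s,
  [/\ upward f s, 0 < weight s & wsum s = v *+ (i + i) + u].
Proof.
have [r ra ru] := steps_span P_iid P_sink u.
have [b [b0 bP ub]] : exists b : R, [/\ 0 <= b,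
    forall y, y \in departures 0 r -> `|f y| + `|f u| <= b & `|f u| <= b].
  exists (\sum_(y <- departures 0 r) `|f y| + `|f u|); split.
  - by rewrite addr_ge0// sumr_ge0.
  - by move=> y yr; rewrite lerD2r (big_rem y)//= lerDl sumr_ge0.
  - by rewrite lerDr sumr_ge0.
have [i0 i0P] := multiple_above b fv; exists i0 => i i0i.
have ib : b < f v *+ i by apply: lt_le_trans i0P _; rewrite ler_wpMn2l// ltW.
pose s0 := nseq i v ++ (r ++ nseq i v).
have s0a : allowed s0.
  by rewrite /s0 !all_cat ra !all_nseq wv !orbT.
have s0u : wsum s0 = v *+ (i + i) + u.
  by rewrite /s0 !wsum_cat !nseq_wsum ru mulrnDr [u + _]addrC addrA.
have fend : f (v *+ (i + i) + u) = f v *+ i + f v *+ i + f u.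
  by rewrite fD (additive_mulrn fD) mulrnDr.
have fu : - b <= f u.
  by have := ler_norm (- f u); rewrite normrN; lra.
have up0 : forall y, y \in departures 0 s0 -> 0 <= f y < f (wsum s0).
  move=> y; rewrite s0u fend /s0 departures_cat mem_cat => /orP[yd|].
    have [n0 nP] := upward_nseq fD i fv.
    by have := nP _ yd; rewrite nseq_wsum (additive_mulrn fD); lra.
  rewrite departures_cat mem_cat add0r nseq_wsum => /orP[|].
    rewrite departures_shift => /bP.
    have -> : f y = f (y - v *+ i) + f v *+ i.
      by rewrite -(additive_mulrn fD) -fD subrK.
    have := ler_norm (f (y - v *+ i)); have := ler_norm (- f (y - v *+ i)).
    have := ler_norm (- f u); rewrite !normrN.
    move: (f (y - v *+ i)) (f v *+ i) ib => g a ib g1 g2 g3 g4; have g5 := normr_ge0 (f u).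
    by apply/andP; split; lra.
  rewrite departures_shift ru => yd.
  have [n0 nP] := upward_nseq fD i fv.
  have := nP _ yd; rewrite nseq_wsum (additive_mulrn fD).
  have : f y = f (y - (v *+ i + u)) + f v *+ i + f u.
    by rewrite -addrA -(additive_mulrn fD) -fD -fD subrK.
  lra.
have [s [sa su sE sd _]] := simple_word 0 s0a.
exists s; split; last by rewrite sE s0u.
- split; first by rewrite sE s0u fend; lra.
  by move=> y /sd/up0; rewrite sE.
- exact: (weight_simple P_iid).
Qed.

Hypothesis t_unbounded :
  exists D : R, forall T : R, exists2 u, 0 <= f u <= D & T <= `|t u|.
Variable a0 : R.
Hypothesis a0_gt0 : 0 < a0.
Hypothesis a0P : forall L, (a0%:E <= mass (up_words f L))%E.

(** In front of a climb one can insert one of two fixed words, al and be.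
    Their lateral displacements differ by the large amount t u, while their
    heights only differ by f u, which at most k0 steps v at the end of the
    climb compensate. Whatever the climb, one of the two results ends far
    from c, and its weight has only lost a constant factor. *)
Lemma spread (N : R) : exists2 a : R, 0 < a & exists L0 : R, forall L, L0 <= L ->
  forall c : R,
    (a%:E <= mass [set s | up_words f L s /\ (N < `|t (wsum s) - c|)%R])%E.
Proof.
have [D DP] := t_unbounded.
have [k0 /ltW k0D] := multiple_above D fv.
have [u /andP[u0 uD] tu] := DP (2 * `|N| + 1 + k0%:R * `|t v|).
have [i1 i1P] := upward_to 0; have [i2 i2P] := upward_to u.
pose i := maxn i1 i2.
have [be [bu bw bE]] := i1P i (leq_maxl _ _).
have [al [au aw aE]] := i2P i (leq_maxr _ _).
have {}bE : wsum be = v *+ (i + i) by rewrite bE addr0.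
pose p := Num.min (weight al) (weight be * weight [:: v] ^+ k0).
have p0 : 0 < p by rewrite lt_min aw mulr_gt0// exprn_gt0.
have fal : f (wsum al) = f (wsum be) + f u by rewrite aE fD bE.
exists (p * a0 / 2); first by rewrite divr_gt0// mulr_gt0.
exists (f (wsum al)) => L L0 c.
pose L1 := L - f (wsum al).
have L1ge0 : 0 <= L1 by rewrite subr_ge0.
have Lge0 : 0 <= L by apply: le_trans L0; case: au.
set W' := [set s | _].
pose W := up_words f L1.
have pW : prefix_free W by exact: up_words_prefix_free.
pose Q := [set s | N < `|t (wsum (al ++ s)) - c|].
have half1 : (p%:E * mass (W `&` Q) <= mass W')%E.
  apply: (@mass_inj p _ _ (cat al)) => [|s [Ws Qs]|s s' _ _ /eqP|s [Ws _]].
  - exact: ltW.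
  - by split => //; apply: (up_words_cat fD Lge0 L1ge0 au) => //; rewrite /L1 addrC subrK.
  - by rewrite eqseq_cat// eqxx => /eqP.
  - rewrite (weight_upward_cat fD P_iid)//; last exact: (up_words_upward L1ge0).
    by rewrite ler_wpM2r ?weight_ge0// ge_min lexx.
(* the least number of extra steps that lifts s by f u *)
have [j jP] : exists j : seq V -> nat, forall s, W s ->
   (j s <= k0)%N /\ up_words f (L1 + f u) (s ++ nseq (j s) v).
  suff /choice[j jP] : forall s, exists j : nat, W s ->
     (j <= k0)%N /\ up_words f (L1 + f u) (s ++ nseq j v) by exists j.
  move=> s; have [Ws|nW] := pselect (W s); last by exists 0%N => /nW.
  have /(up_wordsP _ _ L1ge0)[Ls sP] := Ws.
  have ex : exists j, L1 + f u <= f (wsum s) + f v *+ j.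
    by exists k0; rewrite lerD// (le_trans uD).
  have [j jL jmin] := ex_minnP ex.
  exists j => _; split; first by apply: jmin; rewrite lerD// (le_trans uD).
  apply/up_wordsP; first exact: addr_ge0.
  rewrite wsum_cat fD nseq_wsum (additive_mulrn fD); split => // y.
  rewrite departures_cat mem_cat add0r => /orP[/sP/andP[-> yL] /=|].
    by rewrite (lt_le_trans yL)// lerDl.
  move=> /departuresP[k]; rewrite size_nseq => kj ->.
  rewrite take_nseq ?(ltnW kj)// nseq_wsum fD (additive_mulrn fD).
  apply/andP; split.
    rewrite addr_ge0 ?mulrn_wge0 ?(ltW fv)//; exact: le_trans Ls.
  by rewrite ltNge; apply/negP => /jmin; rewrite leqNgt kj.

have half2 : (p%:E * mass (W `&` ~` Q) <= mass W')%E.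
  apply: (@mass_inj p _ _ (fun s => be ++ (s ++ nseq (j s) v))).
  - exact: ltW.
  - move=> s [Ws nQ]; have [jk sj] := jP s Ws; split.
      apply: (up_words_cat fD Lge0 _ bu _ sj); first exact: addr_ge0.
      by rewrite /L1 fal; lra.
    move: nQ => /negP; rewrite -leNgt !wsum_cat nseq_wsum !tD (additive_mulrn tD).
    rewrite aE bE tD => nQ; rewrite ltNge; apply/negP => nQ'.
    have : `|t u - t v *+ j s| <= 2 * `|N|.
      have -> : t u - t v *+ j s = (t (v *+ (i + i)) + t u + t (wsum s) - c) -
         (t (v *+ (i + i)) + (t (wsum s) + t v *+ j s) - c) by ring.
      by apply: (le_trans (ler_normB _ _)); have := ler_norm N; lra.
    have : `|t u| <= `|t u - t v *+ j s| + `|t v *+ j s|.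
      by rewrite -{1}(subrK (t v *+ j s) (t u)) ler_normD.
    have : `|t v *+ j s| <= k0%:R * `|t v|.
      rewrite normrMn -[leLHS]mulr_natl; apply: ler_wpM2r => //.
      by rewrite ler_nat.
    lra.
  - move=> s s'; rewrite !inE => -[Ws _] [Ws' _] /eqP; rewrite eqseq_cat// eqxx /= => /eqP e.
    apply: (prefix_free_trivIset pW) => //.
    exists (fun k => nth 0 (s ++ nseq (j s) v) k); split.
      by move=> k ks; rewrite nth_cat ks.
    by move=> k ks; rewrite e nth_cat ks.
  - move=> s [Ws _]; have [jk sj] := jP s Ws.
    have su : upward f s by exact: (up_words_upward L1ge0).
    rewrite (weight_upward_cat fD P_iid)//; last first.
      by apply: (upward_cat fD) => //; exact: upward_nseq.
    rewrite (weight_upward_cat fD P_iid)//; last exact: upward_nseq.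
    rewrite (weight_nseq fD P_iid)//.
    apply: (@le_trans _ _ (weight be * weight [:: v] ^+ k0 * weight s)).
      by rewrite ler_wpM2r ?weight_ge0// ge_min lexx orbT.
    rewrite -mulrA ler_wpM2l ?weight_ge0// mulrC ler_wpM2l ?weight_ge0//.
    by apply: ler_wiXn2l => //; [exact: weight_ge0|exact: (weight_le1 P_iid)].
have W1 : mass W' \is a fin_num.
  rewrite ge0_fin_numE ?mass_ge0//; apply: le_lt_trans (ltry 1).
  apply: mass_le1 => s s' [Ws _] [Ws' _]; exact: (up_words_prefix_free Ws).
have H : (p%:E * mass W <= mass W' + mass W')%E.
  by rewrite (mass_split W Q) ge0_muleDr ?mass_ge0// leeD.
have : (p%:E * a0%:E <= mass W' + mass W')%E.
  by apply: le_trans H; apply: lee_wpmul2l; [exact: ltW|exact: a0P].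
rewrite -(fineK W1) -EFinM -EFinD !lee_fin; lra.
Qed.

End spread.

(** * Pigeonhole on the lateral displacements *)

Definition wmass (R : realType) (T : choiceType) (g : T -> R) (Q : set T) : \bar R :=
  \esum_(x in Q) (g x)%:E.

Definition between (R : realType) (m z e e' : R) : Prop :=
  (e + m <= z /\ z + m <= e') \/ (e' + m <= z /\ z + m <= e).

Section weighted_counting.
Context {R : realType}.
Local Open Scope ereal_scope.

Lemma wmass_ge0 (T : choiceType) (g : T -> R) Q : (forall x, 0 <= g x)%R ->
  0 <= wmass g Q.
Proof. by move=> g0; apply: esum_ge0 => x _; rewrite lee_fin. Qed.

Lemma wmass_le (T : countType) (g : T -> R) (Q Q' : set T) : (forall x, 0 <= g x)%R ->
  Q `<=` Q' -> wmass g Q <= wmass g Q'.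
Proof. by move=> g0; apply: esum_le_sub => x; rewrite lee_fin. Qed.

Lemma wmass_fibers (T T' : countType) (g : T -> R) (h : T' -> R)
    (A : set T) (Q : set (T * T')) (c : R) :
  (forall x, 0 <= g x)%R -> (forall y, 0 <= h y)%R -> (0 <= c)%R ->
  (forall x, A x -> c%:E <= wmass h [set y | Q (x, y)]) ->
  c%:E * wmass g A <= wmass (fun q => g q.1 * h q.2)%R Q.
Proof.
move=> g0 h0 c0 cQ.
apply: (@le_trans _ _ (\esum_(x in A) \esum_(y in [set y | Q (x, y)]) (g x * h y)%:E)).
  have gE x : 0 <= (g x)%:E by rewrite lee_fin.
  have hE y : 0 <= (h y)%:E by rewrite lee_fin.
  rewrite /wmass -esumZl//.
  apply: le_esum => x Ax.
  under eq_esum do rewrite EFinM.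
  rewrite esumZl//.
  by rewrite muleC lee_wpmul2l ?lee_fin//; exact: cQ.
rewrite esum_esum; last by move=> x y _ _; rewrite lee_fin mulr_ge0.
apply: wmass_le => [q|]; first exact: mulr_ge0.
by move=> [x y] [].
Qed.

Lemma wmass_cofibers (T T' : countType) (g : T -> R) (h : T' -> R)
    (B : set T') (Q : set (T * T')) (c : R) :
  (forall x, 0 <= g x)%R -> (forall y, 0 <= h y)%R -> (0 <= c)%R ->
  (forall y, B y -> c%:E <= wmass g [set x | Q (x, y)]) ->
  c%:E * wmass h B <= wmass (fun q => g q.1 * h q.2)%R Q.
Proof.
move=> g0 h0 c0 cQ.
apply: le_trans (wmass_fibers (Q := [set q | Q (q.2, q.1)]) h0 g0 c0 cQ) _.
apply: (@esum_le_inj _ _ _ _ _ _ _ (fun q => (q.2, q.1))) => //.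
- by move=> q; rewrite lee_fin mulr_ge0.
- by move=> q; rewrite lee_fin mulr_ge0.
- by move=> [x y] [x' y'] _ _ [-> ->].
- by move=> q _; rewrite lee_fin mulrC.
Qed.

Lemma wmass_bigcup_ord (T : countType) (g : T -> R) n (Q : 'I_n -> set T) :
  (forall x, 0 <= g x)%R ->
  wmass g [set x | exists k, Q k x] <= \sum_(k < n) wmass g (Q k).
Proof.
move=> g0; rewrite /wmass.
have -> : \sum_(k < n) \esum_(x in Q k) (g x)%:E =
    \esum_(x in setT) \sum_(k < n) (if x \in Q k then (g x)%:E else 0).
  rewrite esum_sum => [|x k _ _]; last by case: ifP; rewrite ?lee_fin.
  by apply: eq_bigr => k _; rewrite esum_mkcond.
rewrite esum_mkcond; apply: le_esum => x _.
case: ifPn => [|_]; last by apply: sume_ge0 => k _; case: ifP; rewrite ?lee_fin.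
rewrite inE => -[k Qk]; rewrite (bigD1 k)//= ifT ?inE// leeDl//.
by apply: sume_ge0 => j _; case: ifP; rewrite ?lee_fin.
Qed.

(** As e varies in a window of radius 6 s and is at distance more than s from
    e', the interval between them contains, with a margin s / 4, a point of a
    grid of mesh s / 2; 33 points of this grid are enough. *)
Lemma pigeonhole_between (T : countType) (g : T -> R) (Q : set T) (e e' : T -> R)
    (c s m : R) : (forall x, 0 <= g x)%R -> (0 < s)%R ->
  (forall x, Q x -> (`|e x - c| <= 6 * s)%R /\ (s < `|e' x - e x|)%R) ->
  m%:E <= wmass g Q ->
  exists z, (m / 33)%:E <= wmass g [set x | Q x /\ between (s / 4) z (e x) (e' x)].
Proof.
move=> g0 s0 QP mQ.
pose z (k : 'I_33) : R := (c - 8 * s + (s / 2) * k%:R)%R.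
pose Qk k := [set x | Q x /\ between (s / 4) (z k) (e x) (e' x)].
apply: contrapT => /forallNP nz.
have {}nz k : wmass g (Qk k) < (m / 33)%:E.
  by rewrite ltNge; apply/negP; exact: nz.
have fin k : wmass g (Qk k) \is a fin_num.
  by rewrite ge0_fin_numE ?wmass_ge0// (lt_trans (nz k))// ltry.
suff : m%:E < m%:E by rewrite ltxx.
apply: le_lt_trans mQ _; apply: (@le_lt_trans _ _ (\sum_(k < 33) wmass g (Qk k))).
  apply: le_trans (wmass_bigcup_ord Qk g0); apply: wmass_le => // x Qx.
  have [ec es] := QP x Qx.
  have grid (y : R) : (`|y - c| <= 7 * s)%R ->
      exists k : 'I_33, (z k <= y /\ y < z k + s / 2)%R.
    rewrite ler_norml => /andP[y1 y2].
    have y0 : (0 <= (y - c + 8 * s) / (s / 2))%R.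
      by rewrite divr_ge0 ?divr_ge0// ?ltW//; lra.
    have /andP[t1 t2] := truncn_itv y0.
    set k := Num.trunc _ in t1 t2.
    have kk : (k < 33)%N.
      rewrite -(ltr_nat R); apply: le_lt_trans t1 _.
      rewrite ltr_pdivrMr ?divr_gt0//; lra.
    exists (Ordinal kk); rewrite /z /=.
    rewrite ler_pdivlMr ?divr_gt0// in t1.
    rewrite ltr_pdivrMr ?divr_gt0// -natr1 in t2.
    by split; lra.
  move: ec; rewrite ler_norml => /andP[e1 e2].
  move: es; rewrite lter_normr => /orP[es|es].
    have [|k [k1 k2]] := grid (e x + 3 * s / 4)%R.
      by rewrite ler_norml; apply/andP; split; lra.
    by exists k; split => //; left; split; lra.
  have [|k [k1 k2]] := grid (e x - s / 4)%R.
    by rewrite ler_norml; apply/andP; split; lra.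
  by exists k; split => //; right; split; lra.
have {}nz k : (fine (wmass g (Qk k)) < m / 33)%R by rewrite -lte_fin fineK.
rewrite (eq_bigr (fun k => (fine (wmass g (Qk k)))%:E)); last by move=> k _; rewrite fineK.
rewrite sumEFin lte_fin.
apply: (@lt_le_trans _ _ (\sum_(k < 33) (m / 33))%R).
  apply: ltr_sum => [|k _]; last exact: nz.
  by apply/hasP; exists ord0 => //; rewrite mem_index_enum.
by rewrite sumr_const card_ord -mulr_natl; lra.
Qed.

(** A finite total weight is carried, up to a, by a finite set, on which p is
    bounded. *)
Lemma wmass_tail (T : countType) (g : T -> R) (U : set T) (p : T -> R) (a : R) :
  (forall x, 0 <= g x)%R -> (0 < a)%R -> wmass g U <= 1 ->
  exists s0 : R, forall s, (s0 <= s)%R ->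
    wmass g [set x | U x /\ (s < `|p x|)%R] < a%:E.
Proof.
move=> g0 a0 U1.
have Ufin : wmass g U \is a fin_num.
  by rewrite ge0_fin_numE ?wmass_ge0// (le_lt_trans U1)// ltry.
have [_ [F [finF FU] <-] FS] := ub_ereal_sup_adherent a0 Ufin.
have FE : (\sum_(x \in F) (g x)%:E)%E = wmass g F.
  by rewrite /wmass esum_fset// => x _; rewrite lee_fin.
exists (\sum_(x <- fset_set F) `|p x|)%R => s ps.
have sub : [set x | U x /\ (s < `|p x|)%R] `<=` U `&` ~` F.
  move=> x [Ux sx]; split => // Fx; move: sx; rewrite ltNge => /negP; apply.
  apply: le_trans ps; rewrite (big_rem x)/= ?lerDl ?sumr_ge0//.
  by rewrite in_fset_set// inE.
apply: (le_lt_trans (wmass_le g0 sub)).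
have : wmass g U = (wmass g F + wmass g (U `&` ~` F))%E.
  rewrite {1}/wmass (esumID F); last by move=> x _; rewrite lee_fin.
  by rewrite (_ : U `&` F = F)//; apply/seteqP; split => [x []//|x Fx]; split => //; exact: FU.
have Dfin : wmass g (U `&` ~` F) \is a fin_num.
  rewrite ge0_fin_numE ?wmass_ge0//; apply: le_lt_trans (ltry 1).
  by apply: le_trans U1; apply: wmass_le => // x [].
have Ffin : wmass g F \is a fin_num.
  rewrite ge0_fin_numE ?wmass_ge0//; apply: le_lt_trans (ltry 1).
  by apply: le_trans U1; apply: wmass_le => // x /FU.
have {FS} : wmass g U - a%:E < wmass g F by rewrite -FE; exact: FS.
move: Ufin Dfin Ffin; case: (wmass g U) => // u _.
case: (wmass g (U `&` ~` F)) => // D _; case: (wmass g F) => // f _.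
rewrite -EFinN -!EFinD !lte_fin => h [e]; lra.
Qed.

(** For fixed words in three of the families, the fourth one is spread around
    the value that would make the two ends equal. *)
Lemma windows_and_spread (T : countType) (g : T -> R) (A B C D : set T)
    (ea eb ec ed : T -> R) (ca cb cc m a s : R) :
  (forall x, 0 <= g x)%R -> (0 < s)%R -> (0 <= m)%R -> (0 <= a)%R ->
  m%:E <= wmass g [set x | A x /\ (`|ea x - ca| <= 2 * s)%R] ->
  m%:E <= wmass g [set x | B x /\ (`|eb x - cb| <= 2 * s)%R] ->
  m%:E <= wmass g [set x | C x /\ (`|ec x - cc| <= 2 * s)%R] ->
  (forall c : R, a%:E <= wmass g [set x | D x /\ (s < `|ed x - c|)%R]) ->
  exists z : R, (m ^+ 3 * a / 33)%:E <=
    wmass (fun k : T * T * T * T => g k.1.1.1 * g k.1.1.2 * g k.1.2 * g k.2)%R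
    [set k | [/\ A k.1.1.1, B k.1.1.2, C k.1.2 & D k.2] /\
      between (s / 4) z (ea k.1.1.1 + eb k.1.1.2 + ec k.1.2)%R
                        (ea k.1.1.1 + eb k.1.1.2 + ed k.2)%R].
Proof.
move=> g0 s0 m0 a_ge0 mA mB mC spD.
have mulc (c x : R) (M M' : \bar R) : (0 <= c)%R -> x%:E <= M -> c%:E * M <= M' ->
    (c * x)%:E <= M'.
  by move=> c0 xM; apply: le_trans; rewrite EFinM lee_wpmul2l.
pose Q3 := [set k : T * T * T | [/\ A k.1.1 /\ (`|ea k.1.1 - ca| <= 2 * s)%R,
  B k.1.2 /\ (`|eb k.1.2 - cb| <= 2 * s)%R & C k.2 /\ (`|ec k.2 - cc| <= 2 * s)%R]].
have mQ3 : (m * m * m)%:E <= wmass (fun k : T * T * T => g k.1.1 * g k.1.2 * g k.2)%R Q3.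
  apply: (mulc _ _ _ _ _ mC); first exact: mulr_ge0.
  apply: (@wmass_cofibers (T * T)%type T (fun k => g k.1 * g k.2)%R g) => //.
  - by move=> k; apply: mulr_ge0.
  - by apply: mulr_ge0.
  move=> z Cz; apply: (mulc _ _ _ _ _ mB) => //; apply: (@wmass_cofibers T T g g) => // y By.
  by apply: le_trans mA _; apply: wmass_le => // x Ax; split.
pose Q := [set k : T * T * T * T | Q3 k.1 /\ (D k.2 /\ (s < `|ed k.2 - ec k.1.2|)%R)].
have mQ : (a * (m * m * m))%:E <=
    wmass (fun k : T * T * T * T => g k.1.1.1 * g k.1.1.2 * g k.1.2 * g k.2)%R Q.
  apply: (mulc _ _ _ _ a_ge0 mQ3).
  apply: (@wmass_fibers (T * T * T)%type T (fun k => g k.1.1 * g k.1.2 * g k.2)%R g) => //.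
    by move=> k; rewrite !mulr_ge0.
  by move=> k Q3k; apply: le_trans (spD (ec k.2)) _; exact: wmass_le.
have QP k : Q k ->
    (`|(ea k.1.1.1 + eb k.1.1.2 + ec k.1.2) - (ca + cb + cc)| <= 6 * s)%R /\
    (s < `|(ea k.1.1.1 + eb k.1.1.2 + ed k.2) - (ea k.1.1.1 + eb k.1.1.2 + ec k.1.2)|)%R.
  move=> [[[_ h1] [_ h2] [_ h3]] [_ h4]]; split.
    move: h1 h2 h3; rewrite !ler_norml => /andP[? ?] /andP[? ?] /andP[? ?].
    by apply/andP; split; lra.
  by rewrite opprD addrACA subrr add0r.
have [|z zP] := pigeonhole_between _ s0 QP mQ; first by move=> k; rewrite !mulr_ge0.
exists z; rewrite (_ : m ^+ 3 * a = a * (m * m * m))%R; last by ring.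
apply: le_trans zP _; apply: wmass_le => [k|k [[[[? _] [? _] [? _]] [? _]] bz]].
  by rewrite !mulr_ge0.
by split.
Qed.

(** Let s = N 2 ^ k be the largest scale at which one of the two families is
    still spread. As neither is spread at the scale 2 s, each has a weight at
    least a0 / 2 in some window of radius 2 s, and [windows_and_spread]
    applies with the last word in the family that is spread at the scale s. *)
Lemma between_quadruples (T : countType) (g : T -> R) (U W : set T) (p q : T -> R)
    (a a0 N : R) : (forall x, 0 <= g x)%R -> (0 < N)%R -> (0 < a)%R -> (2 * a <= a0)%R ->
  a0%:E <= wmass g U -> wmass g U <= 1 -> a0%:E <= wmass g W -> wmass g W <= 1 ->
  (forall c : R, a%:E <= wmass g [set x | U x /\ (N < `|p x - c|)%R]) ->
  exists z : R, (a0 ^+ 3 * a / 264)%:E <=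
    wmass (fun k : T * T * T * T => g k.1.1.1 * g k.1.1.2 * g k.1.2 * g k.2)%R
    [set k | [/\ U k.1.1.1, U k.1.1.2, W k.1.2 & W k.2] /\
      between (N / 4) z (p k.1.1.1 + q k.1.2 + p k.1.1.2)%R
                        (p k.1.1.1 + q k.1.2 + q k.2)%R].
Proof.
move=> g0 N0 a_gt0 aa0 U0 U1 W0 W1 spN.
have a0_gt0 : (0 < a0)%R by lra.
pose sp (X : set T) (r : T -> R) (s : R) :=
  forall c : R, a%:E <= wmass g [set x | X x /\ (s < `|r x - c|)%R].
pose sc k := sp U p (N * 2 ^+ k)%R \/ sp W q (N * 2 ^+ k)%R.
have [k0 nk0] : exists k, ~ sc k.
  have [s1 s1P] := wmass_tail p g0 a_gt0 U1.
  have [s2 s2P] := wmass_tail q g0 a_gt0 W1.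
  have [k kP] : exists k : nat, (`|s1| + `|s2| <= N * 2 ^+ k)%R.
    exists (Num.bound ((`|s1| + `|s2|) / N)); rewrite mulrC -ler_pdivrMr//.
    apply: (le_trans (ltW (archi_boundP _))); first by rewrite divr_ge0// ?addr_ge0// ltW.
    by rewrite -natrX ler_nat ltnW// ltn_expl.
  have s1k : (s1 <= N * 2 ^+ k)%R.
    by have := ler_norm s1; have := normr_ge0 s2; lra.
  have s2k : (s2 <= N * 2 ^+ k)%R.
    by have := ler_norm s2; have := normr_ge0 s1; lra.
  exists k => -[/(_ 0%R)|/(_ 0%R)]; apply/negP; rewrite -ltNge.
    by under eq_set do rewrite subr0; exact: s1P.
  by under eq_set do rewrite subr0; exact: s2P.
have [k [sck nsck]] : exists k, sc k /\ ~ sc k.+1.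
  apply: contrapT => /forallNP H; apply: nk0; elim: k0 => [|k IH].
    by left => c; rewrite expr0 mulr1; exact: spN.
  by apply: contrapT => nS; apply: (H k).
pose s := (N * 2 ^+ k)%R.
have s0 : (0 < s)%R by rewrite mulr_gt0// exprn_gt0.
have Ns : (N <= s)%R by rewrite /s ler_peMr ?(ltW N0)// exprn_ege1// ler1n.
have sS : (N * 2 ^+ k.+1 = 2 * s)%R by rewrite exprS /s; lra.
have near (X : set T) r : a0%:E <= wmass g X -> wmass g X <= 1 -> ~ sp X r (2 * s)%R ->
    exists c : R, (a0 / 2)%:E <= wmass g [set x | X x /\ (`|r x - c| <= 2 * s)%R].
  move=> X0 X1 /existsNP[c /negP]; rewrite -ltNge => far; exists c.
  have : wmass g X = wmass g [set x | X x /\ (2 * s < `|r x - c|)%R] +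
      wmass g [set x | X x /\ (`|r x - c| <= 2 * s)%R].
    rewrite {1}/wmass (esumID [set x | (2 * s < `|r x - c|)%R]); last first.
      by move=> x _; rewrite lee_fin.
    congr (_ + wmass _ _); apply/seteqP; split => x [Xx /=].
      by move=> /negP; rewrite -leNgt.
    by move=> h; split => //=; apply/negP; rewrite -leNgt.
  have fin Y : Y `<=` X -> wmass g Y \is a fin_num.
    move=> YX; rewrite ge0_fin_numE ?wmass_ge0//; apply: le_lt_trans (ltry 1).
    by apply: le_trans X1; exact: wmass_le.
  have fX := fin X (@subset_refl _ X).
  set A := wmass g [set x | _ /\ (_ < _)%R] in far *.
  set B := wmass g [set x | _ /\ (_ <= _)%R].
  have fA : A \is a fin_num by apply: fin => x [].
  have fB : B \is a fin_num by apply: fin => x [].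
  move: X0 far; rewrite -(fineK fX) -(fineK fA) -(fineK fB) -EFinD !lee_fin lte_fin.
  move=> ? ? []; lra.
have [cU cUP] : exists c : R, (a0 / 2)%:E <=
    wmass g [set x | U x /\ (`|p x - c| <= 2 * s)%R].
  by apply: near => //; rewrite -sS => S; apply: nsck; left.
have [cW cWP] : exists c : R, (a0 / 2)%:E <=
    wmass g [set x | W x /\ (`|q x - c| <= 2 * s)%R].
  by apply: near => //; rewrite -sS => S; apply: nsck; right.
have h0 : (0 <= a0 / 2)%R by lra.
(* three windows, one spread family, and 33 candidates for z *)
have E264 : (a0 ^+ 3 * a / 264 = (a0 / 2) ^+ 3 * a / 33)%R.
  by rewrite !exprS expr0; lra.
have wide z e e' : between (s / 4) z e e' -> between (N / 4) z e e'.
  by rewrite /between => -[] []; [left|right]; split; lra.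
rewrite E264; case: sck => spr.
- have [z zP] := windows_and_spread g0 s0 h0 (ltW a_gt0) cUP cWP cWP spr.
  exists z; apply: le_trans zP _.
  apply: (@esum_le_inj _ _ _ _ _ _ _ (fun k => (k.1.1.1, k.2, k.1.1.2, k.1.2))).
  + by move=> ?; rewrite lee_fin !mulr_ge0.
  + by move=> ?; rewrite lee_fin !mulr_ge0.
  + by move=> ? [[? ? ? ?] bz]; split => //; apply: wide; case: bz; [right|left].
  + by move=> [[[? ?] ?] ?] [[[? ?] ?] ?] _ _ /= [-> -> -> ->].
  + by move=> ? _; rewrite lee_fin le_eqVlt; apply/orP/or_introl/eqP => /=; ring.
- have [z zP] := windows_and_spread g0 s0 h0 (ltW a_gt0) cUP cWP cUP spr.
  exists z; apply: le_trans zP _.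
  apply: (@esum_le_inj _ _ _ _ _ _ _ (fun k => (k.1.1.1, k.1.2, k.1.1.2, k.2))).
  + by move=> ?; rewrite lee_fin !mulr_ge0.
  + by move=> ?; rewrite lee_fin !mulr_ge0.
  + by move=> ? [[? ? ? ?] bz]; split => //; exact: wide.
  + by move=> [[[? ?] ?] ?] [[[? ?] ?] ?] _ _ /= [-> -> -> ->].
  + by move=> ? _; rewrite lee_fin le_eqVlt; apply/orP/or_introl/eqP => /=; ring.
Qed.

End weighted_counting.

(** * Two walks in one environment *)

Section two_walks.
Context {d : nat} {R : realType}.
Local Notation V := (site d).
Local Notation E := (borel (environment d R)).
Implicit Types (w : environment d R) (s t : seq V) (x y u v : V).
Context (P : probability E R) (P_iid : iid P (@local_env d R)).
Variable f : V -> R.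
Hypothesis fD : forall x y, f (x + y) = f x + f y.
Local Notation g := (fun x => - f x).

Let gD x y : g (x + y) = g x + g y.
Proof. by rewrite /= fD opprD. Qed.

Definition reached (h : V -> R) (n : R) s : Prop :=
  exists2 k, (k <= size s)%N & up_words h n (take k s).

Lemma cyl_reached h n s : reached h n s -> cyl s `<=` starts (up_words h n).
Proof. by move=> [k ks uk] Z sZ; exists (take k s) => //; exact: cyl_take. Qed.

(** By the Markov property the left-hand side is the probability of a
    disjoint union of parts of C. *)
Lemma quenched_stop w x (I : countType) (W : set I) (F : I -> seq V)
    (B C : set (path_space d)) : measurable B -> measurable C ->
  trivIset W (fun i => cyl (F i)) ->
  (forall i, W i -> cyl (F i) `&` shiftp (size (F i)) @^-1` B `<=` C) ->
  (\esum_(i in W) ((path_prob w x (F i))%:E * quenched_inc w (x + wsum (F i))%R B) <= quenched_inc w x C)%E.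
Proof.
move=> mB mC tF FC.
rewrite (_ : \esum_(i in W) _ =
    quenched_inc w x (\bigcup_(i in W) (cyl (F i) `&` shiftp (size (F i)) @^-1` B))).
  apply: le_measure; rewrite ?inE//.
    by apply: measurable_countable_bigcup => i; exact: measurable_cyl_shift.
  by move=> Z [i Wi iZ]; exact: FC iZ.
rewrite measure_bigcup_esum => [|i j Wi Wj [Z [[iZ _] [jZ _]]]|i]; last 2 first.
- by apply: tF => //; exists Z.
- exact: measurable_cyl_shift.
by apply: eq_esum => i _; apply/esym/quenched_inc_markov.
Qed.

Lemma measurable_not_transient (h : V -> R) : measurable (~` transient h : set (path_space d)).
Proof. by apply: measurableC; exact: measurable_transient. Qed.

Lemma measurable_reached_not (h : V -> R) n :
  measurable (starts (up_words h n) `\` transient h : set (path_space d)).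
Proof. by apply: measurableD; [exact: measurable_starts|exact: measurable_transient]. Qed.

(** Stop the walk at the first site, after a climb to n, from which it is
    transient with probability less than 1/2; then it fails to be transient
    with conditional probability at least 1/2. *)
Lemma quenched_bad_sites w n (W : set (seq V)) : prefix_free W ->
  (forall s, W s -> exists2 k, (k <= size s)%N & reached f n (take k s) /\
     (quenched_inc w (wsum (take k s)) (transient f) < (2^-1)%:E)%E) ->
  (\esum_(s in W) (path_prob w 0%R s)%:E <=
   2%:E * quenched_inc w 0%R (starts (up_words f n) `\` transient f))%E.
Proof.
move=> pfW Wbad.
pose Bad := [set s | reached f n s /\ (quenched_inc w (wsum s) (transient f) < (2^-1)%:E)%E].
pose T := first_in Bad.
have pT : prefix_free T by exact: first_in_prefix_free.
have pw0 s : (0 <= (path_prob w 0%R s)%:E)%E by rewrite lee_fin path_prob_ge0.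
have sumE D : prefix_free D -> \esum_(s in D) (path_prob w 0%R s)%:E = quenched_inc w 0%R (starts D).
  move=> pD; rewrite measure_starts//; apply: eq_esum => s _.
  by rewrite quenched_inc_cyl.
rewrite sumE//; apply: (@le_trans _ _ (quenched_inc w 0%R (starts T))).
  apply: le_measure; rewrite ?inE; [exact: measurable_starts..|].
  rewrite starts_first_in => Z [s Ws sZ].
  have [k ks [rk bk]] := Wbad s Ws; exists (take k s) => //.
  exact: cyl_take.
rewrite -sumE//.
have C0 : (0 <= quenched_inc w 0%R (starts (up_words f n) `\` transient f))%E by exact: measure_ge0.
apply: (@le_trans _ _ (\esum_(s in T) (2%:E * ((path_prob w 0%R s)%:E *
    quenched_inc w (0 + wsum s)%R (~` transient f))))%E).
  apply: le_esum => s [[_ bad] _]; rewrite add0r.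
  rewrite muleCA -[leLHS]mule1; apply: lee_wpmul2l => //.
  rewrite probability_setC; last exact: measurable_transient.
  have : quenched_inc w (wsum s) (transient f) \is a fin_num.
    by apply: fin_num_measure; exact: measurable_transient.
  move: bad; case: (quenched_inc w (wsum s) (transient f)) => // r.
  by rewrite lte_fin -EFinB -EFinM lee_fin => ? _; lra.
rewrite esumZl// => [|s]; last by rewrite mule_ge0// measure_ge0.
apply: lee_wpmul2l => //; apply: quenched_stop.
- exact: measurable_not_transient.
- exact: measurable_reached_not.
- exact: prefix_free_trivIset.
- move=> s [[rs _] _] Z [sZ nZ]; split; first exact: cyl_reached rs Z sZ.
  by move=> tZ; apply: nZ; apply/(transient_shift fD).
Qed.

(* When the first walk follows s, the second one follows F s t, which
   prolongs a stopping word t up to a site of s. *)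
Variables (n : R) (y : V) (WX : set (seq V)) (WY : seq V -> set (seq V))
  (F : seq V -> seq V -> seq V).
Hypothesis pfX : prefix_free WX.
Hypothesis trY : forall s, WX s -> trivIset (WY s) (fun t => cyl (F s t)).
Hypothesis reachY : forall s t, WX s -> WY s t -> reached g n (F s t).
Hypothesis meet : forall s t, WX s -> WY s t -> exists2 k, (k <= size s)%N &
  reached f n (take k s) /\ y + wsum (F s t) = wsum (take k s).

(** Let e be the site where the second walk hits the first one, and r the
    probability that the walk from e is transient. If r < 1/2, the first walk
    has visited a bad site and [quenched_bad_sites] applies. If r >= 1/2, the
    second walk, which has descended by n, has from e a probability at least
    1/2 not to be transient downwards. *)
Lemma quenched_two_walks w :
  (\esum_(s in WX) \esum_(t in WY s) ((path_prob w 0%R s)%:E * (path_prob w y (F s t))%:E) <=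
   2%:E * quenched_inc w 0%R (starts (up_words f n) `\` transient f) +
   2%:E * quenched_inc w y (starts (up_words g n) `\` transient g))%E.
Proof.
pose r s t := quenched_inc w (y + wsum (F s t)) (transient f).
pose bad s := [set t | WY s t /\ (r s t < (2^-1)%:E)%E].
pose Xbad := [set s | WX s /\ bad s !=set0].
have p0 x s : (0 <= (path_prob w x s)%:E)%E by rewrite lee_fin path_prob_ge0.
have r0 s t : (0 <= r s t)%E by exact: measure_ge0.
have mI := @measurable_transient d R f.
have step1 s : WX s ->
  (\esum_(t in WY s) ((path_prob w 0%R s)%:E * (path_prob w y (F s t))%:E) <=
   (if s \in Xbad then (path_prob w 0%R s)%:E else 0) +
   2%:E * ((path_prob w 0%R s)%:E * quenched_inc w y (starts (up_words g n) `\` transient g)))%E.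
  move=> Ws.
  have H1 : (\esum_(t in bad s) (path_prob w y (F s t))%:E <= 1)%E.
    have tb : trivIset (bad s) (fun t => cyl (F s t)).
      by move=> i j [Wi _] [Wj _]; exact: trY Ws _ _ Wi Wj.
    rewrite (_ : \esum_(t in bad s) _ = quenched_inc w y (\bigcup_(t in bad s) cyl (F s t))).
      apply: probability_le1; apply: measurable_countable_bigcup => i.
      exact: measurable_cyl.
    rewrite measure_bigcup_esum// => [|t]; last exact: measurable_cyl.
    by apply: eq_esum => t _; apply/esym/quenched_inc_cyl.
  have H2 : (\esum_(t in WY s) ((path_prob w y (F s t))%:E * r s t) <=
      quenched_inc w y (starts (up_words g n) `\` transient g))%E.
    apply: quenched_stop => //.
    - exact: measurable_reached_not.
    - exact: trY.
    - move=> t Wt Z [tZ trZ]; split; first exact: cyl_reached (reachY Ws Wt) Z tZ.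
      have fZ : transient f Z := (transient_shift fD _ Z).1 trZ.
      exact: transient_opp_disjoint.
  rewrite esumZl ?path_prob_ge0//.
  rewrite muleCA [X in (_ <= X + _)%E](_ : _ =
     (path_prob w 0%R s)%:E * (if s \in Xbad then 1 else 0))%E; last first.
    by case: ifP; rewrite ?mule1 ?mule0.
  rewrite -ge0_muleDr//; last 2 first.
  - by case: ifP.
  - by rewrite mule_ge0// measure_ge0.
  apply: lee_wpmul2l => //.
  apply: (@le_trans _ _ (\esum_(t in WY s) ((if t \in bad s then (path_prob w y (F s t))%:E else 0) +
      2%:E * ((path_prob w y (F s t))%:E * r s t)))%E).
    apply: le_esum => t Wt; case: ifPn => [_|/negP tb].
      by rewrite leeDl// !mule_ge0.
    rewrite add0e muleCA -[leLHS]mule1; apply: lee_wpmul2l => //.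
    have : ~ (r s t < (2^-1)%:E)%E by move=> rt; apply: tb; rewrite inE.
    move=> /negP; rewrite -leNgt => rt.
    apply: le_trans (lee_wpmul2l _ rt) => //.
    by rewrite -EFinM lee_fin mulfV.
  rewrite esumD; last 2 first.
  - by move=> t _; case: ifP.
  - by move=> t _; rewrite !mule_ge0.
  apply: leeD.
    rewrite -esum_mkcondr (_ : WY s `&` bad s = bad s); last first.
      by apply/seteqP; split => [t []//|t [? ?]].
    case: ifPn => [//|/negP nb].
    rewrite (_ : bad s = set0) ?esum_set0//.
    by apply/seteqP; split => // t bt; apply: nb; rewrite inE; split => //; exists t.
  rewrite esumZl// => [|t]; last by rewrite mule_ge0.
  exact: lee_wpmul2l.
apply: (@le_trans _ _ (\esum_(s in WX) ((if s \in Xbad then (path_prob w 0%R s)%:E else 0) +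
   2%:E * ((path_prob w 0%R s)%:E * quenched_inc w y (starts (up_words g n) `\` transient g))))%E).
  exact: le_esum.
have C0 : (0 <= quenched_inc w y (starts (up_words g n) `\` transient g))%E by exact: measure_ge0.
rewrite esumD; last 2 first.
- by move=> s _; case: ifP.
- by move=> s _; rewrite !mule_ge0.
apply: leeD.
  rewrite -esum_mkcondr (_ : WX `&` Xbad = Xbad); last first.
    by apply/seteqP; split => [s []//|s [? ?]].
  apply: quenched_bad_sites; first by move=> s t [Ws _] [Wt _]; exact: pfX.
  move=> s [Ws [t [Wt rt]]]; have [k ks [rk e]] := meet Ws Wt.
  by exists k => //; split => //; rewrite -e.
rewrite esumZl// => [|s]; last by rewrite mule_ge0.
apply: lee_wpmul2l => //.
pose c := fine (quenched_inc w y (starts (up_words g n) `\` transient g)).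
have cE : quenched_inc w y (starts (up_words g n) `\` transient g) = c%:E.
  by rewrite fineK//; apply: fin_num_measure; exact: measurable_reached_not.
rewrite (_ : \esum_(s in WX) _ = (c%:E * \esum_(s in WX) (path_prob w 0%R s)%:E)%E); last first.
  rewrite -esumZl//; last exact: fine_ge0.
  by apply: eq_esum => s _; rewrite muleC cE.
rewrite cE in C0 *.
rewrite -[leRHS]mule1; apply: lee_wpmul2l => //.
rewrite (_ : \esum_(s in WX) _ = quenched_inc w 0%R (starts WX)).
  by apply: probability_le1; exact: measurable_starts.
by rewrite measure_starts//; apply: eq_esum => s _; apply/esym/quenched_inc_cyl.
Qed.

Lemma two_walks_bound :
  (\esum_(s in WX) \esum_(t in WY s)
     \int[P]_w (path_prob w 0%R s * path_prob w y (F s t))%:E <=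
   2%:E * annealed_inc P 0%R (starts (up_words f n) `\` transient f) +
   2%:E * annealed_inc P 0%R (starts (up_words g n) `\` transient g))%E.
Proof.
have mpp s t : measurable_fun setT (fun w : E =>
    ((path_prob w 0%R s)%:E * (path_prob w y (F s t))%:E)%E).
  by apply: emeasurable_funM; exact: measurable_path_probE.
have pp0 s t w : (0 <= (path_prob w 0%R s)%:E * (path_prob w y (F s t))%:E)%E.
  by rewrite mule_ge0// lee_fin path_prob_ge0.
have -> : \esum_(s in WX) \esum_(t in WY s)
     (\int[P]_w (path_prob w 0%R s * path_prob w y (F s t))%:E)%E =
    (\int[P]_w (\esum_(s in WX) \esum_(t in WY s)
      ((path_prob w 0%R s)%:E * (path_prob w y (F s t))%:E)))%E.
  rewrite ge0_integral_esum.
  - apply: eq_esum => s _; rewrite ge0_integral_esum.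
    + by apply: eq_esum => t _; apply: eq_integral => w _; rewrite EFinM.
    + by move=> t w; exact: pp0.
    + by move=> t; exact: mpp.
  - by move=> s w; apply: esum_ge0.
  - by move=> s; apply: measurable_esum.
rewrite -(annealed_inc_shift P_iid y (measurable_reached_not g n)).
have mA := measurable_quenched_inc 0 (measurable_reached_not f n).
have mB := measurable_quenched_inc y (measurable_reached_not g n).
rewrite /annealed_inc -!ge0_integralZl//.
rewrite -ge0_integralD//; last 4 first.
- by move=> w _; rewrite mule_ge0// measure_ge0.
- exact: measurable_funeM.
- by move=> w _; rewrite mule_ge0// measure_ge0.
- exact: measurable_funeM.
apply: ge0_le_integral => //.
- by move=> w _; apply: esum_ge0 => s _; apply: esum_ge0 => t _.
- apply: measurable_esum => [s w|s]; first exact: esum_ge0.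
  exact: measurable_esum.
- by apply: emeasurable_funD; exact: measurable_funeM.
- by move=> w _; exact: quenched_two_walks.
Qed.

End two_walks.

(** * Short connections *)

Section neighbourhoods.
Context {d : nat} {R : realType}.
Local Notation V := (site d).
Local Notation E := (borel (environment d R)).
Implicit Types (s t : seq V) (x y z u v : V).
Context (P : probability E R) (P_iid : iid P (@local_env d R)).
Hypothesis P_sink : {ae P, forall w : environment d R, exists c, forall x, reachable w x c}.
Local Notation weight := (weight P).
Local Notation allowed := (all (fun v => 0 < weight [:: v])).

Lemma departures_map x s : departures x s = [seq x + y | y <- departures 0 s].
Proof.
elim: s x => //= v s IH x; rewrite addr0 add0r IH (IH v) -map_comp.
by congr (_ :: _); apply: eq_map => y /=; rewrite addrA.
Qed.

Lemma uniq_departures x s : uniq (departures x s) = uniq (departures 0 s).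
Proof. by rewrite departures_map map_inj_uniq// => y z /addrI. Qed.

Lemma common_lower_bound (l : seq V) (Q : V -> seq V -> Prop) :
  (forall b, b \in l -> exists2 s, 0 < weight s & Q b s) ->
  exists2 p : R, 0 < p & forall b, b \in l -> exists2 s, p <= weight s & Q b s.
Proof.
elim: l => [|b l IH] H; first by exists 1.
have [|p p0 pP] := IH; first by move=> c cl; apply: H; rewrite inE cl orbT.
have [s s0 sQ] := H b (mem_head _ _).
exists (Num.min p (weight s)); first by rewrite lt_min p0.
move=> c; rewrite inE => /orP[/eqP ->|/pP[t pt tQ]].
  by exists s => //; rewrite ge_min lexx orbT.
by exists t => //; rewrite ge_min pt.
Qed.

(** Adding to B the sites visited by a chosen path from each site of B to the
    origin makes it possible to walk to the origin without leaving the set. *)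
Lemma neighbourhood (B : seq V) : exists nb : seq V, exists2 p : R, 0 < p &
  [/\ {subset B <= nb}, 0 \in nb & forall b, b \in nb -> exists2 s, p <= weight s &
      wsum s = - b /\ {subset departures b s <= nb}].
Proof.
have /choice[r rP] b : exists s, allowed s /\ wsum s = - b.
  by have [s sa sb] := steps_span P_iid P_sink (- b); exists s.
pose nb := 0 :: flatten [seq b :: departures b (r b) | b <- B].
have nbP c : c \in nb -> exists2 s, allowed s & wsum s = - c /\ {subset departures c s <= nb}.
  rewrite inE => /orP[/eqP ->|/flattenP[_ /mapP[b bB ->]] cb].
    by exists [::] => //; split => //; rewrite wsum_nil oppr0.
  have [ra rb] := rP b.
  have sub : {subset departures b (r b) <= nb}.
    move=> y yd; rewrite inE; apply/orP; right; apply/flattenP.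
    by exists (b :: departures b (r b)); [exact: map_f|rewrite inE yd orbT].
  move: cb; rewrite inE => /orP[/eqP ->|/departuresP[k kr ->]]; first by exists (r b).
  exists (drop k (r b)).
    by apply/allP => v /mem_drop; move: v; apply/allP.
  have cat_r : r b = take k (r b) ++ drop k (r b) by rewrite cat_take_drop.
  split; last first.
    by move=> y yd; apply: sub; rewrite cat_r departures_cat mem_cat yd orbT.
  by apply: (addrI (wsum (take k (r b)))); rewrite -wsum_cat -cat_r rb opprD addrCA subrr addr0.
have [|p p0 pP] := @common_lower_bound nb
    (fun b s => wsum s = - b /\ {subset departures b s <= nb}).
  move=> b /nbP[s sa [sb sd]]; have [s' [s'a us' s'E s'd _]] := simple_word b sa.
  exists s'; first by apply: (weight_simple P_iid s'a); rewrite -(uniq_departures b).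
  by split; [rewrite s'E|move=> y /s'd/sd].
exists nb, p => //; split => //; last by rewrite inE eqxx.
move=> b bB; rewrite inE; apply/orP; right; apply/flattenP.
by exists (b :: departures b (r b)); [exact: map_f|rewrite mem_head].
Qed.

(** Follow inside x + nb the word that leads to x, up to the first visit to
    S. The departures are then outside S, in a part of the environment which
    a walk with sites in S has not used. *)
Lemma walk_to (nb : seq V) (p : R) :
  (forall b, b \in nb -> exists2 s, p <= weight s &
      wsum s = - b /\ {subset departures b s <= nb}) -> 0 \in nb ->
  forall (S : V -> Prop) x z, S x -> z - x \in nb -> exists s,
    [/\ p <= weight s, S (z + wsum s), (z + wsum s) - x \in nb &
        forall y, y \in departures z s -> ~ S y /\ y - x \in nb].
Proof.
move=> nbP nb0 S x z Sx zx; have [s ps [sE sd]] := nbP _ zx.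
have zs : z + wsum s = x by rewrite sE opprB addrC subrK.
have ex : exists k, `[< (k <= size s)%N /\ S (z + wsum (take k s)) >].
  by exists (size s); apply/asboolP; rewrite take_size zs.
have [k /asboolP[ks Sk] kmin] := ex_minnP ex.
have sd' y : y \in departures z s -> y - x \in nb.
  move=> yd; apply: sd; rewrite departures_shift; rewrite departures_shift in yd.
  by rewrite opprB addrA subrK.
exists (take k s); split => //.
- by apply: le_trans ps _; rewrite -[in X in weight X <= _](cat_take_drop k s); exact: (weight_cat_le P_iid).
- move: ks; rewrite leq_eqVlt => /orP[/eqP ->|ks].
    by rewrite take_size zs subrr.
  by apply: sd'; apply/departuresP; exists k.
move=> y /departuresP[j]; rewrite size_takel// => jk ->; rewrite take_takel ?(ltnW jk)//.
split; last by apply: sd'; apply/departuresP; exists j => //; exact: leq_trans ks.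
move=> Sj; have : (k <= j)%N.
  by apply: kmin; apply/asboolP; split => //; exact: leq_trans (ltnW jk) ks.
by rewrite leqNgt jk.
Qed.

End neighbourhoods.

(** * Two opposite climbs come close to each other *)

Section meeting_geometry.
Context {d : nat} {R : realType}.
Local Notation V := (site d).
Implicit Types (s u : seq V) (x y v : V).

Definition bounded_steps (f t : V -> R) (r : R) s : Prop :=
  forall v, v \in s -> `|f v| <= r /\ `|t v| <= r.

Lemma additiveB (h : V -> R) : (forall x y, h (x + y) = h x + h y) ->
  forall x y, h (x - y) = h x - h y.
Proof. by move=> hD x y; apply: (addIr (h y)); rewrite -hD !subrK. Qed.

Lemma take_size_add s u i : take (size s + i) (s ++ u) = s ++ take i u.
Proof. by rewrite take_cat ltnNge leq_addr /= addKn. Qed.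

Section one_direction.
Variable f : V -> R.
Hypothesis fD : forall x y, f (x + y) = f x + f y.

Lemma up_words_overshoot L r s : 0 < L -> (forall v, v \in s -> `|f v| <= r) ->
  up_words f L s -> f (wsum s) <= L + r.
Proof.
move=> L0 sr [_ sL Ls].
case/lastP: s => [|s v] in sr sL Ls *.
  by move: Ls; rewrite wsum_nil (additive0 fD) leNgt L0.
have := sL (size s); rewrite size_rcons leqnn -cats1 take_size_cat// => /(_ isT) h.
rewrite wsum_cat fD wsum_cons wsum_nil addr0; apply: lerD; first exact: ltW.
by apply: (le_trans (ler_norm _)); apply: sr; rewrite mem_rcons mem_head.
Qed.

Lemma wsum_take_runway u v k i : (size u <= i <= size u + k)%N ->
  wsum (take i (u ++ nseq k v)) = wsum u + v *+ (i - size u).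
Proof.
move=> /andP[ui ik]; rewrite take_cat ltnNge ui /= wsum_cat; congr (_ + _).
by rewrite take_nseq ?leq_subLR// nseq_wsum.
Qed.

(** A climb of height L is followed by a word of known steps, so that a level
    slightly above L is first passed during this word, at a bounded lateral
    distance from the end of the climb. *)
Lemma runway L c u v k : 0 <= L -> up_words f L u -> 0 < f v ->
  L <= c -> c <= L + f v *+ k -> exists I j,
  [/\ (I <= size u + k)%N /\ (j <= k)%N,
      c <= f (wsum (take I (u ++ nseq k v))),
      forall i, (i < I)%N -> f (wsum (take i (u ++ nseq k v))) < c &
      wsum (take I (u ++ nseq k v)) = wsum u + v *+ j].
Proof.
move=> L0 [u0 uL Lu] fv Lc cL.
have ex : exists i, c <= f (wsum (take i (u ++ nseq k v))).
  exists (size u + k)%N; rewrite wsum_take_runway ?leq_addr ?leqnn//.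
  by rewrite addKn fD additive_mulrn//; apply: le_trans cL _; rewrite lerD2r.
have [I Ic Imin] := ex_minnP ex.
have Iu : (I <= size u + k)%N.
  apply: Imin; rewrite wsum_take_runway ?leq_addr ?leqnn//.
  by rewrite addKn fD additive_mulrn//; apply: le_trans cL _; rewrite lerD2r.
have uI : (size u <= I)%N.
  rewrite leqNgt; apply/negP => Iu'.
  have := uL _ Iu'; move: Ic; rewrite take_cat Iu' => Ic.
  by rewrite ltNge (le_trans Lc Ic).
exists I, (I - size u)%N; split => //.
- by rewrite leq_subLR.
- by move=> i iI; rewrite ltNge; apply/negP => /Imin; rewrite leqNgt iI.
- by rewrite wsum_take_runway// uI.
Qed.

Lemma runway_upward L u v k : 0 <= L -> up_words f L u -> 0 < f v ->
  upward f (u ++ nseq k v).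
Proof.
move=> L0 Lu fv; apply: (upward_cat fD); first exact: up_words_upward Lu.
exact: upward_nseq.
Qed.

Lemma upward_take s i : upward f s -> 0 <= f (wsum (take i s)) <= f (wsum s).
Proof.
move=> [s0 sP]; have [si|i_s] := leqP (size s) i; first by rewrite take_oversize// s0 lexx.
have id : wsum (take i s) \in departures 0 s by apply/departuresP; exists i => //; rewrite add0r.
by have /andP[-> /ltW ->] := sP _ id.
Qed.

End one_direction.

Variables (f t : V -> R).
Hypothesis fD : forall x y, f (x + y) = f x + f y.
Hypothesis tD : forall x y, t (x + y) = t x + t y.
Local Notation g := (fun x => - f x).
Variables (r : R) (v v' : V) (k k' : nat).
Hypotheses (r0 : 0 <= r) (fv : 0 < f v) (fv' : 0 < - f v').
Hypotheses (vr : bounded_steps f t r [:: v]) (vr' : bounded_steps f t r [:: v']).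
Hypotheses (kr : 4 * r <= f v *+ k) (kr' : 4 * r <= (- f v') *+ k').

Let gD x y : g (x + y) = g x + g y.
Proof. by rewrite /= fD opprD. Qed.

Lemma bounded_steps_cat s s' : bounded_steps f t r s -> bounded_steps f t r s' ->
  bounded_steps f t r (s ++ s').
Proof. by move=> h h' x; rewrite mem_cat => /orP[/h|/h']. Qed.

Lemma bounded_steps_nseq n x : bounded_steps f t r [:: x] ->
  bounded_steps f t r (nseq n x).
Proof. by move=> h y; rewrite mem_nseq => /andP[_ /eqP ->]; apply: h; rewrite inE. Qed.

(** The walks are considered from the end of their first climbs until they
    have gained the height c that separates these two ends. Meanwhile each
    one overtakes the other in height, and the condition between means that
    they exchange their lateral sides: [grid_paths_meet] applies to them or
    to their mirror images. *)
Lemma quadruple_meet (L z N : R) y (u1 u2 v3 v2 : seq V) :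
  0 < L -> 3 * L + 2 * r <= f y <= 3 * L + 4 * r -> `|t y - z| <= r ->
  r * (1 + (k + k')%:R) < N / 4 ->
  up_words f L u1 -> up_words f L u2 -> up_words g L v3 -> up_words g L v2 ->
  bounded_steps f t r u1 -> bounded_steps f t r u2 ->
  bounded_steps f t r v3 -> bounded_steps f t r v2 ->
  between (N / 4) z (t (wsum u1) - t (wsum v3) + t (wsum u2))
                    (t (wsum u1) - t (wsum v3) - t (wsum v2)) ->
  let X i := wsum (take i (u1 ++ (u2 ++ nseq k v))) in
  let Y j := y + wsum (take j (v3 ++ (v2 ++ nseq k' v'))) in
  exists i j, [/\ (i <= size u1 + (size u2 + k))%N, (j <= size v3 + (size v2 + k'))%N,
     `|f (Y j - X i)| <= 4 * r & `|t (Y j - X i)| <= 4 * r].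
Proof.
move=> L0 /andP[y1 y2] tyz rN U1 U2 V3 V2 bu1 bu2 bv3 bv2 bet X Y.
have L0' := ltW L0.
pose sx := u2 ++ nseq k v; pose sy := v2 ++ nseq k' v'.
have [uL uH] : L <= f (wsum u1) /\ f (wsum u1) <= L + r.
  split; first by case: U1.
  by apply: (up_words_overshoot fD L0 _ U1) => x /bu1[].
have [vL vH] : L <= - f (wsum v3) /\ - f (wsum v3) <= L + r.
  split; first by case: V3.
  by apply: (up_words_overshoot gD L0 _ V3) => x /bv3[]; rewrite normrN.
(* the difference of height between the ends of the two first climbs *)
pose c := f y + f (wsum v3) - f (wsum u1).
have Lc : L <= c by rewrite /c; lra.
have cL : c <= L + 4 * r by rewrite /c; lra.
have [I [jx [[Ik jk] Ic Imin IE]]] : exists I j,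
  [/\ (I <= size u2 + k)%N /\ (j <= k)%N, c <= f (wsum (take I sx)),
      forall i, (i < I)%N -> f (wsum (take i sx)) < c &
      wsum (take I sx) = wsum u2 + v *+ j].
  by apply: (runway fD L0' U2 fv Lc); apply: le_trans cL _; rewrite lerD2l.
have [J [jy [[Jk jk'] Jc Jmin JE]]] : exists I j,
  [/\ (I <= size v2 + k')%N /\ (j <= k')%N, c <= - f (wsum (take I sy)),
      forall i, (i < I)%N -> - f (wsum (take i sy)) < c &
      wsum (take I sy) = wsum v2 + v' *+ j].
  by apply: (runway gD L0' V2 fv' Lc); apply: le_trans cL _; rewrite lerD2l.
have ux i : 0 <= f (wsum (take i sx)).
  by have /andP[] := upward_take i (runway_upward fD k L0' U2 fv).
have uy i : 0 <= - f (wsum (take i sy)).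
  by have /andP[] := upward_take i (runway_upward gD k' L0' V2 fv').
have sizex : size sx = (size u2 + k)%N by rewrite size_cat size_nseq.
have sizey : size sy = (size v2 + k')%N by rewrite size_cat size_nseq.
have bx : bounded_steps f t r sx.
  by apply: bounded_steps_cat => //; exact: bounded_steps_nseq.
have by_ : bounded_steps f t r sy.
  by apply: bounded_steps_cat => //; exact: bounded_steps_nseq.
pose hx i := f (wsum u1) + f (wsum (take i sx)).
pose tx i := t (wsum u1) + t (wsum (take i sx)).
pose hy j := f y + f (wsum v3) + f (wsum (take j sy)).
pose ty j := t y + t (wsum v3) + t (wsum (take j sy)).
have stepx i : (i < I)%N -> `|tx i.+1 - tx i| <= r /\ `|hx i.+1 - hx i| <= r.
  move=> iI; have ix : (i < size sx)%N by rewrite sizex (leq_trans iI).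
  have [h1 h2] := bx _ (mem_nth 0 ix).
  rewrite /tx /hx !(wsum_take_nth ix) fD tD.
  by split; [move: h2|move: h1]; congr (`|_| <= r); ring.
have stepy i : (i < J)%N -> `|ty i.+1 - ty i| <= r /\ `|hy i.+1 - hy i| <= r.
  move=> iJ; have iy : (i < size sy)%N by rewrite sizey (leq_trans iJ).
  have [h1 h2] := by_ _ (mem_nth 0 iy).
  rewrite /ty /hy !(wsum_take_nth iy) fD tD.
  by split; [move: h2|move: h1]; congr (`|_| <= r); ring.
have ca i : (i < I)%N -> hx i < hy 0%N.
  by move=> /Imin; rewrite /hx /hy take0 wsum_nil (additive0 fD) /c; lra.
have cb j : (j <= J)%N -> hy j <= hx I.
  by move=> _; have := uy j; move: Ic; rewrite /hx /hy /c; lra.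
have cc i : (i <= I)%N -> hy J <= hx i.
  by move=> _; have := ux i; move: Jc; rewrite /hx /hy /c; lra.
have cd j : (j < J)%N -> hx 0%N < hy j.
  by move=> /Jmin; rewrite /hx /hy take0 wsum_nil (additive0 fD) /c; lra.
suff [i [j [iI jJ tij hij]]] : exists i j, [/\ (i <= I)%N, (j <= J)%N,
    `|ty j - tx i| <= 4 * r & `|hy j - hx i| <= 4 * r].
  exists (size u1 + i)%N, (size v3 + j)%N; split.
  - by rewrite leq_add2l (leq_trans iI).
  - by rewrite leq_add2l (leq_trans jJ).
  - rewrite /X /Y !take_size_add !wsum_cat.
    rewrite (additiveB fD) !fD; apply: le_trans hij.
    rewrite le_eqVlt; apply/orP; left; apply/eqP; congr (`|_|).
    by rewrite /hy /hx /sx /sy; ring.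
  - rewrite /X /Y !take_size_add !wsum_cat.
    rewrite (additiveB tD) !tD; apply: le_trans tij.
    rewrite le_eqVlt; apply/orP; left; apply/eqP; congr (`|_|).
    by rewrite /ty /tx /sx /sy; ring.
have slide (x : V) n m : bounded_steps f t r [:: x] -> (m <= n)%N ->
    `|t x *+ m| <= r * n%:R.
  move=> /(_ x (mem_head _ _))[_ tx1] mn.
  rewrite normrMn -[leLHS]mulr_natr; apply: ler_pM => //.
  by rewrite ler_nat.
have sx1 := slide v k jx vr jk; have sy1 := slide v' k' jy vr' jk'.
have rE : r * (1 + (k + k')%:R) = r + r * k%:R + r * k'%:R by rewrite natrD; ring.
have rk : 0 <= r * k%:R by rewrite mulr_ge0.
have rk' : 0 <= r * k'%:R by rewrite mulr_ge0.
have tX : tx I = t (wsum u1) + t (wsum u2) + t v *+ jx.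
  by rewrite /tx IE tD (additive_mulrn tD) addrA.
have tY : ty J = t y + t (wsum v3) + t (wsum v2) + t v' *+ jy.
  by rewrite /ty JE tD (additive_mulrn tD) addrA.
have tX0 : tx 0%N = t (wsum u1) by rewrite /tx take0 wsum_nil (additive0 tD) addr0.
have tY0 : ty 0%N = t y + t (wsum v3) by rewrite /ty take0 wsum_nil (additive0 tD) addr0.
move: sx1 sy1 tyz; rewrite !ler_norml => /andP[? ?] /andP[? ?] /andP[? ?].
case: bet => -[b1 b2].
  apply: (grid_paths_meet r0 stepx stepy ca cb cc cd).
    by rewrite tX tY0; lra.
  by rewrite tY tX0; lra.
have [||||i [j [iI jJ tij hij]]] := @grid_paths_meet R (fun i => - tx i) hx
    (fun i => - ty i) hy I J r r0 _ _ ca cb cc cd.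
- by move=> i /stepx[h1 h2]; split => //; rewrite -opprD normrN.
- by move=> i /stepy[h1 h2]; split => //; rewrite -opprD normrN.
- by rewrite tX tY0; lra.
- by rewrite tY tX0; lra.
exists i, j; split => //; move: tij; congr (_ <= _); rewrite -normrN; congr `|_|; ring.
Qed.

End meeting_geometry.

(** * The probability of a meeting *)

Section block_words.
Context {d : nat}.
Local Notation V := (site d).
Implicit Types (s u : seq V) (W : set (seq V)).

Definition path_of s : path_space d := fun k => nth 0 s k.

Lemma cyl_path_of s : cyl s (path_of s). Proof. by []. Qed.

Lemma trivIset_prefix_free W : trivIset W (@cyl d) -> prefix_free W.
Proof.
move=> tW s u Ws Wu su sE; apply: tW => //; exists (path_of u); split => //.
by rewrite sE; apply: cyl_take; exact: cyl_path_of.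
Qed.

(** The words that a walk follows: two climbs from W, then a runway c. *)
Definition blocks W c : set (seq V) :=
  [set s | exists u1 u2, [/\ W u1, W u2 & s = u1 ++ (u2 ++ c)]].

Lemma blocks_trivIset W c u1 u2 u1' u2' Z : prefix_free W ->
  W u1 -> W u2 -> W u1' -> W u2' ->
  cyl (u1 ++ (u2 ++ c)) Z -> cyl (u1' ++ (u2' ++ c)) Z -> u1 = u1' /\ u2 = u2'.
Proof.
move=> pW W1 W2 W1' W2'; have tW := prefix_free_trivIset pW.
rewrite !cyl_cat => -[z1 [z2 _]] [z1' [z2' _]].
have e1 : u1 = u1' by apply: tW => //; exists Z.
by split => //; apply: tW => //; exists (shiftp (size u1) Z); split => //; rewrite e1.
Qed.

Lemma blocks_inj W c u1 u2 u1' u2' : prefix_free W ->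
  W u1 -> W u2 -> W u1' -> W u2' ->
  u1 ++ (u2 ++ c) = u1' ++ (u2' ++ c) -> u1 = u1' /\ u2 = u2'.
Proof.
move=> pW W1 W2 W1' W2' e.
have z := @cyl_path_of (u1 ++ (u2 ++ c)).
have z' : cyl (u1' ++ (u2' ++ c)) (path_of (u1 ++ (u2 ++ c))) by rewrite -e.
exact: blocks_trivIset pW W1 W2 W1' W2' z z'.
Qed.

Lemma blocks_prefix_free W c : prefix_free W -> prefix_free (blocks W c).
Proof.
move=> pW; apply: trivIset_prefix_free.
move=> _ _ [u1 [u2 [W1 W2 ->]]] [u1' [u2' [W1' W2' ->]]] [Z [z z']].
by have [-> ->] := blocks_trivIset pW W1 W2 W1' W2' z z'.
Qed.

Lemma prefix_free_sub W W' : W `<=` W' -> prefix_free W' -> prefix_free W.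
Proof. by move=> WW' pf s u /WW' Ws /WW' Wu; exact: pf. Qed.

Lemma reached_intro (R : realType) (h : V -> R) n s u :
  (forall k, (k <= size s)%N -> 0 <= h (wsum (take k s))) ->
  n <= h (wsum s) -> reached h n (s ++ u).
Proof.
move=> s0 ns.
have ex : exists k, `[< (k <= size s)%N /\ n <= h (wsum (take k s)) >].
  by exists (size s); apply/asboolP; rewrite take_size.
have [k /asboolP[ks nk] kmin] := ex_minnP ex.
have tk j : (j <= k)%N -> take j (s ++ u) = take j s.
  move=> jk; rewrite take_cat; case: ltnP => // sj.
  have jE : j = size s by apply/eqP; rewrite eqn_leq sj (leq_trans jk ks).
  by rewrite jE subnn take0 cats0 take_size.
exists k; first by rewrite size_cat (leq_trans ks) ?leq_addr.
rewrite tk//; split => // j; rewrite size_takel// => jk; rewrite take_takel//.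
- by apply: s0; exact: leq_trans ks.
- rewrite ltNge; apply/negP => nj; have : (k <= j)%N.
    by apply: kmin; apply/asboolP; split => //; exact: leq_trans (ltnW jk) ks.
  by rewrite leqNgt jk.
- exact: ltnW.
Qed.

End block_words.

Section opposite_directions.
Context {d : nat} {R : realType}.
Local Notation V := (site d).
Local Notation E := (borel (environment d R)).
Implicit Types (s u : seq V) (x y v : V).
Context (P : probability E R) (P_iid : iid P (@local_env d R)).
Local Notation weight := (weight P).
Local Notation ann := (annealed_inc P 0).
Variables (f t : V -> R).
Hypothesis fD : forall x y, f (x + y) = f x + f y.
Local Notation g := (fun x => - f x).
Variable r : R.

Let gD x y : g (x + y) = g x + g y.
Proof. by rewrite /= fD opprD. Qed.

Section crossing_walks.
Variables (v v' : V) (k k' : nat).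
Hypotheses (fv : 0 < f v) (fv' : 0 < - f v').
Variables (nb : seq V) (p b : R).
Hypothesis p0 : 0 < p.
Hypothesis nbP : forall c, c \in nb -> exists2 s, p <= weight s &
  wsum s = - c /\ {subset departures c s <= nb}.
Hypothesis nb0 : 0 \in nb.
Hypothesis nb_bound : forall x, x \in nb -> `|f x| <= b.
Variables (L n : R) (y : V).
Hypothesis L0 : 0 < L.
Hypothesis yL : 3 * L + 2 * r <= f y <= 3 * L + 4 * r.
Hypothesis nL : n + f v *+ k + (- f v') *+ k' + 2 * b <= L.

Let U := [set u | up_words f L u /\ bounded_steps f t r u].
Let W := [set u | up_words g L u /\ bounded_steps f t r u].
Let cx := nseq k v.
Let cy := nseq k' v'.

Definition site_on s x : Prop := exists2 i, (i <= size s)%N & x = wsum (take i s).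

Definition near s x : Prop := exists2 a, site_on s a & x - a \in nb.

Definition meeting : set (seq V * seq V) :=
  [set q | [/\ blocks U cx q.1, blocks W cy q.2 &
     exists2 j, (j <= size q.2)%N & near q.1 (y + wsum (take j q.2))]].

(** The second walk stops as soon as it is near s, before it hits a site of s:
    the part of the environment near s is then still unknown to it. *)
Let stop s : set (seq V) := [set u | first_in [set u | near s (y + wsum u)] u /\
  exists2 e, meeting (s, e) & u = take (size u) e].

Let pfU : prefix_free U.
Proof. by apply: (prefix_free_sub _ (@up_words_prefix_free _ _ f L)) => u []. Qed.

Let pfW : prefix_free W.
Proof. by apply: (prefix_free_sub _ (@up_words_prefix_free _ _ g L)) => u []. Qed.

Let L0' : 0 <= L. Proof. exact: ltW. Qed.

Lemma up_blocks s : blocks U cx s ->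
  upward f s /\ f (wsum s) <= 2 * L + 2 * r + f v *+ k.
Proof.
move=> [u1 [u2 [[U1 b1] [U2 b2] ->]]]; split.
  apply: (upward_cat fD); first exact: up_words_upward U1.
  exact: (runway_upward fD k L0' U2 fv).
have h1 : f (wsum u1) <= L + r by apply: (up_words_overshoot fD L0 _ U1) => x /b1[].
have h2 : f (wsum u2) <= L + r by apply: (up_words_overshoot fD L0 _ U2) => x /b2[].
by rewrite !wsum_cat !fD nseq_wsum (additive_mulrn fD); lra.
Qed.

Lemma down_blocks s : blocks W cy s ->
  upward g s /\ - f (wsum s) <= 2 * L + 2 * r + (- f v') *+ k'.
Proof.
move=> [u1 [u2 [[U1 b1] [U2 b2] ->]]]; split.
  apply: (upward_cat gD); first exact: up_words_upward U1.
  exact: (runway_upward gD k' L0' U2 fv').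
have h1 : - f (wsum u1) <= L + r.
  by apply: (up_words_overshoot gD L0 _ U1) => x /b1[]; rewrite normrN.
have h2 : - f (wsum u2) <= L + r.
  by apply: (up_words_overshoot gD L0 _ U2) => x /b2[]; rewrite normrN.
have h3 : - f (wsum cy) = (- f v') *+ k'.
  by rewrite nseq_wsum; exact: (additive_mulrn gD).
by rewrite !wsum_cat !fD; lra.
Qed.

Lemma stop_prefix_free s : prefix_free (stop s).
Proof.
apply: (prefix_free_sub _ (first_in_prefix_free (W := [set u | near s (y + wsum u)]))).
by move=> u [].
Qed.

Lemma meeting_mass s : (mass P [set e | meeting (s, e)] <= mass P (stop s))%E.
Proof.
rewrite -!(mass_starts P_iid 0); last 2 first.
- exact: stop_prefix_free.
- have mW : [set e | meeting (s, e)] `<=` blocks W cy by move=> e [_ We _].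
  exact: (prefix_free_sub mW (blocks_prefix_free pfW)).
apply: le_measure; rewrite ?inE; [exact: measurable_starts..|].
move=> Z [e me eZ]; have [_ _ [j je nj]] := me.
have [i [ij fi]] := @first_inP _ [set u | near s (y + wsum u)] (take j e) nj.
exists (take i (take j e)); last by apply: cyl_take; exact: cyl_take.
split => //; exists e => //.
rewrite size_takel//; rewrite size_takel// in ij.
by rewrite take_takel.
Qed.

(** The word u has stayed away from the neighbourhood of s, and q remains in
    this neighbourhood without departing from a site of s. So s, u and q use
    disjoint parts of the environment. By the choice of n, both walks have
    moved vertically by n before the meeting. *)
Lemma forced_path s u : blocks U cx s -> stop s u -> exists q,
  [/\ p <= weight q, reached g n (u ++ q),
      exists2 i, (i <= size s)%N & reached f n (take i s) /\
        y + wsum (u ++ q) = wsum (take i s) &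
      ((weight s * weight u * weight q)%:E =
       \int[P]_w (path_prob w 0%R s * path_prob w y (u ++ q))%:E)%E].
Proof.
move=> Us [[nu ufirst] [e [_ We _] uE]].
have [a Sa ya] := nu.
have [q [pq Sq nq dq]] := walk_to P_iid nbP nb0 Sa ya.
have [us uH] := up_blocks Us; have [ue eH] := down_blocks We.
have [i is_ iE] := Sq; have [ia ias aE] := Sa.
have /andP[fa1 fa2] : 0 <= f a <= f (wsum s) by rewrite aE; exact: upward_take.
have u_pos j : (j <= size u)%N -> 0 <= - f (wsum (take j u)).
  by move=> ju; rewrite uE take_takel//; have /andP[] := upward_take j ue.
have ule : - f (wsum u) <= - f (wsum e).
  by rewrite uE; have /andP[] := upward_take (size u) ue.
have bya := nb_bound ya; have bq := nb_bound nq.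
move: bya bq; rewrite !(additiveB fD) !fD !ler_norml => /andP[ya1 ya2] /andP[q1 q2].
have /andP[yL1 yL2] := yL.
have fvk : 0 <= f v *+ k by rewrite mulrn_wge0// ltW.
have fvk' : 0 <= (- f v') *+ k' by rewrite mulrn_wge0// ltW.
exists q; split => //.
- apply: reached_intro => //.
  move: ((- f v') *+ k') (f v *+ k) fvk' nL fvk uH => x1 x2 ? ? ? ?; lra.
- exists i => //; split; last by rewrite wsum_cat addrA.
  rewrite -(cats0 (take i s)); apply: reached_intro => [j|].
    by move=> _; rewrite -take_min; have /andP[] := upward_take (minn j i) us.
  rewrite -iE !fD.
  move: ((- f v') *+ k') (f v *+ k) fvk' nL fvk eH => x1 x2 ? ? ? ?; lra.
- have s_on x : x \in departures 0 s -> site_on s x.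
    by move=> /departuresP[j js ->]; exists j; rewrite ?add0r// ltnW.
  have u_far x : x \in departures y u -> ~ near s x.
    move=> /departuresP[j ju ->] near_j; apply: (ufirst j ju); exact: near_j.
  rewrite (weight_indep P_iid)//; last first.
    move=> x /s_on Sx; apply/negP; rewrite departures_cat mem_cat => /orP[/u_far|/dq[]//].
    by apply; exists x => //; rewrite subrr.
  rewrite (weight_cat P_iid) ?mulrA// => x xu; apply/negP => xq.
  have yx : y + x \in departures y u by rewrite departures_shift addrC addKr.
  have yxq : y + x \in departures (y + wsum u) q.
    rewrite departures_shift; rewrite departures_shift in xq.
    by rewrite opprD addrACA subrr add0r.
  by apply: (u_far _ yx); exists a => //; have [] := dq _ yxq.
Qed.

(** At the cost of a factor p, the second walk is prolonged by [forced_path]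
    until it hits the first one, and [two_walks_bound] applies. *)
Lemma meeting_bound :
  (p%:E * wmass (fun q => weight q.1 * weight q.2)%R meeting <=
   2%:E * ann (starts (up_words f n) `\` transient f) +
   2%:E * ann (starts (up_words g n) `\` transient g))%E.
Proof.
have /choice[F FP] s : exists F, forall u, blocks U cx s -> stop s u ->
    [/\ p <= weight (F u), reached g n (u ++ F u),
      exists2 i, (i <= size s)%N & reached f n (take i s) /\
        y + wsum (u ++ F u) = wsum (take i s) &
      ((weight s * weight u * weight (F u))%:E =
       \int[P]_w (path_prob w 0%R s * path_prob w y (u ++ F u))%:E)%E].
  have /choice[F FP] u : exists q, blocks U cx s -> stop s u ->
    [/\ p <= weight q, reached g n (u ++ q),
      exists2 i, (i <= size s)%N & reached f n (take i s) /\
        y + wsum (u ++ q) = wsum (take i s) &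
      ((weight s * weight u * weight q)%:E =
       \int[P]_w (path_prob w 0%R s * path_prob w y (u ++ q))%:E)%E].
    have [Us|nUs] := pselect (blocks U cx s); last by exists [::].
    have [su|nsu] := pselect (stop s u); last by exists [::].
    by have [q qP] := forced_path Us su; exists q.
  by exists F.
apply: le_trans (two_walks_bound P_iid fD (WX := blocks U cx) (WY := stop) (y := y)
  (F := fun s u => u ++ F s u) _ _ _ _); last first.
- by move=> s u Us su; have [_ _ [i] ? []] := FP s u Us su; exists i.
- by move=> s u Us su; have [] := FP s u Us su.
- move=> s Us u u' su su' [Z [uZ u'Z]].
  apply: (prefix_free_trivIset (@stop_prefix_free s)) => //; exists Z.
  by move: uZ u'Z; rewrite !cyl_cat => -[? _] [].
- by apply: blocks_prefix_free; exact: pfU.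
have wt0 s : (0 <= (weight s)%:E)%E by rewrite lee_fin weight_ge0.
rewrite /wmass -esumZl ?(ltW p0)//; last by move=> q; rewrite lee_fin mulr_ge0// weight_ge0.
apply: (@le_trans _ _ (\esum_(s in blocks U cx)
    (p%:E * ((weight s)%:E * mass P [set e | meeting (s, e)])))%E).
  have mE s : (p%:E * ((weight s)%:E * mass P [set e | meeting (s, e)]))%E =
      \esum_(e in [set e | meeting (s, e)]) (p%:E * ((weight s)%:E * (weight e)%:E))%E.
    rewrite /mass -esumZl ?weight_ge0// -esumZl ?(ltW p0)// => e.
    exact: mule_ge0.
  rewrite (eq_esum (fun s _ => mE s)) esum_esum; last first.
    by move=> s e _ _; rewrite !mule_ge0// lee_fin ltW.
  apply: esum_le_sub => [q|[s e] me].
    by rewrite -EFinM lee_fin !mulr_ge0 ?weight_ge0// ltW.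
  by split => //; case: me.
apply: le_esum => s Us.
apply: (@le_trans _ _ (p%:E * ((weight s)%:E * mass P (stop s)))%E).
  apply: lee_wpmul2l; first by rewrite lee_fin ltW.
  by apply: lee_wpmul2l => //; exact: meeting_mass.
rewrite /mass -esumZl ?weight_ge0// -esumZl ?(ltW p0)//; last by move=> u; rewrite mule_ge0.
apply: le_esum => u su; have [pq _ _ <-] := FP s u Us su.
rewrite -!EFinM lee_fin mulrC ler_wpM2l// mulr_ge0// weight_ge0//.
Qed.

End crossing_walks.

(** * Exclusion of two opposite directions *)

Hypothesis P_sink : {ae P, forall w : environment d R, exists c, forall x, reachable w x c}.
Hypothesis tD : forall x y, t (x + y) = t x + t y.
Hypothesis r0 : 0 <= r.
Hypothesis weight_bounded : forall s, 0 < weight s -> bounded_steps f t r s.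
Hypothesis box_finite : forall K : R, exists B : seq V,
  forall x, `|f x| <= K -> `|t x| <= K -> x \in B.
Hypothesis approx : forall a b : R, exists2 x, `|f x - a| <= r & `|t x - b| <= r.

Lemma f_nonzero : exists x, f x != 0.
Proof.
have [x + _] := approx (r + 1) 0; rewrite ler_norml => /andP[h _].
by exists x; rewrite gt_eqF//; lra.
Qed.

Lemma t_unbounded : exists D : R, forall T : R, exists2 u, 0 <= f u <= D & T <= `|t u|.
Proof.
exists (2 * r) => T; have [u] := approx r (`|T| + r).
rewrite !ler_norml => /andP[h1 h2] /andP[h3 h4]; exists u; first by lra.
have := ler_norm T; have := ler_norm (t u); lra.
Qed.

(** Words of positive weight only contain bounded steps, hence
    [quadruple_meet] applies to the quadruples of positive weight. The two
    runways multiply the weight by a constant. *)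
Lemma quadruple_meeting_mass (v v' : V) (k k' : nat) (L N c z : R) (y : V) nb :
  0 < f v -> 0 < - f v' -> 0 < weight [:: v] -> 0 < weight [:: v'] ->
  4 * r <= f v *+ k -> 4 * r <= (- f v') *+ k' ->
  (forall x, `|f x| <= 4 * r -> `|t x| <= 4 * r -> x \in nb) ->
  0 < L -> 3 * L + 2 * r <= f y <= 3 * L + 4 * r -> `|t y - z| <= r ->
  r * (1 + (k + k')%:R) < N / 4 ->
  (c%:E <= wmass (fun q : seq V * seq V * seq V * seq V =>
      weight q.1.1.1 * weight q.1.1.2 * weight q.1.2 * weight q.2)%R
    [set q | [/\ up_words f L q.1.1.1, up_words f L q.1.1.2, up_words g L q.1.2 &
         up_words g L q.2] /\
      between (N / 4) z
        (t (wsum q.1.1.1) - t (wsum q.1.2) + t (wsum q.1.1.2))%R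
        (t (wsum q.1.1.1) - t (wsum q.1.2) - t (wsum q.2))%R])%E ->
  ((weight [:: v] ^+ k * weight [:: v'] ^+ k' * c)%:E <=
    wmass (fun q : seq V * seq V => weight q.1 * weight q.2)%R
      (meeting v v' k k' nb L y))%E.
Proof.
move=> fv fv' wv wv' kr kr' nb_box L0 yL ty rN.
have L0' := ltW L0.
pose h (q : seq V * seq V * seq V * seq V) := weight q.1.1.1 * weight q.1.1.2 * weight q.1.2 * weight q.2.
rewrite -/h; set Q := [set q | _]; move=> cQ.
have h0 q : 0 <= h q by rewrite !mulr_ge0// weight_ge0.
have QE : (wmass h Q <= wmass h (Q `&` [set q | (0 < h q)%R]))%E.
  rewrite {1}/wmass (esumID [set q | (0 < h q)%R]); last first.
    by move=> q _; rewrite lee_fin.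
  rewrite [X in (_ + X)%E]esum1 ?adde0// => q [_ /negP]; rewrite -leNgt => hq.
  by congr EFin; apply/eqP; rewrite eq_le hq h0.
have k0 : 0 <= weight [:: v] ^+ k * weight [:: v'] ^+ k' by rewrite mulr_ge0// exprn_ge0// weight_ge0.
apply: (@le_trans _ _ ((weight [:: v] ^+ k * weight [:: v'] ^+ k')%:E *
    wmass h (Q `&` [set q | (0 < h q)%R]))%E).
  by rewrite EFinM; apply: lee_wpmul2l => //; exact: le_trans QE.
rewrite /wmass -esumZl//.
pose bl (q : seq V * seq V * seq V * seq V) :=
  (q.1.1.1 ++ (q.1.1.2 ++ nseq k v), q.1.2 ++ (q.2 ++ nseq k' v')).
have pos q : 0 < h q -> [/\ 0 < weight q.1.1.1, 0 < weight q.1.1.2, 0 < weight q.1.2 & 0 < weight q.2].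
  rewrite /h => hq; split; rewrite lt0r weight_ge0 andbT; apply: contraTneq hq => ->;
    by rewrite ?(mul0r, mulr0) ltxx.
apply: (@esum_le_inj _ _ _ _ _ _ _ bl).
- by move=> q; rewrite -EFinM lee_fin mulr_ge0.
- by move=> q; rewrite lee_fin mulr_ge0// weight_ge0.
- move=> [[[u1 u2] v3] v2] [[[U1 U2 V3 V2] bet] hq] /=.
  have [p1 p2 p3 p4] := pos _ hq.
  split; first by exists u1, u2; split => //; split => //; exact: weight_bounded.
    by exists v3, v2; split => //; split => //; exact: weight_bounded.
  have bv : bounded_steps f t r [:: v] by exact: weight_bounded.
  have bv' : bounded_steps f t r [:: v'] by exact: weight_bounded.
  have [i [j [ii jj hf ht]]] := quadruple_meet fD tD r0 fv fv' bv bv' kr kr' L0 yL ty rN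
    U1 U2 V3 V2 (weight_bounded p1) (weight_bounded p2) (weight_bounded p3) (weight_bounded p4) bet.
  exists j; first by rewrite !size_cat size_nseq.
  exists (wsum (take i (u1 ++ (u2 ++ nseq k v)))); last exact: nb_box.
  by exists i => //; rewrite !size_cat size_nseq.
- move=> [[[u1 u2] v3] v2] [[[u1' u2'] v3'] v2'].
  rewrite !inE => -[[[U1 U2 V3 V2] _] _] [[[U1' U2' V3' V2'] _] _] [e1 e2].
  move: U1 U2 V3 V2 U1' U2' V3' V2' => /= U1 U2 V3 V2 U1' U2' V3' V2'.
  have [-> ->] := blocks_inj (@up_words_prefix_free _ _ f L) U1 U2 U1' U2' e1.
  by have [-> ->] := blocks_inj (@up_words_prefix_free _ _ g L) V3 V2 V3' V2' e2.
- move=> [[[u1 u2] v3] v2] [[[U1 U2 V3 V2] _] _] /=.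
  rewrite -EFinM lee_fin /h /=.
  have wX : weight (u1 ++ (u2 ++ nseq k v)) = weight u1 * (weight u2 * weight [:: v] ^+ k).
    rewrite (weight_upward_cat fD P_iid); last 2 first.
    - exact: up_words_upward U1.
    - exact: (runway_upward fD k L0' U2 fv).
    rewrite (weight_upward_cat fD P_iid) ?(weight_nseq fD P_iid)//; last exact: upward_nseq.
    exact: up_words_upward U2.
  have wY : weight (v3 ++ (v2 ++ nseq k' v')) = weight v3 * (weight v2 * weight [:: v'] ^+ k').
    rewrite (weight_upward_cat gD P_iid); last 2 first.
    - exact: up_words_upward V3.
    - exact: (runway_upward gD k' L0' V2 fv').
    rewrite (weight_upward_cat gD P_iid) ?(weight_nseq gD P_iid)//; last exact: upward_nseq.
    exact: up_words_upward V2.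
  by rewrite wX wY le_eqVlt; apply/orP; left; apply/eqP; ring.
Qed.

(** The lower bound given by [quadruple_meeting_mass] does not depend on L,
    while the upper bound given by [meeting_bound] vanishes as L grows. *)
Lemma no_opposite_transience : ann (transient f) != 0%E -> ann (transient g) = 0%E.
Proof.
move=> A0; apply/eqP; apply: contraT => B0.
have [v fv wv] := positive_step P_iid P_sink fD f_nonzero.
have g_nonzero : exists x, g x != 0.
  by have [x] := f_nonzero; exists x; rewrite oppr_eq0.
have [v' fv' wv'] := positive_step P_iid P_sink gD g_nonzero.
have a_pos := up_mass_pos P_iid fD A0; have b_pos := up_mass_pos P_iid gD B0.
have [a1 a1_gt0 a1P] := a_pos; have [a2 a2_gt0 a2P] := b_pos.
pose a0 := Num.min a1 a2.
have a0_gt0 : 0 < a0 by rewrite lt_min a1_gt0.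
have pf (h : V -> R) L := @up_words_prefix_free d R h L.
have fP L : (a0%:E <= mass P (up_words f L))%E.
  rewrite -(mass_starts P_iid 0 (pf f L)); apply: le_trans (a1P L).
  by rewrite lee_fin ge_min lexx.
have gP L : (a0%:E <= mass P (up_words g L))%E.
  rewrite -(mass_starts P_iid 0 (pf g L)); apply: le_trans (a2P L).
  by rewrite lee_fin ge_min lexx orbT.
have [k /ltW kr] := multiple_above (4 * r) fv.
have [k' /ltW kr'] := multiple_above (4 * r) fv'.
(* the lateral margin N / 4 exceeds what happens on the runways *)
pose N := 4 * (r * (1 + (k + k')%:R)) + 4.
have rN0 : 0 <= r * (1 + (k + k')%:R) by rewrite mulr_ge0// addr_ge0.
have rN : r * (1 + (k + k')%:R) < N / 4 by rewrite /N; lra.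
have N0 : 0 < N by rewrite /N; lra.
have [a' a'0 [L0 L0P]] := spread P_iid P_sink fD tD fv wv t_unbounded a0_gt0 fP N.
pose a := Num.min a' (a0 / 2).
have a_gt0 : 0 < a by rewrite lt_min a'0 divr_gt0.
have aa0 : 2 * a <= a0.
  have : a <= a0 / 2 by rewrite ge_min lexx orbT.
  lra.
have [B BP] := box_finite (4 * r).
have [nb [p p0 [Bnb nb0 nbP]]] := neighbourhood P_iid P_sink B.
have nb_box x : `|f x| <= 4 * r -> `|t x| <= 4 * r -> x \in nb.
  by move=> fx tx; apply: Bnb; exact: BP.
have [b bP] : exists b : R, forall x, x \in nb -> `|f x| <= b.
  exists (\sum_(x <- nb) `|f x|) => x xnb.
  by rewrite (big_rem x)//= lerDl sumr_ge0.
pose c := a0 ^+ 3 * a / 264.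
have c0 : 0 < c by rewrite divr_gt0// mulr_gt0// exprn_gt0.
pose p2 := weight [:: v] ^+ k * weight [:: v'] ^+ k'.
have p20 : 0 < p2 by rewrite mulr_gt0// exprn_gt0.
(* 4 e is half the lower bound of the meeting *)
pose e := p * (p2 * c) / 8.
have e0 : 0 < e.
  by apply: divr_gt0 => //; apply: mulr_gt0 => //; exact: mulr_gt0.
have [n1 n1P] := reach_not_transient_small P_iid fD a_pos e0.
have [n2 n2P] := reach_not_transient_small P_iid gD b_pos e0.
pose n : R := Num.max n1%:R n2%:R.
pose L : R := Num.max (n + f v *+ k + (- f v') *+ k' + 2 * b) (Num.max L0 1).
have nL : n + f v *+ k + (- f v') *+ k' + 2 * b <= L by rewrite le_max lexx.
have L0L : L0 <= L by rewrite !le_max lexx orbT.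
have Lgt0 : 0 < L by rewrite !lt_max ltr01 !orbT.
have spN (x : R) : (a%:E <= wmass weight
    [set s | up_words f L s /\ (N < `|t (wsum s) - x|)%R])%E.
  by apply: le_trans (L0P L L0L x); rewrite lee_fin ge_min lexx.
have [z zP] := between_quadruples (T := seq V) (p := t \o @wsum d) (fun s => - t (wsum s))
  (fun s => weight_ge0 P s) N0 a_gt0 aa0 (fP L) (mass_le1 P_iid (pf f L))
  (gP L) (mass_le1 P_iid (pf g L)) spN.
have [y fy ty] := approx (3 * L + 3 * r) z.
have yL : 3 * L + 2 * r <= f y <= 3 * L + 4 * r.
  by move: fy; rewrite ler_norml => /andP[h1 h2]; apply/andP; split; lra.
have low := quadruple_meeting_mass fv fv' wv wv' kr kr' nb_box Lgt0 yL ty rN zP.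
have up := meeting_bound fv fv' p0 nbP nb0 bP Lgt0 yL nL.
have : ((p * (p2 * c))%:E <= (4 * e)%:E)%E.
  apply: (@le_trans _ _ (2%:E * e%:E + 2%:E * e%:E)%E); last first.
    by rewrite -EFinM -EFinD lee_fin; lra.
  apply: (@le_trans _ _ (p%:E * wmass (fun q : seq V * seq V => weight q.1 * weight q.2)%R
      (meeting v v' k k' nb L y))%E).
    by rewrite EFinM; apply: lee_wpmul2l; [rewrite lee_fin ltW|exact: low].
  apply: le_trans up _; apply: leeD; apply: lee_wpmul2l => //.
    by apply: n1P; rewrite le_max lexx.
  by apply: n2P; rewrite le_max lexx orbT.
rewrite lee_fin /e; have : 0 < p * (p2 * c) by apply: mulr_gt0 => //; exact: mulr_gt0.
lra.
Qed.

End opposite_directions.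

(** * The plane *)

Section sink.
Context {d : nat} {R : realType}.
Implicit Types (w : environment d R).

Lemma reachable_trans w (x y z : site d) :
  reachable w x y -> reachable w y z -> reachable w x z.
Proof.
move=> [s ps <-] [u pu <-]; exists (s ++ u); last by rewrite last_cat.
by rewrite cat_path ps.
Qed.

Lemma unique_class_sink w : unique_infinite_class_reachable w ->
  exists c, forall x, reachable w x c.
Proof.
move=> [C CE CP].
have [[c cE] _] : infinite_communicating_classes w C by rewrite CE.
exists c => x; have [y] := CP x; rewrite cE => -[_ yc] xy.
exact: reachable_trans yc.
Qed.

End sink.

Section plane.
Context {R : realType}.
Local Notation i1 := (lift ord0 ord0 : 'I_2).
Implicit Types (l : 'rV[R]_2) (v : site 2).

Lemma dot2E (u w : 'rV[R]_2) : dot u w = u 0 0 * w 0 0 + u 0 i1 * w 0 i1.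
Proof. by rewrite /dot big_ord_recl big_ord1. Qed.

Lemma level2E l v : level l v = (v 0 0)%:~R * l 0 0 + (v 0 i1)%:~R * l 0 i1.
Proof. by rewrite /level dot2E !mxE. Qed.

Definition orthogonal_vec l : 'rV[R]_2 :=
  \row_i (if i == 0 then - l 0 i1 else l 0 0).

Lemma level_orthogonalE l v :
  level (orthogonal_vec l) v = (v 0 i1)%:~R * l 0 0 - (v 0 0)%:~R * l 0 i1.
Proof. by rewrite level2E !mxE/= mulrN addrC. Qed.

Lemma unit_sphere2E l : l \in unit_sphere 2 R -> l 0 0 ^+ 2 + l 0 i1 ^+ 2 = 1.
Proof.
rewrite inE /unit_sphere /= /enorm dot2E -!expr2 => e.
by rewrite -[LHS]sqr_sqrtr ?addr_ge0 ?sqr_ge0// e expr1n.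
Qed.

Lemma unit_coord_le1 l i : l 0 0 ^+ 2 + l 0 i1 ^+ 2 = 1 -> `|l 0 i| <= 1.
Proof.
move=> e; rewrite -(ler_pXn2r (n := 2))// ?nnegrE// expr1n real_normK ?num_real//.
have [->|->] : i = 0 \/ i = i1.
  by case: (unliftP 0 i) => [j|] ->; [right; rewrite (ord1 j)|left].
  by rewrite -e lerDl sqr_ge0.
by rewrite -e lerDr sqr_ge0.
Qed.

Section unit_vector.
Variable l : 'rV[R]_2.
Hypothesis l1 : l 0 0 ^+ 2 + l 0 i1 ^+ 2 = 1.
Local Notation f := (level l).
Local Notation t := (level (orthogonal_vec l)).

Lemma level_sqrD v : f v ^+ 2 + t v ^+ 2 = enorm (site_vec R v) ^+ 2.
Proof.
rewrite /enorm sqr_sqrtr; last by rewrite dot2E -!expr2 addr_ge0 ?sqr_ge0.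
rewrite level2E level_orthogonalE dot2E !mxE.
rewrite -[RHS]mul1r -l1; ring.
Qed.

Lemma level_le_enorm v : `|f v| <= enorm (site_vec R v) /\ `|t v| <= enorm (site_vec R v).
Proof.
have e0 : 0 <= enorm (site_vec R v) by exact: sqrtr_ge0.
by split; rewrite -(ler_pXn2r (n := 2))// ?nnegrE// real_normK ?num_real//;
  rewrite -level_sqrD ?lerDl ?lerDr sqr_ge0.
Qed.

Lemma level_coord v : (v 0 0)%:~R = f v * l 0 0 - t v * l 0 i1 /\
  (v 0 i1)%:~R = f v * l 0 i1 + t v * l 0 0.
Proof.
rewrite level2E level_orthogonalE.
by split; rewrite -[LHS]mulr1 -l1; ring.
Qed.

Lemma bounded_levels_finite (K : R) : exists B : seq (site 2),
  forall v, `|f v| <= K -> `|t v| <= K -> v \in B.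
Proof.
have [n nK] := multiple_above (2 * K) ltr01.
pose I := [seq (k%:Z - n%:Z)%R | k <- iota 0 (n + n).+1].
pose mk (a b : int) : site 2 := \row_i (if i == 0 then a else b).
exists [seq mk a b | a <- I, b <- I] => v fK tK.
have la i : `|l 0 i| <= 1 by exact: unit_coord_le1.
have prod_le (x y : R) : `|x| <= K -> `|y| <= 1 -> `|x * y| <= K.
  by move=> xK y1; rewrite normrM -[K]mulr1 ler_pM.
have inI (a : int) : `|a%:~R : R| <= 2 * K -> a \in I.
  move=> aK; have an : `|a| < n%:Z.
    by rewrite -(ltr_int R) intr_norm; exact: le_lt_trans aK nK.
  apply/mapP; exists (absz (a + n%:Z)); first by rewrite mem_iota; lia.
  by lia.
have [v0 v1] := level_coord v.
rewrite (_ : v = mk (v 0 0) (v 0 i1)); last first.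
  apply/rowP => i; rewrite !mxE; case: (unliftP 0 i) => [j|] -> //=.
  by rewrite (ord1 j).
apply/allpairsP; exists (v 0 0, v 0 i1); split => //=; apply: inI.
  rewrite v0; apply: le_trans (ler_normB _ _) _.
  by have := prod_le _ _ fK (la 0); have := prod_le _ _ tK (la i1); lra.
rewrite v1; apply: le_trans (ler_normD _ _) _.
by have := prod_le _ _ fK (la i1); have := prod_le _ _ tK (la 0); lra.
Qed.

(** Round down the coordinates of the point of the plane with f = a and t =
    b. *)
Lemma levels_approx (a b : R) : exists2 v : site 2, `|f v - a| <= 2 & `|t v - b| <= 2.
Proof.
pose x := a * l 0 0 - b * l 0 i1; pose y := a * l 0 i1 + b * l 0 0.
pose v : site 2 := \row_i (if i == 0 then Num.floor x else Num.floor y).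
have prod_le (p q : R) : `|p| <= 1 -> `|q| <= 1 -> `|p * q| <= 1.
  by move=> p1 q1; rewrite normrM -[leRHS]mulr1 ler_pM.
have fl (z : R) : `|(Num.floor z)%:~R - z| <= 1.
  by have /andP[] := floor_itv z; rewrite intrD ler_norml => h1 h2; apply/andP; split; lra.
have la i : `|l 0 i| <= 1 by exact: unit_coord_le1.
have ae : a = x * l 0 0 + y * l 0 i1.
  by rewrite -[LHS]mulr1 -l1 /x /y; ring.
have be : b = y * l 0 0 - x * l 0 i1.
  by rewrite -[LHS]mulr1 -l1 /x /y; ring.
exists v; rewrite ?level2E ?level_orthogonalE !mxE/=.
  rewrite ae (_ : _ - _ = ((Num.floor x)%:~R - x) * l 0 0 + ((Num.floor y)%:~R - y) * l 0 i1);
    last by ring.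
  apply: le_trans (ler_normD _ _) _.
  by have := prod_le _ _ (fl x) (la 0); have := prod_le _ _ (fl y) (la i1); lra.
rewrite be (_ : _ - _ = ((Num.floor y)%:~R - y) * l 0 0 - ((Num.floor x)%:~R - x) * l 0 i1);
  last by ring.
apply: le_trans (ler_normB _ _) _.
by have := prod_le _ _ (fl y) (la 0); have := prod_le _ _ (fl x) (la i1); lra.
Qed.

End unit_vector.

Lemma positive_words_bounded (P : probability (borel (environment 2 R)) R) l r :
  iid P (@local_env 2 R) -> l 0 0 ^+ 2 + l 0 i1 ^+ 2 = 1 ->
  {ae P, forall w : environment 2 R,
    forall x y : site 2, r < enorm (site_vec R (x - y)) -> w (x, y) = 0} ->
  forall s, 0 < weight P s -> bounded_steps (level l) (level (orthogonal_vec l)) r s.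
Proof.
move=> P_iid l1 P_range s /(weight_pos_witness P_iid P_range)[w wr].
have enormN (v : site 2) : enorm (site_vec R (- v)) = enorm (site_vec R v).
  by rewrite /enorm !dot2E !mxE !rmorphN/= !mulrNN.
elim: s (0 : site 2) => [//|v s IH] x /=.
rewrite lt0r mulf_eq0 negb_or => /andP[/andP[xv vs] _] u; rewrite inE => /orP[/eqP ->|].
  have vr : enorm (site_vec R v) <= r.
    rewrite leNgt; apply: contraNN xv => vr; apply/eqP/wr.
    by rewrite opprD addNKr enormN.
  by have [h1 h2] := level_le_enorm l1 v; split; exact: le_trans vr.
by apply: (IH (x + v)); rewrite lt0r vs path_prob_ge0.
Qed.

End plane.

Theorem theorem2p1 (R : realType)
    (P : probability (borel (environment 2 R)) R)
    (P_iid : iid P (@local_env 2 R))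
    (P_class : {ae P, forall w : environment 2 R,
      unique_infinite_class_reachable w})
    (P_range : exists2 r : R, 0 < r & {ae P, forall w : environment 2 R,
      forall x y : site 2, r < enorm (site_vec R (x - y)) -> w (x, y) = 0})
    (l : 'rV[R]_2) (l_unit : l \in unit_sphere 2 R) :
  annealed P 0 setT (directionally_transient l) = 0%E \/
  annealed P 0 setT (directionally_transient l) = 1%E.
Proof.
have P_sink : {ae P, forall w : environment 2 R, exists c, forall x, reachable w x c}.
  apply: filterS P_class; first exact: (@ae_filter_ringOfSetsType _ (borel (environment 2 R))).
  by move=> w; exact: unique_class_sink.
have l1 := unit_sphere2E l_unit.
have [r0 r0_gt0 r0P] := P_range; pose r := Num.max r0 2.
have [r_ge0 r_ge2 r0r] : [/\ 0 <= r, 2 <= r & r0 <= r].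
  by rewrite !le_max !lexx ler0n !orbT.
rewrite annealed_transientE.
have [->|fT] := eqVneq (annealed_inc P 0 (transient (level l))) 0%E; first by left.
right.
have bnd s : 0 < weight P s -> bounded_steps (level l) (level (orthogonal_vec l)) r s.
  move=> s0 v vs; have [h1 h2] := positive_words_bounded P_iid l1 r0P s0 vs.
  by split; exact: le_trans r0r.
have app a b : exists2 v, `|level l v - a| <= r & `|level (orthogonal_vec l) v - b| <= r.
  by have [v h1 h2] := levels_approx l1 a b; exists v; apply: le_trans r_ge2.
have fD := levelD l; have tD := levelD (orthogonal_vec l).
have [u u0] := f_nonzero app.
apply: (transient_one P_iid P_sink fD) => //; first by exists u.
exact: (no_opposite_transience P_iid fD P_sink tD r_ge0 bnd (bounded_levels_finite l1) app).
Qed.
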